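(* Let $(U,x)\rightsquigarrow(\tilde U,\tilde x)$ be a change of chart on $M$, and let $G\in\mathscr{C}_{\mathrm{spr}}(A|_{U\cap\tilde U})$, $N\in\mathscr{C}_{\mathrm{nl}}(A|_{U\cap\tilde U})$, $\Gamma\in\mathscr{C}_{\mathrm{anis}}(A|_{U\cap\tilde U})$. (i) Putting $$G=G^{(U,x)}-2Z^{(U,x)}=G^{(\tilde U,\tilde x)}-2Z^{(\tilde U,\tilde x)},$$ $$N=N^{(U,x)}-J^{(U,x)}=N^{(\tilde U,\tilde x)}-J^{(\tilde U,\tilde x)},$$ $$\Gamma=\Gamma^{(U,x)}+P^{(U,x)}=\Gamma^{(\tilde U,\tilde x)}+P^{(\tilde U,\tilde x)}$$ for unique $Z^{(U,x)},Z^{(\tilde U,\tilde x)}\in\mathrm{h}_2\mathcal{T}^1_0((U\cap\tilde U)_A)$, $J^{(U,x)},J^{(\tilde U,\tilde x)}\in\mathrm{h}_1\mathcal{T}^1_1((U\cap\tilde U)_A)$ and $P^{(U,x)},P^{(\tilde U,\tilde x)}\in\mathrm{h}_0\mathcal{T}^1_2((U\cap\tilde U)_A)$, one has that $$N^{(U,x)}-\dot\partial Z^{(U,x)}=N^{(\tilde U,\tilde x)}-\dot\partial Z^{(\tilde U,\tilde x)},$$ $$G^{(U,x)}-\imath_{\mathbb{C}}J^{(U,x)}=G^{(\tilde U,\tilde x)}-\imath_{\mathbb{C}}J^{(\tilde U,\tilde x)},\qquad\Gamma^{(U,x)}+\dot\partial J^{(U,x)}=\Gamma^{(\tilde U,\tilde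 x)}+\dot\partial J^{(\tilde U,\tilde x)},$$ $$N^{(U,x)}-\imath_{\mathbb{C}}P^{(U,x)}=N^{(\tilde U,\tilde x)}-\imath_{\mathbb{C}}P^{(\tilde U,\tilde x)},\qquad\dot\partial P^{(U,x)}=\dot\partial P^{(\tilde U,\tilde x)}.$$ (ii) Consequently, there appear well-defined maps $$\dot\partial_{\mathrm{spr}}\colon\mathscr{C}_{\mathrm{spr}}(A)\to\mathscr{C}_{\mathrm{nl}}(A),\quad\imath^{\mathrm{spr}}\colon\mathscr{C}_{\mathrm{nl}}(A)\to\mathscr{C}_{\mathrm{spr}}(A),\quad\dot\partial_{\mathrm{nl}}\colon\mathscr{C}_{\mathrm{nl}}(A)\to\mathscr{C}_{\mathrm{anis}}(A),$$ $$\imath^{\mathrm{nl}}\colon\mathscr{C}_{\mathrm{anis}}(A)\to\mathscr{C}_{\mathrm{nl}}(A),\quad\dot\partial_{\mathrm{anis}}\colon\mathscr{C}_{\mathrm{anis}}(A)\to\mathrm{h}_{-1}\mathcal{T}^1_3(M_A),$$ given on each $A|_U$, when $G$, $N$, $\Gamma$ are locally expressed as $G=G^{(U,x)}-2Z^{(U,x)}$, $N=N^{(U,x)}-J^{(U,x)}$, $\Gamma=\Gamma^{(U,x)}+P^{(U,x)}$, by $$\dot\partial_{\mathrm{spr}}G:=N^{(U,x)}-\dot\partial Z^{(U,x)},\quad\imath^{\mathrm{spr}}N:=G^{(U,x)}-\imath_{\mathbb{C}}J^{(U,x)},\quad\dot\partial_{\mathrm{nl}}N:=\Gamma^{(U,x)}+\dot\partial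 J^{(U,x)},$$ $$\imath^{\mathrm{nl}}\Gamma:=N^{(U,x)}-\imath_{\mathbb{C}}P^{(U,x)},\quad\dot\partial_{\mathrm{anis}}\Gamma:=\dot\partial P^{(U,x)}.$$
   Context: $M$ is a smooth (Hausdorff, second countable) $n$-dimensional manifold and $A\subseteq \mathrm{T}M\setminus\mathbf{0}$ is open with every fiber $A_p:=A\cap \mathrm{T}_pM$ ($p\in M$) nonempty and conic (closed under multiplication by $\lambda\in\mathbb{R}^+=(0,\infty)$). $\pi_A\colon A\to M$ is the natural projection, $A|_U:=A\cap\mathrm{T}U$, and $h_\lambda\colon A\to A$, $h_\lambda(v)=\lambda v$. All objects are smooth ($\mathcal{C}^\infty$). Anisotropic tensors: $\mathcal{T}^r_s(M_A)$ is the set of sections of $\pi_A^*(\mathrm{T}M^{\otimes r}\otimes\mathrm{T}^*M^{\otimes s})\to A$; $\mathrm{h}_\alpha\mathcal{T}^r_s(M_A)$ those whose components in natural coordinates $(x^i,y^i)$ satisfy $T(x,\lambda y)=\lambda^\alpha T(x,y)$ for $\lambda\in\mathbb{R}^+$; $\mathcal{T}^r_s(U_A)$ the analogous set over $A|_U$. The Liouville field is $\mathbb{C}=y^i\partial_{x^i}$; $(\dot\partial T)^{I}_{j_1\ldots j_sk}=\partial T^I_{j_1\ldots j_s}/\partial y^k$ and $(\imath_{\mathbb{C}}S)^I_{j_1\ldots j_s}=S^I_{j_1\ldots j_sa}y^a$. Let $\mathrm{V}A\subset\mathrm{T}A$ be the vertical bundle, identified with $\pi_A^*(\mathrm{T}M)$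 ($\partial_{y^i}\equiv\partial_{x^i}$). Let $\mathrm{S}A=\{\xi\in\mathrm{T}_vA: v\in A,\ \mathrm{d}(\pi_A)_v(\xi)=v\}$, an affine bundle over $A$ directed by $\mathrm{V}A$; $\mathrm{J}^1A=\{\eta\in\mathrm{Hom}(\mathrm{T}_{\pi(v)}M,\mathrm{T}_vA): v\in A,\ \mathrm{d}(\pi_A)_v\circ\eta=\mathrm{Id}\}$, affine directed by $\pi_A^*(\mathrm{T}^*M\otimes\mathrm{T}M)$; and $\mathrm{C}M\to M$ the bundle of affine connections, with $\mathrm{C}_pM$ the set of affine connections on $M$ modulo having equal Christoffel symbols at $p$, affine directed by $\mathrm{T}M\otimes\mathrm{T}^*M\otimes\mathrm{T}^*M$. $\mathscr{C}_{\mathrm{spr}}(A)$: sprays, i.e. sections $G\colon A\to\mathrm{S}A$ with $G_{\lambda v}=\lambda\,\mathrm{d}(h_\lambda)_v(G_v)$; locally $G=y^i\partial_{x^i}-2G^i\partial_{y^i}$ with $G^i$ $2$-homogeneous. $\mathscr{C}_{\mathrm{nl}}(A)$: ($1$-homogeneous) nonlinear connections, i.e. sections $N\colon A\to\mathrm{J}^1A$ with $N_{\lambda v}=\mathrm{d}(h_\lambda)_v\circ N_v$; locally $N=(\delta^i_j\partial_{x^i}-N^i_j\partial_{y^i})\otimes\mathrm{d}x^j$ with $N^i_j$ $1$-homogeneous. $\mathscr{C}_{\mathrm{anis}}(A)$: ($0$-homogeneous) anisotropic connections, i.e. sections $\Gamma\colon A\to\pi_A^*(\mathrm{C}M)$ with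 $\Gamma_{\lambda v}=\Gamma_v$; locally given by $0$-homogeneous functions $\Gamma^i_{jk}$ on $A|_U$ transforming as classical Christoffel symbols: $\tilde\Gamma^i_{jk}=-\frac{\partial^2\tilde x^i}{\partial x^b\partial x^c}\frac{\partial x^b}{\partial\tilde x^j}\frac{\partial x^c}{\partial\tilde x^k}+\frac{\partial\tilde x^i}{\partial x^a}\frac{\partial x^b}{\partial\tilde x^j}\frac{\partial x^c}{\partial\tilde x^k}\Gamma^a_{bc}$. Affine operations: for $Z\in\mathrm{h}_2\mathcal{T}^1_0$, $J\in\mathrm{h}_1\mathcal{T}^1_1$, $P\in\mathrm{h}_0\mathcal{T}^1_2$: $G-2Z=y^i\partial_{x^i}-2(G^i+Z^i)\partial_{y^i}$ and, more generally, tensors in $\mathcal T^1_0$ act on sprays through $\partial_{x^i}\mapsto\partial_{y^i}$; $N-J=\{\delta^i_j\partial_{x^i}-(N^i_j+J^i_j)\partial_{y^i}\}\otimes\mathrm{d}x^j$; $\Gamma+P\equiv\{\Gamma^i_{jk}+P^i_{jk}\}$. For a chart $(U,x)$ on $M$, $G^{(U,x)}=y^i\partial_{x^i}$, $N^{(U,x)}=\delta^i_j\,\partial_{x^i}\otimes\mathrm{d}x^j$ and $\Gamma^{(U,x)}\equiv\{\Gamma^i_{jk}=0\}$ are the spray, nonlinear connection and anisotropic connection on $A|_U$ whose components $G^i$, $N^i_j$, $\Gamma^i_{jk}$ in the natural chart $(\mathrm{T}U,(x,y))$ vanish. *)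

(* Defs.v *)
From HB Require Import structures.
From mathcomp Require Import all_boot all_order all_algebra.
From mathcomp Require Import all_classical all_reals all_analysis.

Set Implicit Arguments.
Unset Strict Implicit.
Unset Printing Implicit Defensive.

Import Order.TTheory GRing.Theory Num.Theory.
Import numFieldNormedType.Exports.

Local Open Scope classical_set_scope.
Local Open Scope ring_scope.

(* Meant for open U in finite dimension, where f is C^k.+1 iff it is
   differentiable with all its directional derivatives of class C^k. *)
Fixpoint Ck (R : realType) (V W : normedModType R) (k : nat)
    (U : set V) (f : V -> W) : Prop :=
  if k is k'.+1 then
    (forall x, U x -> differentiable f x) /\
    (forall v : V, Ck k' U (fun x => 'D_v f x : W))
  else forall x, U x -> {for x, continuous f}.

Definition smooth (R : realType) (V W : normedModType R)
    (U : set V) (f : V -> W) : Prop := forall k, Ck k U f.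

(* Only the values of cmap on dom are meaningful. *)
Record chart (R : realType) (M : Type) (E : normedModType R) :=
  Chart { dom : set M ; cmap : M -> E }.

Section Charts.
Context {R : realType} {M : Type} {E : normedModType R}.
Implicit Types (c : chart M E) (B : set M).

(* The coordinate expression f \o cmap^-1 of a function f on B, extended by
   zero outside the image of B `&` dom c. *)
Definition in_chart (W : normedModType R) c B (f : forall p, B p -> W)
    (x : E) : W :=
  xget 0 [set w | exists p (Bp : B p), [/\ dom c p, cmap c p = x & w = f p Bp]].

Definition smooth_in (W : normedModType R) c B (f : forall p, B p -> W) :=
  smooth (cmap c @` (B `&` dom c)) (in_chart c f).

Definition transition c c' : E -> E :=
  @in_chart E c (dom c') (fun q _ => cmap c' q).

Definition compatible c c' := @smooth_in E c (dom c') (fun q _ => cmap c' q).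

End Charts.

Section Manifold.
Context {R : realType} {n : nat} {M : topologicalType}.
Implicit Types c : chart M 'rV[R]_n.

Definition is_chart c :=
  [/\ open (dom c),
      (forall p q, dom c p -> dom c q -> cmap c p = cmap c q -> p = q) &
      forall W, W `<=` dom c -> (open W <-> open (cmap c @` W))].

(* The charts on M are the elements of its maximal atlas. *)
Definition smooth_manifold (atl : set (chart M 'rV[R]_n)) :=
  [/\ hausdorff_space M /\ @second_countable M,
      (forall p, exists2 c, atl c & dom c p),
      (forall c, atl c -> is_chart c),
      (forall c c', atl c -> atl c' -> compatible c c') &
      forall c, is_chart c ->
        (forall c', atl c' -> compatible c c' /\ compatible c' c) -> atl c].

End Manifold.

Section Tangent.
Context {R : realType} {M : Type} {E : normedModType R}.
Variables (atl : set (chart M E)) (p : M).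

(* A tangent vector is its family of components in all the charts around p,
   subject to the contravariant law; components in the other charts are set to
   zero so that equality of families is equality of vectors. *)
Record tangent := Tangent {
  vcomp : chart M E -> E ;
  vcomp_law : forall c c', atl c -> atl c' -> dom c p -> dom c' p ->
    vcomp c' = 'd (transition c c') (cmap c p) (vcomp c) ;
  vcomp_off : forall c, ~ (atl c /\ dom c p) -> vcomp c = 0 }.

Lemma tangentP (X Y : tangent) : vcomp X = vcomp Y -> X = Y.
Proof.
case: X Y => [f f1 f2] [g g1 g2] /= fg; subst g.
by rewrite (Prop_irrelevance f1 g1) (Prop_irrelevance f2 g2).
Qed.

HB.instance Definition _ := gen_eqMixin tangent.
HB.instance Definition _ := gen_choiceMixin tangent.

Definition tangent0 : tangent.
Proof. by exists (fun=> 0) => // c c' *; rewrite linear0. Defined.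

Definition tangentN (X : tangent) : tangent.
Proof.
exists (fun c => - vcomp X c) => [c c' ac ac' cp c'p|c cp].
  by rewrite linearN (vcomp_law X ac ac').
by rewrite vcomp_off ?oppr0.
Defined.

Definition tangentD (X Y : tangent) : tangent.
Proof.
exists (fun c => vcomp X c + vcomp Y c) => [c c' ac ac' cp c'p|c cp].
  by rewrite linearD (vcomp_law X ac ac') // (vcomp_law Y ac ac').
by rewrite !vcomp_off ?addr0.
Defined.

Definition tangentZ (a : R) (X : tangent) : tangent.
Proof.
exists (fun c => a *: vcomp X c) => [c c' ac ac' cp c'p|c cp].
  by rewrite linearZ (vcomp_law X ac ac').
by rewrite vcomp_off ?scaler0.
Defined.

Let addA : associative tangentD.
Proof. by move=> *; apply/tangentP/funext => c /=; rewrite addrA. Qed.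
Let addC : commutative tangentD.
Proof. by move=> *; apply/tangentP/funext => c /=; rewrite addrC. Qed.
Let add0 : left_id tangent0 tangentD.
Proof. by move=> *; apply/tangentP/funext => c /=; rewrite add0r. Qed.
Let addN : left_inverse tangent0 tangentN tangentD.
Proof. by move=> *; apply/tangentP/funext => c /=; rewrite addNr. Qed.
HB.instance Definition _ := GRing.isZmodule.Build tangent addA addC add0 addN.

Let scaleA (a b : R) X : tangentZ a (tangentZ b X) = tangentZ (a * b) X.
Proof. by apply/tangentP/funext => c /=; rewrite scalerA. Qed.
Let scale1 : left_id 1 tangentZ.
Proof. by move=> *; apply/tangentP/funext => c /=; rewrite scale1r. Qed.
Let scaleDr : right_distributive tangentZ +%R.
Proof. by move=> *; apply/tangentP/funext => c /=; rewrite scalerDr. Qed.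
Let scaleDl X : {morph tangentZ^~ X : a b / a + b}.
Proof. by move=> *; apply/tangentP/funext => c /=; rewrite scalerDl. Qed.
HB.instance Definition _ :=
  GRing.Zmodule_isLmodule.Build R tangent scaleA scale1 scaleDr scaleDl.

(* The tangent vector at p with components w in the chart c around p. *)
Definition tvec (c : chart M E) (w : E) : tangent :=
  xget 0 [set X | vcomp X c = w].

End Tangent.

(* The differential at p of a smooth F : M -> N. *)
Definition dmap (R : realType) (M N : Type) (E E' : normedModType R)
    (atlM : set (chart M E)) (atlN : set (chart N E'))
    (F : M -> N) (p : M) (X : tangent atlM p) : tangent atlN (F p) :=
  xget 0 [set Y | forall c d, atlM c -> dom c p -> atlN d -> dom d (F p) ->
    vcomp Y d =
    'd (@in_chart R M E E' c [set q | dom d (F q)] (fun q _ => cmap d (F q)))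
       (cmap c p) (vcomp X c)].

Section TangentBundle.
Context {R : realType} {M : Type} {E : normedModType R}.
Variable atl : set (chart M E).

Definition TM := {p : M & tangent atl p}.
Definition tpi (v : TM) : M := projT1 v.
Definition tvect (v : TM) : tangent atl (tpi v) := projT2 v.
Definition hscale (l : R) (v : TM) : TM := existT _ (tpi v) (l *: tvect v).

(* The natural chart (x, y) of TM associated with a chart c = (U, x). *)
Definition nat_chart (c : chart M E) : chart TM (E * E)%type :=
  Chart [set v | dom c (tpi v)]
        (fun v => (cmap c (tpi v), vcomp (tvect v) c) : (E * E)%type).

Definition nat_atlas : set (chart TM (E * E)%type) := nat_chart @` atl.

(* T_v(TM), which is T_v A when A is open in TM. *)
Definition TTM (v : TM) := tangent nat_atlas v.

Definition TM_over (U : set M) : set TM := [set v | U (tpi v)].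

(* A is open in TM, contains no zero vector, and its fibers are nonempty and
   conic. *)
Definition conic_domain (A : set TM) :=
  [/\ (forall c, atl c ->
         open (cmap (nat_chart c) @` (A `&` dom (nat_chart c)))),
      (forall v, A v -> tvect v != 0),
      (forall p, exists2 v, A v & tpi v = p) &
      forall (l : R) v, 0 < l -> A v -> A (hscale l v)].

(* The identification of pi^*(TM) with the vertical bundle: d/dx^i at pi(v) is
   sent to d/dy^i at v. *)
Definition vlift (v : TM) (w : tangent atl (tpi v)) : TTM v :=
  xget 0 [set X : TTM v | forall c, atl c -> dom c (tpi v) ->
    vcomp X (nat_chart c) = (0, vcomp w c)].

Definition restr (F : TM -> Type) (B B' : set TM) (sub : B' `<=` B)
    (f : forall v, B v -> F v) : forall v, B' v -> F v :=
  fun v B'v => f v (sub v B'v).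

End TangentBundle.

Arguments nat_chart {R M E} atl c.
Arguments nat_atlas {R M E} atl _.

Section Anisotropic.
Context {R : realType} {M : Type} {n : nat}.
Local Notation E := 'rV[R]_n.
Variable atl : set (chart M E).
Implicit Types (c : chart M E) (p : M) (B : set (TM atl)).

Definition evec (j : 'I_n) : E := delta_mx 0 j.

Section Tensors.

(* TM (x) T*M^{(x) s} at p, as s-linear maps from T_p M to itself. *)
Definition mtensor (s : nat) p := ('I_s -> tangent atl p) -> tangent atl p.

Definition multilinear s p (t : mtensor s p) :=
  forall (k : 'I_s) (u : 'I_s -> tangent atl p),
    linear (fun x => t (fun i => if i == k then x else u i)).

(* The i-th entry of tcomp c t J is the component t^i_{J 0, ..., J s.-1}. *)
Definition tcomp s p c (t : mtensor s p) (J : 'I_s -> 'I_n) : E :=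
  vcomp (t (fun k => tvec atl p c (evec (J k)))) c.

Definition tsec s B := forall v : TM atl, B v -> mtensor s (tpi v).

Definition is_htensor (a : int) s B (T : tsec s B) :=
  [/\ (forall v Bv, multilinear (T v Bv)),
      (forall (l : R) v (Bv : B v) (Blv : B (hscale l v)) c J, 0 < l ->
         atl c -> dom c (tpi v) ->
         tcomp c (T (hscale l v) Blv) J = l ^ a *: tcomp c (T v Bv) J) &
      forall c J, atl c ->
        smooth_in (nat_chart atl c) (fun v Bv => tcomp c (T v Bv) J)].

(* h_a T^1_s of B, the last argument s of is_htensor being the covariant
   valence. *)
Definition htensor (a : int) (s : nat) B := {T : tsec s B | is_htensor a T}.

Definition tscale s B (k : R) (T : tsec s B) : tsec s B :=
  fun v Bv u => k *: T v Bv u.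

(* (vdiff T)^i_{j_1 ... j_s k} = d T^i_{j_1 ... j_s} / d y^k. *)
Definition vdiff s B (T : tsec s B) : tsec s.+1 B := fun v Bv =>
  xget (fun=> 0) [set S : mtensor s.+1 (tpi v) | multilinear S /\
    forall c (J : 'I_s.+1 -> 'I_n), atl c -> dom c (tpi v) ->
      tcomp c S J =
      'D_(0, evec (J ord_max))
        (in_chart (nat_chart atl c)
           (fun w (Bw : B w) =>
              tcomp c (T w Bw) (fun k => J (widen_ord (leqnSn s) k))))
        (cmap (nat_chart atl c) v)].

(* Contraction of the last index with the Liouville field, whose value at v is
   v itself. *)
Definition icontract s B (S : tsec s.+1 B) : tsec s B := fun v Bv u =>
  S v Bv (fun i => if unlift ord_max i is Some j then u j else tvect v).

End Tensors.

Section Sprays.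

Definition spray_sec B := forall v, B v -> TTM v.

Definition is_spray B (G : spray_sec B) :=
  [/\ (forall v Bv, dmap atl (@tpi _ _ _ atl) (G v Bv) = tvect v),
      (forall (l : R) v (Bv : B v) (Blv : B (hscale l v)), 0 < l ->
         G (hscale l v) Blv =
         l *: dmap (nat_atlas atl) (hscale l) (G v Bv)) &
      forall c, atl c ->
        smooth_in (nat_chart atl c) (fun v Bv => vcomp (G v Bv) (nat_chart atl c))].

Definition spray B := {G : spray_sec B | is_spray G}.

(* The affine action of T^1_0: G - Z, where d/dx^i acts as d/dy^i. *)
Definition spray_sub B (G : spray_sec B) (Z : tsec 0 B) : spray_sec B :=
  fun v Bv => G v Bv - vlift (Z v Bv (fun=> 0)).

(* y^i d/dx^i *)
Definition chart_spray c B : spray_sec B := fun v _ =>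
  tvec (nat_atlas atl) v (nat_chart atl c) (vcomp (tvect v) c, 0).

End Sprays.

Section NonlinearConnections.

Definition nl_sec B := forall v, B v -> tangent atl (tpi v) -> TTM v.

Definition is_nl B (N : nl_sec B) :=
  [/\ (forall v Bv, linear (N v Bv)),
      (forall v Bv u, dmap atl (@tpi _ _ _ atl) (N v Bv u) = u),
      (forall (l : R) v (Bv : B v) (Blv : B (hscale l v)) u, 0 < l ->
         N (hscale l v) Blv u = dmap (nat_atlas atl) (hscale l) (N v Bv u)) &
      forall c j, atl c ->
        smooth_in (nat_chart atl c)
          (fun v Bv => vcomp (N v Bv (tvec atl (tpi v) c (evec j)))
                            (nat_chart atl c))].

Definition nlconn B := {N : nl_sec B | is_nl N}.

Definition nl_sub B (N : nl_sec B) (J : tsec 1 B) : nl_sec B :=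
  fun v Bv u => N v Bv u - vlift (J v Bv (fun=> u)).

(* d/dx^i (x) dx^i *)
Definition chart_nl c B : nl_sec B := fun v _ u =>
  tvec (nat_atlas atl) v (nat_chart atl c) (vcomp u c, 0).

End NonlinearConnections.

Section AnisotropicConnections.

(* d x'^i / d x^j and d^2 x'^i / d x^j d x^k at p, for c = (U, x) and
   c' = (U', x'). *)
Definition jac c c' p (i j : 'I_n) : R :=
  ('D_(evec j) (transition c c') (cmap c p)) 0 i.
Definition hess c c' p (i j k : 'I_n) : R :=
  ('D_(evec j) (fun x => 'D_(evec k) (transition c c') x : E) (cmap c p)) 0 i.

(* A point of the fiber of CM at p is given by its Christoffel symbols
   G c i j k = Gamma^i_{jk} in all the charts c around p. *)
Definition christoffel := chart M E -> 'I_n -> 'I_n -> 'I_n -> R.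

Definition is_CM p (G : christoffel) :=
  (forall c c', atl c -> atl c' -> dom c p -> dom c' p -> forall i j k,
     G c' i j k =
     - (\sum_b \sum_d hess c c' p i b d * jac c' c p b j * jac c' c p d k) +
     \sum_a \sum_b \sum_d
        jac c c' p i a * jac c' c p b j * jac c' c p d k * G c a b d) /\
  (forall c i j k, ~ (atl c /\ dom c p) -> G c i j k = 0).

Definition anis_sec B := forall v, B v -> christoffel.

Definition is_anis B (G : anis_sec B) :=
  [/\ (forall v Bv, is_CM (tpi v) (G v Bv)),
      (forall (l : R) v (Bv : B v) (Blv : B (hscale l v)), 0 < l ->
         G (hscale l v) Blv = G v Bv) &
      forall c i j k, atl c ->
        @smooth_in _ _ _ R^o (nat_chart atl c) B (fun v Bv => G v Bv c i j k)].

Definition anisconn B := {G : anis_sec B | is_anis G}.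

Definition anis_add B (G : anis_sec B) (P : tsec 2 B) : anis_sec B :=
  fun v Bv c i j k =>
    G v Bv c i j k + tcomp c (P v Bv) (fun l => if l == ord0 then j else k) 0 i.

(* The connection whose Christoffel symbols in c vanish. *)
Definition chart_anis c B : anis_sec B := fun v _ =>
  xget (fun _ _ _ _ => 0) [set G : christoffel | is_CM (tpi v) G /\ forall i j k, G c i j k = 0].

End AnisotropicConnections.

End Anisotropic.

Arguments chart_spray {R M n atl} c {B} v _.
Arguments chart_nl {R M n atl} c {B} v _ u.
Arguments chart_anis {R M n atl} c {B} v _.

(* Main.v *)
Require Import Defs.
From HB Require Import structures.
From mathcomp Require Import all_boot all_order all_algebra.
From mathcomp Require Import all_classical all_reals all_analysis.
From mathcomp Require Import ring.

Set Implicit Arguments.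
Unset Strict Implicit.
Unset Printing Implicit Defensive.

Import Order.TTheory GRing.Theory Num.Theory.
Import numFieldNormedType.Exports.

Local Open Scope classical_set_scope.
Local Open Scope ring_scope.

(** Seen in a chart c, the coordinate connections of another chart c' are
    governed by one symmetric bilinear map on each tangent space, the defect
    Q(a, b) = D^2 phi (D phi^-1 a, D phi^-1 b), where phi is the transition from
    c' to c: the spray of c' is (y, Q(y, y)), its nonlinear connection is
    u |-> (u, Q(u, y)) and its Christoffel symbols are - Q.  Hence
    Z' - Z = Q(y, y) / 2, J' - J = Q(., y) and P' - P = Q, and the identities
    follow by vertical differentiation and by contraction with y; the symmetry
    of second derivatives is what makes the vertical derivative of Q(y, y) / 2
    in the direction u equal to Q(u, y).  The maps of (ii) are then obtained by
    gluing the local expressions, every condition on a section being checked in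
    a single chart. *)

(** * Differential calculus on normed modules *)

Section Differentials.
Context {R : realType}.
Implicit Types V W : normedModType R.

(** Changes of natural charts are linear along each fiber of TM. This is why a vertical derivative
    of a tensor is again a tensor, and why tensors are only ever differentiated with the base point
    frozen, as functions of y on one copy of R^n. One obstacle is that [tvec], [dmap], [vlift],
    [vdiff] and [chart_anis] are choices made by [xget]: before any of them can be computed, its
    specification must be shown to have a solution. Moreover sections live on subsets of TM. Their
    coordinate expressions are extended by zero, and openness of the domains makes the extension
    invisible to derivatives. Another obstacle is smoothness, which is required in every chart,
    whereas Z, J and P are built in a single chart c. Seen in another chart they are the components
    of the given connection corrected by a defect Q, so Q itself has to be smooth. For this Q is
    rewritten as - D phi (D^2 psi (a, b)), psi being the inverse of phi, where the inner directions
    a and b no longer depend on the point. *)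

Lemma near_eq_diff V W (f g : V -> W) x :
  (\near x, f x = g x) -> differentiable f x ->
  differentiable g x /\ 'd g x = 'd f x :> (V -> W).
Proof.
move=> fg df.
have fg0 : \forall h \near (0 : V), f (h + x) = g (h + x).
  by move: fg; rewrite (near_shift 0 x) subr0.
have gE : g \o shift x = cst (g x) + 'd f x +o_ 0 id.
  apply/eqaddoP => _/posnumP[e]; near=> h.
  have -> : (g \o shift x - (cst (g x) + 'd f x)) h =
            (f \o shift x - (cst (f x) + 'd f x)) h.
    rewrite !fctE /= (nbhs_singleton fg); congr (_ - _); apply/esym.
    by near: h.
  by near: h; have /eqaddoP := diff_locally df; exact.
have dg := diff_unique (diff_continuous df) gE.
by split=> //; apply/diff_locallyP; rewrite dg; split=> //; exact: diff_continuous.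
Unshelve. all: by end_near. Qed.

Lemma scale_is_bilinear W : bilinear_for
    (GRing.Scale.Law.clone _ _ *:%R _) (GRing.Scale.Law.clone _ _ *:%R _)
    (@GRing.scale R W).
Proof.
by split=> [u'|u] a x y /=; rewrite ?scalerDl ?scalerDr ?scalerA // mulrC -scalerA.
Qed.

(** The Leibniz rule, read off the differential of the continuous bilinear map [*:] composed with
    the pair (a, f). *)
Lemma is_diff_scale V W (a : V -> R) (f : V -> W) x :
  differentiable a x -> differentiable f x ->
  is_diff x (fun y => a y *: f y) (fun v => a x *: 'd f x v + 'd a x v *: f x).
Proof.
move=> da df.
pose sbM := bilinear_isBilinear.Build R R W W _ _ _ (scale_is_bilinear W).
pose sb : {bilinear R -> W -> W} := HB.pack (@GRing.scale R W) sbM.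
have sc : continuous (fun p : R * W => sb p.1 p.2) by exact: scale_continuous.
pose h y := (a y, f y).
have dh : differentiable h x by exact: differentiable_pair.
have ds : differentiable (fun p : R * W => sb p.1 p.2) (h x).
  exact: differentiable_bilin.
have -> : (fun y => a y *: f y) = (fun p : R * W => sb p.1 p.2) \o h by [].
split; first exact: differentiable_comp.
rewrite diff_comp // diff_bilin // diff_pair //.
Qed.

End Differentials.

(** * Closure properties of the class C^k *)

Section Smoothness.
Context {R : realType}.
Implicit Types V W X : normedModType R.

Lemma eq_on_near V (T : Type) (U : set V) (f g : V -> T) x :
  open U -> U x -> (forall y, U y -> f y = g y) -> \near x, f x = g x.
Proof.
move=> oU Ux fg; have nU : nbhs x U by exact: open_nbhs_nbhs.
by apply: filterS nU => y; exact: fg.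
Qed.

Lemma eq_Ck V W (U : set V) (f g : V -> W) k :
  open U -> (forall x, U x -> f x = g x) -> Ck k U f -> Ck k U g.
Proof.
move=> oU; elim: k f g => [|k IH] f g fg /=.
  move=> cf x Ux; have -> : {for x, continuous g} = (g @ x --> g x) by [].
  rewrite -(fg x Ux).
  exact: cvg_trans (near_eq_cvg (eq_on_near oU Ux fg)) (cf x Ux).
move=> [df cf]; split=> [x Ux|v].
  by have [] := near_eq_diff (eq_on_near oU Ux fg) (df x Ux).
apply: IH (cf v) => x Ux.
by apply: near_eq_derive; exact: eq_on_near fg.
Qed.

Lemma CkW V W (U : set V) (f : V -> W) k : Ck k.+1 U f -> Ck k U f.
Proof.
elim: k f => [|k IH] f [df cf]; first by move=> x /df; exact: differentiable_continuous.
by split=> // v; apply: IH.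
Qed.

Lemma sub_Ck V W (U U' : set V) (f : V -> W) k :
  U' `<=` U -> Ck k U f -> Ck k U' f.
Proof.
move=> UU; elim: k f => [|k IH] f; first by move=> cf x /UU /cf.
by move=> [df cf]; split=> [x /UU|v]; [exact: df | exact: IH (cf v)].
Qed.

Lemma Ck_cst V W (U : set V) (w : W) k : Ck k U (cst w : V -> W).
Proof.
elim: k w => [|k IH] w; first by move=> x _; exact: cvg_cst.
split=> [x _|v]; first exact: differentiable_cst.
have -> : (fun x => 'D_v (cst w) x) = cst 0 :> (V -> W).
  by apply/funext => x; rewrite derive_cst.
exact: IH.
Qed.

Lemma Ck_linear V W (U : set V) (f : {linear V -> W}) k :
  continuous f -> Ck k U f.
Proof.
move=> cf; case: k => [|k]; first by move=> x _; exact: cf.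
split=> [x _|v]; first exact: linear_differentiable.
have -> : (fun x => 'D_v f x) = cst (f v) :> (V -> W).
  by apply/funext => x; rewrite deriveE ?diff_lin //; exact: linear_differentiable.
exact: Ck_cst.
Qed.

Lemma CkD V W (U : set V) (f g : V -> W) k :
  open U -> Ck k U f -> Ck k U g -> Ck k U (fun x => f x + g x).
Proof.
move=> oU; elim: k f g => [|k IH] f g cf cg.
  by move=> x Ux; apply: cvgD; [exact: cf | exact: cg].
case: cf cg => df cf [dg cg]; split=> [x Ux|v].
  by apply: differentiableD; [exact: df | exact: dg].
apply: (@eq_Ck _ _ _ (fun x => 'D_v f x + 'D_v g x)) => // [x Ux|]; last exact: IH (cf v) (cg v).
by rewrite -deriveD //; apply: diff_derivable; [exact: df | exact: dg].
Qed.

Lemma Ck_scale V W (U : set V) (a : V -> R) (f : V -> W) k :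
  open U -> Ck k U a -> Ck k U f -> Ck k U (fun x => a x *: f x).
Proof.
move=> oU; elim: k a f => [|k IH] a f ca cf.
  by move=> x Ux; apply: cvgZ; [exact: ca | exact: cf].
(* The derivative of the product contains a and f undifferentiated, so the induction also needs them
   at order k. *)
have ca1 := CkW ca; have cf1 := CkW cf.
case: ca cf => da ca [df cf].
have D x : U x -> is_diff x (fun y => a y *: f y)
    (fun v => a x *: 'd f x v + 'd a x v *: f x).
  by move=> Ux; apply: is_diff_scale; [exact: da | exact: df].
split=> [x Ux|v]; first by have Dx := D x Ux; exact: ex_diff.
apply: (@eq_Ck _ _ _ (fun x => a x *: 'D_v f x + 'D_v a x *: f x)) => // [x Ux|].
  have Dx := D x Ux.
  rewrite [RHS]deriveE; last exact: ex_diff.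
  by rewrite (@diff_val _ _ _ _ _ _ _ Dx) !deriveE //; [exact: da | exact: df].
by apply: CkD => //; [exact: IH ca1 (cf v) | exact: IH (ca v) cf1].
Qed.

Lemma CkZ V W (U : set V) (c : R) (f : V -> W) k :
  open U -> Ck k U f -> Ck k U (fun x => c *: f x).
Proof. by move=> oU; apply: Ck_scale => //; exact: (@Ck_cst _ R^o). Qed.

Lemma CkN V W (U : set V) (f : V -> W) k :
  open U -> Ck k U f -> Ck k U (fun x => - f x).
Proof.
move=> oU /(CkZ (- 1) oU); apply: eq_Ck => // x _.
by rewrite scaleN1r.
Qed.

Lemma Ck_sum V W (U : set V) (I : Type) (r : seq I) (f : I -> V -> W) k :
  open U -> (forall i, Ck k U (f i)) -> Ck k U (fun x => \sum_(i <- r) f i x).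
Proof.
move=> oU cf; elim: r => [|i r IH].
  by apply: (@eq_Ck _ _ _ (cst 0)) (Ck_cst _ _ _) => // x _; rewrite big_nil.
apply: (@eq_Ck _ _ _ (fun x => f i x + \sum_(i <- r) f i x)); first by [].
  by move=> x _; rewrite big_cons.
exact: CkD.
Qed.

(** A linear map on R^n is a finite sum of coordinates times fixed vectors. *)
Lemma rV_linear_continuous n W (f : {linear 'rV[R]_n -> W}) : continuous f.
Proof.
have -> : f = (fun x : 'rV_n => \sum_j x 0 j *: f (delta_mx 0 j)) :> (_ -> _).
  by apply/funext => x; rewrite {1}[x]row_sum_delta linear_sum; apply: eq_bigr => j _; rewrite linearZ.
suff : Ck 0 setT (fun x : 'rV[R]_n => \sum_j x 0 j *: f (delta_mx 0 j)).
  by move=> cf x; exact: cf.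
apply: Ck_sum openT _ => j; apply: Ck_scale openT _ (Ck_cst _ _ _) => x _.
exact: coord_continuous.
Qed.

Lemma diff_rV n W (g : 'rV[R]_n -> W) x v : differentiable g x ->
  'd g x v = \sum_j v 0 j *: 'D_(delta_mx 0 j) g x.
Proof.
move=> dg; rewrite {1}[v]row_sum_delta linear_sum; apply: eq_bigr => j _.
by rewrite linearZ /= deriveE.
Qed.

Lemma Ck_coord n V (U : set V) (f : V -> 'rV[R]_n) (j : 'I_n) k :
  open U -> Ck k U f -> Ck k U (fun x => f x 0 j : R).
Proof.
move=> oU; elim: k f => [|k IH] f cf.
  move=> x Ux; apply: (@cvg_comp _ _ _ f (fun y : 'rV_n => y 0 j)); first exact: cf.
  exact: coord_continuous.
case: cf => df cf; split=> [x Ux|v].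
  apply: (@differentiable_comp _ _ _ _ f (fun y : 'rV_n => y 0 j)); first exact: df.
  exact: differentiable_coord.
apply: (@eq_Ck _ _ _ (fun x => 'D_v f x 0 j)) => // [x Ux|]; last exact: IH (cf v).
by rewrite derive_mx ?mxE //; apply: diff_derivable; exact: df.
Qed.

(** [Ck] controls derivatives in fixed directions, but the chain rule differentiates g in the moving
    direction 'D_v f x. The middle space is R^n so that this direction can be expanded on the
    standard basis. *)
Lemma Ck_comp n V W (U : set V) (O : set 'rV[R]_n) (f : V -> 'rV[R]_n)
    (g : 'rV[R]_n -> W) k :
  open U -> (forall x, U x -> O (f x)) ->
  Ck k U f -> Ck k O g -> Ck k U (g \o f).
Proof.
move=> oU fO; elim: k f g fO => [|k IH] f g fO cf cg.
  by move=> x Ux; apply: continuous_comp; [exact: cf | exact/cg/fO].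
have cf1 := CkW cf; case: cf cg => df cf [dg cg].
split=> [x Ux|v].
  by apply: differentiable_comp; [exact: df | exact/dg/fO].
apply: (@eq_Ck _ _ _
  (fun x => \sum_j ('D_v f x) 0 j *: 'D_(delta_mx 0 j) g (f x))) => // [x Ux|].
  have dfx := df x Ux; have dgx := dg _ (fO _ Ux).
  rewrite [RHS]deriveE; last exact: differentiable_comp.
  by rewrite diff_comp //= diff_rV // deriveE.
apply: Ck_sum => // j; apply: Ck_scale => //; first exact: Ck_coord oU (cf v).
exact: (IH f _ fO cf1 (cg _)).
Qed.

End Smoothness.

(** * Symmetry of second derivatives *)

Section Schwarz.
Context {R : realType}.
Implicit Types V : normedModType R.

Lemma is_derive_line V (W : normedModType R) (f : V -> W) (u y : V) (s : R) :
  differentiable f (s *: u + y) ->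
  is_derive s 1 (fun h => f (h *: u + y)) ('D_u f (s *: u + y)).
Proof.
move=> df.
have dl : is_diff s (fun h : R => h *: u + y) (fun h => h *: u + 0).
  exact: is_diffD.
have dfl : differentiable (f \o (fun h : R => h *: u + y)) s.
  by apply: differentiable_comp => //; exact: ex_diff.
have -> : (fun h => f (h *: u + y)) = f \o (fun h : R => h *: u + y) by [].
split; first exact: diff_derivable.
rewrite !deriveE // diff_comp //.
by rewrite /= (@diff_val _ _ _ _ _ _ _ dl) scale1r addr0.
Qed.

Lemma square_nbhs V (x u v : V) (N : set V) : nbhs x N ->
  exists2 t : R, 0 < t &
    forall s r, 0 <= s <= t -> 0 <= r <= t -> N (s *: u + (r *: v + x)).
Proof.
move=> /nbhs_ballP[e /= e0 eN].
have k0 : 0 < `|u| + `|v| + 1 by rewrite ltr_wpDl // addr_ge0.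
(* The summand 1 keeps the denominator positive when u = v = 0 and makes the final estimate
   strict. *)
exists (e / (`|u| + `|v| + 1)); first exact: divr_gt0.
move=> s r /andP[s0 st] /andP[r0 rt]; apply: eN.
rewrite -ball_normE /= addrA addrC opprD addrA subrr sub0r normrN.
apply: (le_lt_trans (ler_normD _ _)); rewrite !normrZ !ger0_norm //.
apply: (@le_lt_trans _ _ (e / (`|u| + `|v| + 1) * (`|u| + `|v|))).
  by rewrite mulrDr lerD // ler_wpM2r.
by rewrite mulrAC ltr_pdivrMr // ltr_pM2l // ltrDl.
Qed.

(** The mean value theorem is applied twice: along u to the increment of f in the direction v, then
    along v to 'D_u f. Each application contributes one factor t. *)
Lemma second_difference V (U : set V) (f : V -> R) (x u v : V) (t : R) :
  Ck 2 U f -> 0 < t ->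
  (forall s r, 0 <= s <= t -> 0 <= r <= t -> U (s *: u + (r *: v + x))) ->
  exists s r, [/\ 0 <= s <= t, 0 <= r <= t &
    f (t *: u + (t *: v + x)) - f (t *: u + x) - f (t *: v + x) + f x =
    t ^+ 2 * 'D_v (fun y => 'D_u f y) (s *: u + (r *: v + x))].
Proof.
move=> [df ddf] t0 Ut.
have Us s : 0 <= s <= t -> U (s *: u + x).
  by move=> st; rewrite -[x](add0r x) -(scale0r v); apply: Ut => //; rewrite lexx ltW.
have tt : 0 <= t <= t by rewrite lexx ltW.
pose g s := f (s *: u + (t *: v + x)) - f (s *: u + x).
pose dg s := 'D_u f (s *: u + (t *: v + x)) - 'D_u f (s *: u + x).
have Dg s : 0 <= s <= t -> is_derive s 1 g (dg s).
  move=> st; apply: is_deriveB; apply: is_derive_line; apply: df; first exact: Ut.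
  exact: Us.
have [s||s st gE] := @MVT R g dg 0 t t0.
- by rewrite in_itv /= => /andP[s0 st]; apply: Dg; rewrite !ltW.
- apply: derivable_within_continuous => s; rewrite in_itv /= => st.
  by have D := Dg s st; exact: ex_derive.
have {}st : 0 <= s <= t by move: st; rewrite in_itv /= => /andP[s0 st]; rewrite !ltW.
pose k r := 'D_u f (r *: v + (s *: u + x)).
pose dk r := 'D_v (fun y => 'D_u f y) (r *: v + (s *: u + x)).
have Dk r : 0 <= r <= t -> is_derive r 1 k (dk r).
  move=> rt; apply: (@is_derive_line _ _ (fun y => 'D_u f y)).
  by apply: (ddf u).1; rewrite addrCA; exact: Ut.
have [r||r rt kE] := @MVT R k dk 0 t t0.
- by rewrite in_itv /= => /andP[r0 rt]; apply: Dk; rewrite !ltW.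
- apply: derivable_within_continuous => r; rewrite in_itv /= => rt.
  by have D := Dk r rt; exact: ex_derive.
have {}rt : 0 <= r <= t by move: rt; rewrite in_itv /= => /andP[r0 rt]; rewrite !ltW.
exists s, r; split=> //.
move: gE kE; rewrite /g /dg /k /dk !scale0r !add0r !subr0.
rewrite (addrCA (t *: v)) (addrCA (r *: v)) => gE kE.
rewrite kE in gE; rewrite expr2 mulrC mulrA -gE.
ring.
Qed.

(* Both mixed derivatives are limits of the same second difference over t ^+ 2. *)
Lemma derive_sym V (U : set V) (f : V -> R) (x u v : V) :
  open U -> Ck 2 U f -> U x ->
  'D_u (fun y => 'D_v f y) x = 'D_v (fun y => 'D_u f y) x.
Proof.
move=> oU cf Ux; set a := LHS; set b := RHS.
apply/eqP; rewrite -subr_eq0 -normr_le0; apply/ler_addgt0Pr => e e0; rewrite add0r.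
have e2 : 0 < e / 2 by rewrite divr_gt0.
have cu := (cf.2 u).2 v x Ux; have cv := (cf.2 v).2 u x Ux.
have nU : nbhs x U by exact: open_nbhs_nbhs.
have nb : nbhs x (fun y => `|b - 'D_v (fun y => 'D_u f y) y| < e / 2).
  by move/cvgrPdist_lt : cu => /(_ _ e2).
have na : nbhs x (fun y => `|a - 'D_u (fun y => 'D_v f y) y| < e / 2).
  by move/cvgrPdist_lt : cv => /(_ _ e2).
have [t t0 Nt] := square_nbhs u v (filterI nU (filterI na nb)).
have [|s [r [st rt uvE]]] := @second_difference _ _ _ x u v t cf t0.
  by move=> s r st rt; have [] := Nt s r st rt.
have [|r' [s' [rt' st' vuE]]] := @second_difference _ _ _ x v u t cf t0.
  by move=> r' s' rt' st'; rewrite addrCA; have [] := Nt s' r' st' rt'.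
have tn : t ^+ 2 != 0 by rewrite expf_neq0 // gt_eqF.
have [_ [_ bE]] := Nt _ _ st rt; have [_ [aE _]] := Nt _ _ st' rt'.
(* Exchanging u and v only permutes the terms of the second difference, so the two mean values
   coincide once t ^+ 2 is cancelled; each is within e / 2 of its own limit. *)
rewrite (addrCA (r' *: v)) (addrCA (t *: v)) [X in X + f x]addrAC uvE in vuE.
move: bE aE {uvE} vuE.
move: ('D_v (fun y => 'D_u f y) _) ('D_u (fun y => 'D_v f y) _) => B A.
clearbody a b => bE aE /(mulfI tn) BA.
by rewrite -(subrKA A) (le_trans (ler_normD _ _)) // [leRHS]splitr lerD // ltW // -BA distrC.
Qed.

Lemma derive_sym_rV V n (U : set V) (f : V -> 'rV[R]_n) (x u v : V) :
  open U -> Ck 2 U f -> U x ->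
  'D_u (fun y => 'D_v f y) x = 'D_v (fun y => 'D_u f y) x.
Proof.
move=> oU cf Ux; apply/rowP => j.
have H w w' : ('D_w (fun y => 'D_w' f y) x) 0 j =
              'D_w (fun y => 'D_w' (fun z => f z 0 j : R) y) x.
  rewrite derive_mx ?mxE; last by apply: diff_derivable; apply: (cf.2 w').1.
  apply: near_eq_derive; apply: eq_on_near oU Ux _ => y Uy.
  by rewrite derive_mx ?mxE //; apply: diff_derivable; exact: cf.1.
have cj := Ck_coord j oU cf.
have S := derive_sym u v oU cj Ux.
exact: etrans (H u v) (etrans S (esym (H v u))).
Qed.

End Schwarz.

(** * Tangent vectors and natural charts *)

Section RegularAtlas.
Context {R : realType} {M : Type} {E : normedModType R}.
Implicit Types (c : chart M E) (W : normedModType R).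

Definition chart_inj c := forall p q, dom c p -> dom c q -> cmap c p = cmap c q -> p = q.

Lemma in_chartE W c (B : set M) (f : forall p, B p -> W) p (Bp : B p) :
  chart_inj c -> dom c p -> in_chart c f (cmap c p) = f p Bp.
Proof.
move=> ci cp; rewrite /in_chart; set S := [set w | _].
have Sf : S (f p Bp) by exists p, Bp.
apply: xget_subset1 Sf _ => w w' [q [Bq [cq qp ->]]] [q' [Bq' [cq' qp' ->]]].
have qq' : q = q' by apply: ci => //; rewrite qp qp'.
by subst q'; rewrite (Prop_irrelevance Bq Bq').
Qed.

Lemma in_chart_off W c (B : set M) (f : forall p, B p -> W) x :
  ~ (cmap c @` (B `&` dom c)) x -> in_chart c f x = 0.
Proof.
move=> nx; apply: xgetPN => w [p [Bp [cp px _]]]; apply: nx.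
by exists p.
Qed.

Lemma image_setI_chart c (A B : set M) : chart_inj c ->
  cmap c @` (A `&` dom c) `&` cmap c @` (B `&` dom c) `<=` cmap c @` (A `&` B `&` dom c).
Proof.
move=> ci _ [[p [Ap cp] <-] [q [Bq cq] qp]]; have qpE := ci _ _ cq cp qp.
by exists p => //; split=> //; split=> //; rewrite -qpE.
Qed.

(** These are the properties that the atlas of M shares with the natural atlas of TM, so that the
    calculus of tangent vectors below serves both for TM and for TTM. *)
Definition regular_atlas (atl : set (chart M E)) :=
  (forall c, atl c -> chart_inj c) /\
  forall c c', atl c -> atl c' ->
    open (cmap c @` (dom c' `&` dom c)) /\
    forall p, dom c p -> dom c' p -> differentiable (transition c c') (cmap c p).

Definition trans_diff c c' p (w : E) : E := 'd (transition c c') (cmap c p) w.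

Variables (atl : set (chart M E)) (Hatl : regular_atlas atl).

Lemma transitionE c c' p : atl c -> dom c p -> dom c' p ->
  transition c c' (cmap c p) = cmap c' p.
Proof. by move=> ac cp c'p; apply: in_chartE => //; exact: Hatl.1. Qed.

Lemma overlap_nbhs c c' p : atl c -> atl c' -> dom c p -> dom c' p ->
  nbhs (cmap c p) (cmap c @` (dom c' `&` dom c)).
Proof.
move=> ac ac' cp c'p; apply: open_nbhs_nbhs; split; last by exists p.
exact: (Hatl.2 _ _ ac ac').1.
Qed.

Lemma trans_diff_id c p w : atl c -> dom c p -> trans_diff c c p w = w.
Proof.
move=> ac cp.
have idE : \forall x \near cmap c p, id x = transition c c x.
  apply: filterS (overlap_nbhs ac ac cp cp) => _ [q [_ cq] <-].
  by rewrite transitionE.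
have did : is_diff (cmap c p) (@id E) id by exact: is_diff_id.
by rewrite /trans_diff; have [_ ->] := near_eq_diff idE (@ex_diff _ _ _ _ _ _ _ did); rewrite diff_val.
Qed.

(** The chain rule. The composite of two transitions is the third one only where all three charts
    are defined, which is a neighborhood of the point. *)
Lemma trans_diff_comp c c' c'' p w : atl c -> atl c' -> atl c'' ->
  dom c p -> dom c' p -> dom c'' p ->
  trans_diff c c'' p w = trans_diff c' c'' p (trans_diff c c' p w).
Proof.
move=> ac ac' ac'' cp c'p c''p; rewrite /trans_diff.
have d1 := (Hatl.2 _ _ ac ac').2 _ cp c'p.
have d2 := (Hatl.2 _ _ ac' ac'').2 _ c'p c''p.
rewrite -(transitionE ac cp c'p) in d2 *.
transitivity ('d (transition c' c'' \o transition c c') (cmap c p) w); last first.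
  by rewrite (diff_comp d1 d2).
have [|_ -> //] := @near_eq_diff _ _ _ (transition c' c'' \o transition c c')
  (transition c c'') (cmap c p) _ (differentiable_comp d1 d2).
near=> x.
have : (cmap c @` (dom c' `&` dom c) `&` cmap c @` (dom c'' `&` dom c)) x.
  by split; near: x; exact: overlap_nbhs.
move=> /(image_setI_chart (Hatl.1 _ ac)) [q [[c'q c''q] cq] <-].
by rewrite /= !transitionE.
Unshelve. all: by end_near. Qed.

Lemma vcompE p (X : tangent atl p) c c' : atl c -> atl c' -> dom c p -> dom c' p ->
  vcomp X c' = trans_diff c c' p (vcomp X c).
Proof. exact: vcomp_law. Qed.

Lemma vcomp_inj p (X Y : tangent atl p) c : atl c -> dom c p ->
  vcomp X c = vcomp Y c -> X = Y.
Proof.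
move=> ac cp XY; apply/tangentP/funext => c'.
have [[ac' c'p]|n] := pselect (atl c' /\ dom c' p).
  by rewrite (vcompE X ac) // (vcompE Y ac) // XY.
by rewrite !vcomp_off.
Qed.

(** This is why [tvec] never falls back on its default 0: components transported from c to all other
    charts obey the contravariant law by the cocycle identity. *)
Lemma tangent_exists c p w : atl c -> dom c p ->
  exists X : tangent atl p, vcomp X c = w.
Proof.
move=> ac cp.
pose f c' := if pselect (atl c' /\ dom c' p) then trans_diff c c' p w else 0.
have fE c' : atl c' -> dom c' p -> f c' = trans_diff c c' p w.
  by rewrite /f; case: pselect => // n ac' c'p; case: n.
have f1 c1 c2 : atl c1 -> atl c2 -> dom c1 p -> dom c2 p ->
    f c2 = 'd (transition c1 c2) (cmap c1 p) (f c1).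
  by move=> a1 a2 c1p c2p; rewrite !fE // (@trans_diff_comp c c1 c2).
have f2 c1 : ~ (atl c1 /\ dom c1 p) -> f c1 = 0.
  by rewrite /f; case: pselect.
by exists (Tangent f1 f2); rewrite /= fE // trans_diff_id.
Qed.

Lemma vcomp_tvec c p w : atl c -> dom c p -> vcomp (tvec atl p c w) c = w.
Proof.
move=> ac cp; have [X Xw] := tangent_exists w ac cp.
exact: (@xgetI _ 0 [set X : tangent atl p | vcomp X c = w] X Xw).
Qed.

Lemma vcomp_tvecE c c' p w : atl c -> atl c' -> dom c p -> dom c' p ->
  vcomp (tvec atl p c w) c' = trans_diff c c' p w.
Proof. by move=> ac ac' cp c'p; rewrite (vcompE _ ac) // vcomp_tvec. Qed.

Lemma tvec_vcomp c p (X : tangent atl p) : atl c -> dom c p ->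
  tvec atl p c (vcomp X c) = X.
Proof. by move=> ac cp; apply: (vcomp_inj ac cp); rewrite vcomp_tvec. Qed.

End RegularAtlas.

(* The first and second differentials at p of the transition from c to c'. *)
HB.lock Definition dtrans (R : realType) (M : Type) (n : nat) (c c' : chart M 'rV[R]_n)
  (p : M) (a : 'rV[R]_n) : 'rV[R]_n := trans_diff c c' p a.

HB.lock Definition d2trans (R : realType) (M : Type) (n : nat) (c c' : chart M 'rV[R]_n)
  (p : M) (a b : 'rV[R]_n) : 'rV[R]_n :=
  'D_a (fun x => 'D_b (transition c c') x) (cmap c p).

(** A locked copy of [tvec], so that the underlying choice is never unfolded by unification. *)
HB.lock Definition tangent_of (R : realType) (M : Type) (n : nat)
  (atl : set (chart M 'rV[R]_n)) (c : chart M 'rV[R]_n) (p : M) (a : 'rV[R]_n) :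
  tangent atl p := tvec atl p c a.

(** * Natural charts of TM and coordinates on TTM *)

Section NaturalAtlas.
Context {R : realType} {M : Type} {n : nat}.
Local Notation E := 'rV[R]_n.
Implicit Types c : chart M E.

Lemma is_diff_fst (V W : normedModType R) (z : V * W) : is_diff z fst fst.
Proof.
have cf : continuous (@fst V W : V * W -> V) by move=> x; exact: cvg_fst.
by split; [exact: linear_differentiable | rewrite diff_lin].
Qed.

Lemma is_diff_snd (V W : normedModType R) (z : V * W) : is_diff z snd snd.
Proof.
have cf : continuous (@snd V W : V * W -> W) by move=> x; exact: cvg_snd.
by split; [exact: linear_differentiable | rewrite diff_lin].
Qed.

Lemma is_diff_coord m (z : 'rV[R]_m) j :
  is_diff z (fun x : 'rV[R]_m => x 0 j : R) (fun x => x 0 j).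
Proof.
have d := differentiable_coord z 0 j.
split=> //; apply/funext => v; rewrite -deriveE //.
have /= := derive_mx (@derivable_id _ _ z v).
by move/(congr1 (fun A : 'rV_m => A 0 j)); rewrite mxE derive_id.
Qed.

Lemma is_diff_linear (f : E -> E) y : linear f -> is_diff y f f.
Proof.
move=> lf; pose fM := GRing.isLinear.Build _ _ _ _ f lf.
pose fL : {linear E -> E} := HB.pack f fM.
have cf : continuous fL by exact: rV_linear_continuous.
by split; [exact: (linear_differentiable (f := fL)) | exact: (diff_lin (f := fL))].
Qed.

Lemma is_diff_sum (V W : normedModType R) (I : Type) (r : seq I)
    (F dF : I -> V -> W) x : (forall i, is_diff x (F i) (dF i)) ->
  is_diff x (fun z => \sum_(i <- r) F i z) (fun w => \sum_(i <- r) dF i w).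
Proof.
move=> HF; elim: r => [|i r IH].
  have -> : (fun z => \sum_(i <- [::]) F i z) = cst 0.
    by apply/funext => z; rewrite big_nil.
  by apply: is_diff_eq; apply/funext => z; rewrite big_nil.
have -> : (fun z => \sum_(i <- i :: r) F i z) = F i + (fun z => \sum_(i <- r) F i z).
  by apply/funext => z; rewrite big_cons.
apply: is_diff_eq (is_diffD (HF i) IH) _.
by apply/funext => z; rewrite big_cons.
Qed.

Lemma is_diff_differentiable (V W : normedModType R) (f df : V -> W) x :
  is_diff x f df -> differentiable f x.
Proof. by move=> D; exact: ex_diff. Qed.

Lemma is_diff_val (V W : normedModType R) (f df : V -> W) x :
  is_diff x f df -> 'd f x = df :> (V -> W).
Proof. by move=> D; exact: diff_val. Qed.

(** What is kept of [smooth_manifold] when the topology of M is forgotten; that charts cover M is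
    assumed separately where points have to be given a chart. *)
Definition smooth_atlas (atl : set (chart M E)) :=
  regular_atlas atl /\ forall c c', atl c -> atl c' -> compatible c c'.

Lemma dtransD c c' p (a b : E) : dtrans c c' p (a + b) = dtrans c c' p a + dtrans c c' p b.
Proof. by rewrite dtrans.unlock; exact: linearD. Qed.

Lemma dtransZ c c' p k (a : E) : dtrans c c' p (k *: a) = k *: dtrans c c' p a.
Proof. by rewrite dtrans.unlock; exact: linearZ. Qed.

Lemma dtrans0 c c' p : dtrans c c' p (0 : E) = (0 : E).
Proof. by rewrite dtrans.unlock; exact: linear0. Qed.

Lemma dtransN c c' p (a : E) : dtrans c c' p (- a) = - dtrans c c' p a.
Proof. by rewrite dtrans.unlock; exact: linearN. Qed.

Variables (atl : set (chart M E)) (Hatl : smooth_atlas atl).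
Let reg : regular_atlas atl := Hatl.1.

Definition tcoord c p (X : tangent atl p) : E := vcomp X c.

Lemma tcoordD c p (X Y : tangent atl p) : tcoord c (X + Y) = tcoord c X + tcoord c Y.
Proof. by []. Qed.

Lemma tcoordZ c p k (X : tangent atl p) : tcoord c (k *: X) = k *: tcoord c X.
Proof. by []. Qed.

Lemma tcoord0 c p : tcoord c (0 : tangent atl p) = (0 : E).
Proof. by []. Qed.

Lemma tcoord_off c p (X : tangent atl p) : ~ (atl c /\ dom c p) -> tcoord c X = (0 : E).
Proof. exact: vcomp_off. Qed.

Lemma tcoord_law c c' p (X : tangent atl p) : atl c -> atl c' -> dom c p -> dom c' p ->
  tcoord c' X = dtrans c c' p (tcoord c X).
Proof. by rewrite dtrans.unlock; exact: vcomp_law. Qed.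

Lemma tcoord_inj c p (X Y : tangent atl p) : atl c -> dom c p -> tcoord c X = tcoord c Y -> X = Y.
Proof. exact: (vcomp_inj). Qed.

Lemma tcoord_tangent_of c p a : atl c -> dom c p -> tcoord c (tangent_of atl c p a) = a.
Proof. by rewrite tangent_of.unlock; exact: (vcomp_tvec reg). Qed.

Lemma tangent_of_tcoord c p (X : tangent atl p) : atl c -> dom c p -> tangent_of atl c p (tcoord c X) = X.
Proof. by rewrite tangent_of.unlock; exact: (tvec_vcomp reg). Qed.

Lemma tcoord_tangent_ofE c c' p a : atl c -> atl c' -> dom c p -> dom c' p ->
  tcoord c' (tangent_of atl c p a) = dtrans c c' p a.
Proof. by rewrite dtrans.unlock tangent_of.unlock; exact: (vcomp_tvecE reg). Qed.

Lemma dtrans_id c p a : atl c -> dom c p -> dtrans c c p a = a.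
Proof. by rewrite dtrans.unlock; exact: (trans_diff_id reg). Qed.

Lemma dtrans_comp c c' c'' p a : atl c -> atl c' -> atl c'' ->
  dom c p -> dom c' p -> dom c'' p -> dtrans c c'' p a = dtrans c' c'' p (dtrans c c' p a).
Proof. by rewrite dtrans.unlock; exact: (trans_diff_comp reg). Qed.

Notation overlap c c' := (cmap c @` (dom c' `&` dom c)).

Lemma overlap_open c c' : atl c -> atl c' -> open (overlap c c').
Proof. by move=> ac ac'; exact: (reg.2 _ _ ac ac').1. Qed.

Lemma overlapP c c' p : dom c p -> dom c' p -> overlap c c' (cmap c p).
Proof. by move=> cp c'p; exists p. Qed.

Lemma transition_Ck c c' k : atl c -> atl c' -> Ck k (overlap c c') (transition c c').
Proof. by move=> ac ac'; exact: (Hatl.2 _ _ ac ac'). Qed.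

Lemma transition_diff c c' x : atl c -> atl c' -> overlap c c' x ->
  differentiable (transition c c') x.
Proof. by move=> ac ac' [p [c'p cp] <-]; exact: (reg.2 _ _ ac ac').2. Qed.

Lemma dtransE c c' p b : atl c -> atl c' -> dom c p -> dom c' p ->
  dtrans c c' p b = 'D_b (transition c c') (cmap c p).
Proof.
by move=> ac ac' cp c'p; rewrite dtrans.unlock deriveE //; exact: (transition_diff ac ac' (overlapP cp c'p)).
Qed.

Lemma dtrans_rV c c' p (b : E) : atl c -> atl c' -> dom c p -> dom c' p ->
  dtrans c c' p b = \sum_j b 0 j *: 'D_(delta_mx 0 j) (transition c c') (cmap c p).
Proof.
by move=> ac ac' cp c'p; rewrite dtrans.unlock; exact: (diff_rV b (transition_diff ac ac' (overlapP cp c'p))).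
Qed.

Lemma d2trans_sym c c' p a b : atl c -> atl c' -> dom c p -> dom c' p ->
  d2trans c c' p a b = d2trans c c' p b a.
Proof.
move=> ac ac' cp c'p; rewrite d2trans.unlock.
exact: (derive_sym_rV a b (overlap_open ac ac') (transition_Ck 2 ac ac')
  (overlapP cp c'p)).
Qed.

Lemma d2trans_diff c c' p a b : atl c -> atl c' -> dom c p -> dom c' p ->
  d2trans c c' p a b = 'd (fun x => 'D_b (transition c c') x) (cmap c p) a.
Proof.
move=> ac ac' cp c'p; rewrite d2trans.unlock deriveE //.
by apply: ((transition_Ck 2 ac ac').2 b).1; exact: overlapP.
Qed.

Lemma d2transDl c c' p a a' b : atl c -> atl c' -> dom c p -> dom c' p ->
  d2trans c c' p (a + a') b = d2trans c c' p a b + d2trans c c' p a' b.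
Proof. by move=> *; rewrite !d2trans_diff // linearD. Qed.

Lemma d2transZl c c' p k a b : atl c -> atl c' -> dom c p -> dom c' p ->
  d2trans c c' p (k *: a) b = k *: d2trans c c' p a b.
Proof. by move=> *; rewrite !d2trans_diff // linearZ. Qed.

(** Linearity in the inner direction is borrowed from the outer one by symmetry, so that linearity
    of b |-> 'D_b phi need not be carried to a neighborhood of p. *)
Lemma d2transDr c c' p a b b' : atl c -> atl c' -> dom c p -> dom c' p ->
  d2trans c c' p a (b + b') = d2trans c c' p a b + d2trans c c' p a b'.
Proof. by move=> *; rewrite !(d2trans_sym a) // d2transDl. Qed.

Lemma d2transZr c c' p k a b : atl c -> atl c' -> dom c p -> dom c' p ->
  d2trans c c' p a (k *: b) = k *: d2trans c c' p a b.
Proof. by move=> *; rewrite !(d2trans_sym a) // d2transZl. Qed.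

Lemma d2trans0l c c' p b : atl c -> atl c' -> dom c p -> dom c' p -> d2trans c c' p 0 b = 0.
Proof. by move=> *; rewrite d2trans_diff // linear0. Qed.

Lemma d2trans_sumr c c' p a (y : E) : atl c -> atl c' -> dom c p -> dom c' p ->
  \sum_j y 0 j *: d2trans c c' p a (delta_mx 0 j) = d2trans c c' p a y.
Proof.
move=> ac ac' cp c'p; rewrite (d2trans_sym a) // d2trans_diff // [in RHS](row_sum_delta y).
by rewrite linear_sum; apply: eq_bigr => j _; rewrite d2trans_sym // d2trans_diff // linearZ.
Qed.


Definition TM_of c p (y : E) : TM atl := existT _ p (tangent_of atl c p y).

Lemma cmap_nat c v :
  cmap (nat_chart atl c) v = (cmap c (tpi v), tcoord c (tvect v)) :> E * E.
Proof. by []. Qed.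

Lemma cmap_TM_of c p y : atl c -> dom c p ->
  cmap (nat_chart atl c) (TM_of c p y) = (cmap c p, y) :> E * E.
Proof. by move=> ac cp; rewrite cmap_nat tcoord_tangent_of. Qed.

Lemma nat_inj c : atl c -> chart_inj (nat_chart atl c).
Proof.
move=> ac [p X] [q Y] /= cp cq [/(reg.1 _ ac _ _ cp cq) pq XY].
by subst q; rewrite (vcomp_inj ac cp XY).
Qed.

Lemma nat_overlap c c' : atl c ->
  cmap (nat_chart atl c) @` (dom (nat_chart atl c') `&` dom (nat_chart atl c)) =
  [set z | overlap c c' z.1].
Proof.
move=> ac; apply/seteqP; split=> [_ [[p X] /= [c'p cp] <-]|[x y] /= [p [c'p cp] <-]].
  by exists p.
by exists (TM_of c p y) => //; exact: cmap_TM_of.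
Qed.

Lemma open_fst_preimage (V W : normedModType R) (U : set V) :
  open U -> open [set z : V * W | U z.1].
Proof. by move=> oU; apply: (@open_comp _ _ fst) => // z _; exact: cvg_fst. Qed.

Lemma nat_overlap_open c c' : atl c -> atl c' -> open [set z : E * E | overlap c c' z.1].
Proof. by move=> ac ac'; apply: open_fst_preimage; exact: overlap_open. Qed.

Lemma nat_transitionE c c' (z : E * E) : atl c -> atl c' -> overlap c c' z.1 ->
  transition (nat_chart atl c) (nat_chart atl c') z =
  (transition c c' z.1, 'd (transition c c') (z.1) z.2) :> E * E.
Proof.
case: z => x y ac ac' /= [p [c'p cp] <-].
rewrite -(cmap_TM_of y ac cp).
have -> : transition (nat_chart atl c) (nat_chart atl c') (cmap (nat_chart atl c) (TM_of c p y)) =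
    cmap (nat_chart atl c') (TM_of c p y) by apply: in_chartE => //; exact: nat_inj.
by rewrite cmap_nat tcoord_tangent_ofE // -(transitionE reg ac cp c'p) dtrans.unlock.
Qed.

(** In (x, y) |-> D phi_x y both the point and the direction move. Expanding y on the basis gives a
    finite sum of products of a coordinate y_j with the function 'D_(e j) phi of x, and the Leibniz
    rule applies to each product. *)
Lemma is_diff_nat_transition c c' p (y : E) : atl c -> atl c' -> dom c p -> dom c' p ->
  is_diff (cmap c p, y) (transition (nat_chart atl c) (nat_chart atl c'))
    (fun w => (dtrans c c' p w.1, d2trans c c' p w.1 y + dtrans c c' p w.2)).
Proof.
move=> ac ac' cp c'p; set x := cmap c p.
pose phi := transition c c'; pose e j : E := delta_mx 0 j.
have dphi : differentiable phi x by exact: (transition_diff ac ac' (overlapP cp c'p)).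
have ddphi v : differentiable (fun x => 'D_v phi x) x.
  by apply: ((transition_Ck 2 ac ac').2 v).1; exact: overlapP.
have d1 : is_diff (x, y) (phi \o fst) ('d phi x \o fst).
  have df := is_diff_fst (x, y).
  split; first by apply: differentiable_comp => //; exact: ex_diff.
  by rewrite diff_comp //; rewrite diff_val.
pose F j (z : E * E) := z.2 0 j *: 'D_(e j) phi (z.1).
have dF j : is_diff (x, y) (F j)
    (fun w => y 0 j *: d2trans c c' p w.1 (e j) + w.2 0 j *: 'D_(e j) phi x).
  have df := is_diff_fst (x, y); have ds := is_diff_snd (x, y).
  have dc : is_diff (x, y) (fun z : E * E => z.2 0 j : R) (fun w => w.2 0 j).
    have dj := is_diff_coord y j.
    have -> : (fun z : E * E => z.2 0 j : R) = (fun x : E => x 0 j : R) \o snd by [].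
    by apply: is_diff_eq; apply/funext => w.
  have dD : is_diff (x, y) (fun z : E * E => 'D_(e j) phi (z.1))
      (fun w => d2trans c c' p w.1 (e j)).
    split; first exact: (@differentiable_comp _ _ _ _ fst (fun x => 'D_(e j) phi x)).
    rewrite (@diff_comp _ _ _ _ fst (fun x => 'D_(e j) phi x)) //.
    by rewrite diff_val; apply/funext => w; rewrite /= d2trans_diff.
  have [d v] := is_diff_scale (@ex_diff _ _ _ _ _ _ _ dc) (@ex_diff _ _ _ _ _ _ _ dD).
  by split=> //; rewrite v !diff_val.
have dS := is_diff_sum (index_enum 'I_n) dF.
have dPhi := is_diff_pair d1 dS.
have E : \forall z \near (x, y), (phi z.1, \sum_j F j z) =
    transition (nat_chart atl c) (nat_chart atl c') z.
  apply: (@eq_on_near _ _ _ [set z | overlap c c' z.1]).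
  - exact: nat_overlap_open.
  - exact: overlapP.
  - move=> z zU; rewrite nat_transitionE // diff_rV //.
    exact: (transition_diff ac ac').
have [d v] := near_eq_diff E (is_diff_differentiable dPhi).
split; first exact: d.
rewrite v (is_diff_val dPhi); apply/funext => w; congr (_, _); first by rewrite dtrans.unlock.
rewrite -(d2trans_sumr w.1 y ac ac' cp c'p) (dtrans_rV w.2 ac ac' cp c'p).
exact: big_split.
Qed.

Lemma nat_atlasP c : atl c -> nat_atlas atl (nat_chart atl c).
Proof. by move=> ac; exists c. Qed.

Lemma nat_regular : regular_atlas (nat_atlas atl).
Proof.
split=> [_ [c ac <-]|_ _ [c ac <-] [c' ac' <-]]; first exact: nat_inj.
split; first by rewrite nat_overlap //; exact: nat_overlap_open.
move=> v cv c'v.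
exact: is_diff_differentiable (is_diff_nat_transition (tcoord c (tvect v)) ac ac' cv c'v).
Qed.

Lemma trans_diff_nat c c' (v : TM atl) (w : E * E) : atl c -> atl c' ->
  dom c (tpi v) -> dom c' (tpi v) ->
  trans_diff (nat_chart atl c) (nat_chart atl c') v w =
  (dtrans c c' (tpi v) w.1, d2trans c c' (tpi v) w.1 (tcoord c (tvect v)) + dtrans c c' (tpi v) w.2)
  :> E * E.
Proof.
move=> ac ac' cv c'v.
by rewrite /trans_diff (is_diff_val (is_diff_nat_transition (tcoord c (tvect v)) ac ac' cv c'v)).
Qed.

(* Components of X in the natural chart: those of d/dx^i and those of d/dy^i. *)
Definition hcoord c v (X : TTM v) : E := (vcomp X (nat_chart atl c)).1.
Definition vcoord c v (X : TTM v) : E := (vcomp X (nat_chart atl c)).2.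
Definition TTM_of c v (a b : E) : TTM v := tvec (nat_atlas atl) v (nat_chart atl c) (a, b).

Lemma hcoordB c v (X Y : TTM v) : hcoord c (X - Y) = hcoord c X - hcoord c Y.
Proof. by []. Qed.
Lemma vcoordB c v (X Y : TTM v) : vcoord c (X - Y) = vcoord c X - vcoord c Y.
Proof. by []. Qed.
Lemma hcoordZ c v k (X : TTM v) : hcoord c (k *: X) = k *: hcoord c X.
Proof. by []. Qed.
Lemma vcoordZ c v k (X : TTM v) : vcoord c (k *: X) = k *: vcoord c X.
Proof. by []. Qed.
Lemma hcoordD c v (X Y : TTM v) : hcoord c (X + Y) = hcoord c X + hcoord c Y.
Proof. by []. Qed.
Lemma vcoordD c v (X Y : TTM v) : vcoord c (X + Y) = vcoord c X + vcoord c Y.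
Proof. by []. Qed.

Lemma hcoord_law c c' v (X : TTM v) : atl c -> atl c' -> dom c (tpi v) -> dom c' (tpi v) ->
  hcoord c' X = dtrans c c' (tpi v) (hcoord c X).
Proof.
move=> ac ac' cv c'v.
by rewrite /hcoord (vcompE X (nat_atlasP ac) (nat_atlasP ac') cv c'v) trans_diff_nat.
Qed.

(** The second-order term is the source of the defect: a vector without vertical part in c may
    acquire one in c'. *)
Lemma vcoord_law c c' v (X : TTM v) : atl c -> atl c' -> dom c (tpi v) -> dom c' (tpi v) ->
  vcoord c' X = d2trans c c' (tpi v) (hcoord c X) (tcoord c (tvect v)) + dtrans c c' (tpi v) (vcoord c X).
Proof.
move=> ac ac' cv c'v.
by rewrite /vcoord (vcompE X (nat_atlasP ac) (nat_atlasP ac') cv c'v) trans_diff_nat.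
Qed.

Lemma hcoord_TTM_of c v a b : atl c -> dom c (tpi v) -> hcoord c (TTM_of c v a b) = a.
Proof.
by move=> ac cv; rewrite /hcoord /TTM_of (vcomp_tvec nat_regular _ (nat_atlasP ac) cv).
Qed.

Lemma vcoord_TTM_of c v a b : atl c -> dom c (tpi v) -> vcoord c (TTM_of c v a b) = b.
Proof.
by move=> ac cv; rewrite /vcoord /TTM_of (vcomp_tvec nat_regular _ (nat_atlasP ac) cv).
Qed.

Lemma hvcoord_inj c v (X Y : TTM v) : atl c -> dom c (tpi v) ->
  hcoord c X = hcoord c Y -> vcoord c X = vcoord c Y -> X = Y.
Proof.
move=> ac cv xE yE; apply: (vcomp_inj (nat_atlasP ac) cv).
by rewrite [LHS]surjective_pairing [RHS]surjective_pairing; congr (_, _).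
Qed.

End NaturalAtlas.

(** * Vertical lift, projection and fiber scaling in natural charts *)

Section NaturalMaps.
Context {R : realType} {M : Type} {n : nat}.
Local Notation E := 'rV[R]_n.
Implicit Types c : chart M E.
Variables (atl : set (chart M E)) (Hatl : smooth_atlas atl).
Let reg : regular_atlas atl := Hatl.1.
Notation overlap c c' := (cmap c @` (dom c' `&` dom c)).


Lemma tcoord_hscale c l (v : TM atl) : tcoord c (tvect (hscale l v)) = l *: tcoord c (tvect v).
Proof. by []. Qed.

(* The second-order chain rule is the vertical part of the functoriality of the
   differentials of the natural transitions. *)
Lemma d2trans_comp c c' c'' p a b : atl c -> atl c' -> atl c'' ->
  dom c p -> dom c' p -> dom c'' p ->
  d2trans c c'' p a b = d2trans c' c'' p (dtrans c c' p a) (dtrans c c' p b) + dtrans c' c'' p (d2trans c c' p a b).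
Proof.
move=> ac ac' ac'' cp c'p c''p; pose v : TM atl := TM_of atl c p b.
have vb : tcoord c (tvect v) = b by exact: tcoord_tangent_of.
pose X := TTM_of c v a 0.
have [Xa X0] : hcoord c X = a /\ vcoord c X = 0 by rewrite hcoord_TTM_of ?vcoord_TTM_of.
have := vcoord_law Hatl X ac' ac'' c'p c''p.
rewrite (vcoord_law Hatl X ac ac'' cp c''p) (vcoord_law Hatl X ac ac' cp c'p).
rewrite (hcoord_law Hatl X ac ac' cp c'p) (tcoord_law (tvect v) ac ac' cp c'p).
by rewrite Xa X0 vb !dtrans0 !addr0.
Qed.

(* The second-order chain rule for c, c, c reads D = D + D. *)
Lemma d2trans_id c p a b : atl c -> dom c p -> d2trans c c p a b = 0.
Proof.
move=> ac cp; have := d2trans_comp a b ac ac ac cp cp cp.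
rewrite !(dtrans_id Hatl _ ac cp) => /eqP.
by rewrite -subr_eq subrr => /eqP.
Qed.

(** The second-order term of the transition law is linear in the horizontal part, so it vanishes on
    pairs (0, w): these transform like w itself, and the specification of [vlift] is met in all
    charts at once. *)
Lemma vlift_coord c (v : TM atl) (w : tangent atl (tpi v)) : atl c -> dom c (tpi v) ->
  hcoord c (vlift w) = 0 /\ vcoord c (vlift w) = tcoord c w.
Proof.
move=> ac cv; rewrite /vlift; set S := [set X | _].
suff /xgetI : S (TTM_of c v 0 (tcoord c w)).
  by move=> /(_ 0) /(_ c ac cv) e; rewrite /hcoord /vcoord e.
move=> c' ac' c'v; rewrite [LHS]surjective_pairing.
rewrite -/(hcoord c' (TTM_of c v 0 (tcoord c w))) -/(vcoord c' (TTM_of c v 0 (tcoord c w))).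
rewrite (hcoord_law Hatl _ ac ac' cv c'v) (vcoord_law Hatl _ ac ac' cv c'v).
rewrite hcoord_TTM_of // vcoord_TTM_of // dtrans0 (d2trans0l Hatl _ ac ac' cv c'v) add0r.
by rewrite -(tcoord_law w ac ac' cv c'v).
Qed.

(** The equality holds on the whole space because off the overlap both sides take the default value
    0 of [in_chart]. *)
Lemma in_chart_tpi c d : atl c ->
  in_chart (nat_chart atl c) (fun w (_ : [set q | dom d (tpi q)] w) => cmap d (tpi w)) =
  transition c d \o (@fst E E).
Proof.
move=> ac; apply/funext => -[x y] /=.
have [[p [dp cp] <-]|n_] := pselect (overlap c d x).
  rewrite (transitionE reg) // -(cmap_TM_of Hatl y ac cp).
  have dv : [set q | dom d (tpi q)] (TM_of atl c p y) by [].
  by rewrite (in_chartE _ dv) //; exact: nat_inj.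
have -> : transition c d x = 0 by exact: in_chart_off.
by apply: in_chart_off => -[[p X] /= [dp cp] [px _]]; apply: n_; exists p.
Qed.

Lemma diff_tpi c d (v : TM atl) (w : E * E) : atl c -> atl d ->
  dom c (tpi v) -> dom d (tpi v) ->
  'd (in_chart (nat_chart atl c)
        (fun w (_ : [set q | dom d (tpi q)] w) => cmap d (tpi w)))
     (cmap (nat_chart atl c) v) w = dtrans c d (tpi v) w.1.
Proof.
move=> ac ad cv dv; rewrite in_chart_tpi //.
have D := is_diff_fst (cmap (nat_chart atl c) v : E * E).
rewrite (diff_comp (is_diff_differentiable D) (transition_diff Hatl ac ad (overlapP cv dv))).
by rewrite /= (is_diff_val D) dtrans.unlock.
Qed.

Lemma in_chart_hscale c d l : atl c ->
  in_chart (nat_chart atl c)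
    (fun w (_ : [set q | dom (nat_chart atl d) (hscale l q)] w) =>
       cmap (nat_chart atl d) (hscale l w)) =
  transition (nat_chart atl c) (nat_chart atl d) \o (fun z : E * E => (z.1, l *: z.2) : E * E).
Proof.
move=> ac; apply/funext => -[x y] /=.
have [[p [dp cp] <-]|n_] := pselect (overlap c d x).
  pose v : TM atl := TM_of atl c p y.
  have -> : (cmap c p, l *: y) = cmap (nat_chart atl c) (hscale l v) :> E * E.
    by rewrite cmap_nat tcoord_hscale tcoord_tangent_of.
  rewrite (transitionE (nat_regular Hatl) (nat_atlasP ac)) //.
  rewrite -(cmap_TM_of Hatl y ac cp).
  have dv : [set q | dom (nat_chart atl d) (hscale l q)] v by [].
  by rewrite (in_chartE _ dv) //; exact: nat_inj.
have -> : transition (nat_chart atl c) (nat_chart atl d) (x, l *: y : E) = 0.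
  by apply: in_chart_off => -[[p X] /= [dp cp] [px _]]; apply: n_; exists p.
by apply: in_chart_off => -[[p X] /= [dp cp] [px _]]; apply: n_; exists p.
Qed.

Lemma diff_hscale c d l (v : TM atl) (w : E * E) : atl c -> atl d ->
  dom c (tpi v) -> dom d (tpi v) ->
  'd (in_chart (nat_chart atl c)
      (fun w (_ : [set q | dom (nat_chart atl d) (hscale l q)] w) =>
       cmap (nat_chart atl d) (hscale l w)))
     (cmap (nat_chart atl c) v) w =
  trans_diff (nat_chart atl c) (nat_chart atl d) (hscale l v) (w.1, l *: w.2).
Proof.
move=> ac ad cv dv; rewrite in_chart_hscale //.
set z : E * E := cmap _ v.
have D1 := is_diff_fst z; have D2 := is_diff_snd z.
have D3 : is_diff z (l \*: snd : E * E -> E) (l \*: snd) by exact: is_diffZ.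
have D := is_diff_pair D1 D3.
have Dt := is_diff_nat_transition Hatl (tcoord c (tvect (hscale l v))) ac ad (p := tpi v) cv dv.
rewrite (@diff_comp _ _ _ _ _ (transition (nat_chart atl c) (nat_chart atl d)) z
  (is_diff_differentiable D) (is_diff_differentiable Dt)).
transitivity (trans_diff (nat_chart atl c) (nat_chart atl d) (hscale l v)
  ('d (fun y : E * E => (y.1, (l \*: (snd : E * E -> E)) y)) z w)); first by [].
by rewrite (is_diff_val D).
Qed.

Lemma tcoord_dmap_tpi c (v : TM atl) (X : TTM v) : atl c -> dom c (tpi v) ->
  tcoord c (dmap atl (@tpi _ _ _ atl) X) = hcoord c X.
Proof.
move=> ac cv; rewrite /dmap; set S := [set Y | _].
suff /xgetI : S (tangent_of atl c (tpi v) (hcoord c X)).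
  move=> /(_ 0) /(_ _ c (nat_atlasP ac) cv ac cv) e.
  by apply: (etrans e); rewrite diff_tpi // -/(hcoord c X) (dtrans_id Hatl).
move=> _ d [c' ac' <-] c'v ad dv.
apply: (etrans (tcoord_tangent_ofE Hatl _ ac ad cv dv)); rewrite diff_tpi // -/(hcoord c' X).
by rewrite (hcoord_law Hatl X ac ac' cv c'v) -(dtrans_comp Hatl).
Qed.

(** In natural coordinates [hscale l] is (x, y) |-> (x, l y). Since [dmap] is specified by all pairs
    of charts, the candidate Y built in c has to be checked in every pair (c', d); this uses that
    [d2trans] is linear in its second argument, here l y. *)
Lemma dmap_hscale_coord c l (v : TM atl) (X : TTM v) : atl c -> dom c (tpi v) ->
  let Y : TTM (hscale l v) := dmap (nat_atlas atl) (hscale l) X in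
  hcoord c Y = hcoord c X /\ vcoord c Y = l *: vcoord c X.
Proof.
move=> ac cv; rewrite /dmap /=; set S := [set Y | _].
pose Y := TTM_of c (hscale l v) (hcoord c X) (l *: vcoord c X).
have cv' : dom (nat_chart atl c) (hscale l v) by [].
suff SY : S Y.
  suff -> : xget 0 S = Y by rewrite hcoord_TTM_of ?vcoord_TTM_of.
  apply: xget_subset1 SY _ => Y1 Y2 S1 S2; apply: (vcomp_inj (nat_atlasP ac) cv').
  rewrite (S1 _ _ (nat_atlasP ac) cv (nat_atlasP ac) cv').
  by rewrite (S2 _ _ (nat_atlasP ac) cv (nat_atlasP ac) cv').
move=> _ _ [c' ac' <-] c'v [d ad <-] dv.
rewrite diff_hscale // [LHS]surjective_pairing -/(hcoord d Y) -/(vcoord d Y).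
rewrite (trans_diff_nat Hatl _ ac' ad (v := hscale l v) c'v dv) /=.
rewrite -/(hcoord c' X) -/(vcoord c' X).
have xE : hcoord c' Y = hcoord c' X.
  by rewrite (hcoord_law Hatl Y ac ac' cv c'v) (hcoord_law Hatl X ac ac' cv c'v) hcoord_TTM_of.
have yE : vcoord c' Y = l *: vcoord c' X.
  rewrite (vcoord_law Hatl Y ac ac' cv c'v) (vcoord_law Hatl X ac ac' cv c'v).
  rewrite (hcoord_TTM_of Hatl (v := hscale l v) _ _ ac cv) (vcoord_TTM_of Hatl (v := hscale l v) _ _ ac cv).
  by rewrite tcoord_hscale (d2transZr Hatl _ _ _ ac ac' cv c'v) dtransZ scalerDr.
rewrite (hcoord_law Hatl Y ac' ad c'v dv) (vcoord_law Hatl Y ac' ad c'v dv).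
by rewrite xE yE.
Qed.

End NaturalMaps.

(** * Anisotropic tensors and vertical derivatives *)

Section Multilinear.
Context {R : realType} {M : Type} {n : nat}.
Local Notation E := 'rV[R]_n.
Implicit Types c : chart M E.
Variables (atl : set (chart M E)) (Hatl : smooth_atlas atl).

Definition set_arg s (T : Type) (u : 'I_s -> T) (k : 'I_s) (x : T) : 'I_s -> T :=
  fun i => if i == k then x else u i.

Definition frame c p s (J : 'I_s -> 'I_n) : 'I_s -> tangent atl p :=
  fun k => tangent_of atl c p (evec (J k)).

Lemma tcompE s p c (t : mtensor atl s p) J : tcomp c t J = tcoord c (t (frame c p J)) :> E.
Proof.
rewrite /tcomp; have -> // : (fun k => tvec atl p c (evec (J k))) = frame c p J.
by apply/funext => k; rewrite /frame tangent_of.unlock.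
Qed.

Lemma set_arg_same s T (u : 'I_s -> T) k : set_arg u k (u k) = u.
Proof. by apply/funext => i; rewrite /set_arg; case: eqP => [->|]. Qed.

Lemma linear_lsum (V W : lmodType R) (f : V -> W) (I : Type) (r : seq I) (a : I -> R)
    (x : I -> V) : linear f ->
  f (\sum_(i <- r) a i *: x i) = \sum_(i <- r) a i *: f (x i).
Proof.
move=> lf; pose fM := GRing.isLinear.Build _ _ _ _ f lf.
pose fL : {linear V -> W} := HB.pack f fM.
by rewrite -[f]/(fL : _ -> _) linear_sum; apply: eq_bigr => i _; rewrite linearZ.
Qed.

Lemma tangent_ofD c p (a b : E) : atl c -> dom c p ->
  tangent_of atl c p (a + b) = tangent_of atl c p a + tangent_of atl c p b.
Proof. by move=> ac cp; apply: (tcoord_inj ac cp); rewrite tcoordD !tcoord_tangent_of. Qed.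

Lemma tangent_ofZ c p k (a : E) : atl c -> dom c p -> tangent_of atl c p (k *: a) = k *: tangent_of atl c p a.
Proof. by move=> ac cp; apply: (tcoord_inj ac cp); rewrite tcoordZ !tcoord_tangent_of. Qed.

Lemma tcoord_sum c p (I : Type) (r : seq I) (f : I -> tangent atl p) :
  tcoord c (\sum_(i <- r) f i) = \sum_(i <- r) tcoord c (f i) :> E.
Proof.
elim: r => [|i r IH]; first by rewrite !big_nil.
by rewrite !big_cons tcoordD IH.
Qed.

Lemma tangent_sum c p (X : tangent atl p) : atl c -> dom c p ->
  X = \sum_j tcoord c X 0 j *: tangent_of atl c p (evec j).
Proof.
move=> ac cp; apply: (tcoord_inj ac cp); rewrite tcoord_sum {1}[tcoord c X]row_sum_delta.
by apply: eq_bigr => j _; rewrite tcoordZ tcoord_tangent_of.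
Qed.

Lemma multilinear_expand s p (t : mtensor atl s p) c u k : multilinear t ->
  atl c -> dom c p ->
  t u = \sum_j tcoord c (u k) 0 j *: t (set_arg u k (tangent_of atl c p (evec j))).
Proof.
move=> mt ac cp; rewrite -{1}[u](set_arg_same u k) {1}(tangent_sum (u k) ac cp).
exact: (linear_lsum _ _ _ (mt k u)).
Qed.

(** An induction principle for multilinear statements: arguments are replaced by basis vectors one
    slot at a time. The auxiliary induction is on m, the slots of index at least m being basis
    vectors already. *)
Lemma frame_ind s c p (Q : ('I_s -> tangent atl p) -> Prop) :
  (forall J, Q (frame c p J)) ->
  (forall u k, (forall j, Q (set_arg u k (tangent_of atl c p (evec j)))) -> Q u) ->
  forall u, Q u.
Proof.
move=> Q0 QS u.
suff H m : (m <= s)%N -> forall u, (forall i : 'I_s, (m <= i)%N ->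
    exists j, u i = tangent_of atl c p (evec j)) -> Q u.
  by apply: (H s) => // i; rewrite leqNgt ltn_ord.
elim: m => [_|m IH ms] {}u Hu.
  have /choice[J HJ] : forall i, exists j, u i = tangent_of atl c p (evec j).
    by move=> i; exact: Hu.
  by have -> : u = frame c p J by apply/funext.
apply: (QS u (Ordinal ms)) => j; apply: IH; first exact: ltnW.
move=> i mi; rewrite /set_arg; case: eqP => [_|/eqP im]; first by exists j.
by apply: Hu; rewrite ltn_neqAle mi andbT eq_sym.
Qed.

Lemma multilinear_ext s p (t t' : mtensor atl s p) c : atl c -> dom c p ->
  multilinear t -> multilinear t' ->
  (forall J, tcomp c t J = tcomp c t' J) -> t = t'.
Proof.
move=> ac cp mt mt' tt'; apply/funext; apply: (@frame_ind s c p) => [J|u k Hu].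
  by apply: (tcoord_inj ac cp); have := tt' J; rewrite !tcompE.
rewrite (multilinear_expand u k mt ac cp) (multilinear_expand u k mt' ac cp).
by apply: eq_bigr => j _; rewrite Hu.
Qed.

End Multilinear.

(** * The vertical derivative inside one fiber *)

Section VerticalDerivative.
Context {R : realType} {M : Type} {n : nat}.
Local Notation E := 'rV[R]_n.
Implicit Types c : chart M E.
Variables (atl : set (chart M E)) (Hatl : smooth_atlas atl).
Implicit Types B : set (TM atl).
Let reg : regular_atlas atl := Hatl.1.

Notation nat_image c B := (cmap (nat_chart atl c) @` (B `&` dom (nat_chart atl c))).

(** TM carries no topology here; openness is read in the natural charts, as in [conic_domain]. *)
Definition nat_open B := forall c, atl c -> open (nat_image c B).
Definition conic B := forall (l : R) v, 0 < l -> B v -> B (hscale l v).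

(* T at the point y of the fiber over p, extended by zero outside B. *)
Definition fiber_ext s B (T : tsec s B) p (y : tangent atl p) (u : 'I_s -> tangent atl p) :
  tangent atl p := xget 0 [set X | exists Bw, X = T (existT _ p y) Bw u].

Lemma fiber_extE s B (T : tsec s B) v (Bv : B v) u : fiber_ext T (tvect v) u = T v Bv u.
Proof.
case: v Bv u => p y Bv u; apply: (@xget_subset1 _ _ _ (T (existT _ p y) Bv u)).
  by exists Bv.
by move=> X Y [Bw ->] [Bw' ->]; rewrite (Prop_irrelevance Bw Bw').
Qed.

Lemma fiber_ext_off s B (T : tsec s B) p (y : tangent atl p) u : ~ B (existT _ p y) -> fiber_ext T y u = 0.
Proof. by move=> nB; apply: xgetPN => X [Bw _]. Qed.

Lemma fiber_ext_multilinear s B (T : tsec s B) p (y : tangent atl p) :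
  (forall v Bv, multilinear (T v Bv)) -> multilinear (fiber_ext T y).
Proof.
move=> mT k u; have [By|nB] := pselect (B (existT _ p y)).
  have E1 w : fiber_ext T y w = T (existT _ p y) By w := fiber_extE T By w.
  by move=> a x x'; rewrite !E1; exact: (mT _ By k u).
by move=> a x x'; rewrite !fiber_ext_off // scaler0 addr0.
Qed.

(** With p and the vectors u frozen, the vertical derivative is an ordinary differential on R^n.
    Keeping vectors rather than indices as arguments lets u stay the same when the chart changes. *)
Definition fiber_expr s B (T : tsec s B) c p (u : 'I_s -> tangent atl p) (y : E) : E :=
  tcoord c (fiber_ext T (tangent_of atl c p y) u).

Lemma nat_image_TM_of B c p y : atl c -> dom c p ->
  nat_image c B (cmap c p, y) <-> B (TM_of atl c p y).
Proof.
move=> ac cp; split=> [[v [Bv cv]]|Bv]; last first.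
  by exists (TM_of atl c p y) => //; exact: cmap_TM_of.
rewrite -(cmap_TM_of Hatl y ac cp) => vE.
by rewrite -(nat_inj Hatl ac cv _ vE).
Qed.

Lemma fiber_exprE s B (T : tsec s B) c p J (y : E) : atl c -> dom c p ->
  in_chart (nat_chart atl c) (fun v Bv => tcomp c (T v Bv) J) (cmap c p, y) =
  fiber_expr T c (frame atl c p J) y.
Proof.
move=> ac cp; have [By|nB] := pselect (B (TM_of atl c p y)).
  rewrite -(cmap_TM_of Hatl y ac cp) (in_chartE _ By) //; last exact: nat_inj.
  by rewrite tcompE /fiber_expr -[tangent_of atl c p y]/(tvect (TM_of atl c p y)) (fiber_extE T By).
rewrite in_chart_off; last by move/(nat_image_TM_of B y ac cp).
by rewrite /fiber_expr fiber_ext_off // tcoord0.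
Qed.

Lemma is_diff_slice (W : normedModType R) (G : E * E -> W) (x y : E) :
  differentiable G (x, y) ->
  is_diff y (fun z => G (x, z)) (fun w => 'd G (x, y) (0, w)).
Proof.
move=> dG.
have D := is_diff_pair (is_diff_cst x y) (is_diff_id y).
have -> : (fun z => G (x, z)) = G \o (fun z : E => (cst x z, id z)) by [].
split; first exact: (differentiable_comp (is_diff_differentiable D) dG).
rewrite (diff_comp (is_diff_differentiable D) dG).
by apply/funext => w; rewrite /= (is_diff_val D).
Qed.

Lemma diff_conj (V1 V2 V3 V4 : normedModType R) (K : V1 -> V2) (F : V2 -> V3)
    (L : V3 -> V4) dK dF dL y a :
  is_diff y K dK -> is_diff (K y) F dF -> is_diff (F (K y)) L dL ->
  'd (L \o (F \o K)) y a = dL (dF (dK a)).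
Proof.
move=> D1 D2 D3.
by rewrite (is_diff_val (is_diff_comp (is_diff_comp D1 D2) (D3 : is_diff ((F \o K) y) _ _))).
Qed.

Lemma diff_lincomb (V W : normedModType R) (f g : V -> W) a y w :
  differentiable f y -> differentiable g y ->
  'd (a *: f + g) y w = a *: 'd f y w + 'd g y w.
Proof.
move=> D1 D2.
by rewrite (is_diff_val (is_diffD (is_diffZ a (differentiableP D1)) (differentiableP D2))).
Qed.

Section Fixed.
Variables (s : nat) (B : set (TM atl)) (T : tsec s B).
Arguments T : clear implicits.
Hypothesis oB : nat_open B.
Hypothesis mT : forall v Bv, multilinear (T v Bv).
Hypothesis sT : forall c J, atl c ->
  smooth_in (nat_chart atl c) (fun v Bv => tcomp c (T v Bv) J).

(* The smoothness of T is only known on the coordinate frame; multilinearity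
   extends it to arbitrary arguments u. *)
Lemma fiber_expr_diff c v (u : 'I_s -> tangent atl (tpi v)) : atl c -> dom c (tpi v) -> B v ->
  differentiable (fiber_expr T c u) (tcoord c (tvect v)).
Proof.
move=> ac cv Bv; move: u; apply: (@frame_ind _ _ _ atl s c (tpi v)) => [J|u k Hu].
  have dG : differentiable
      (in_chart (nat_chart atl c) (fun v Bv => tcomp c (T v Bv) J) : E * E -> E)
      (cmap c (tpi v), tcoord c (tvect v)).
    by apply: (sT J ac 1).1; exists v.
  have D := is_diff_slice dG.
  suff -> : fiber_expr T c (frame atl c (tpi v) J) = (fun z : E => in_chart (nat_chart atl c)
      (fun v Bv => tcomp c (T v Bv) J) (cmap c (tpi v), z)) by exact: is_diff_differentiable D.
  by apply/funext => z; rewrite fiber_exprE.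
have -> : fiber_expr T c u = fun y =>
    \sum_j tcoord c (u k) 0 j *: fiber_expr T c (set_arg u k (tangent_of atl c (tpi v) (evec j))) y.
  apply/funext => y; rewrite /fiber_expr.
  rewrite (multilinear_expand Hatl u k (fiber_ext_multilinear _ mT) ac cv) tcoord_sum.
  by apply: eq_bigr => j _; rewrite tcoordZ.
have Hj j := differentiableP (Hu j).
have Hz j := is_diffZ (tcoord c (u k) 0 j) (Hj j).
exact: is_diff_differentiable (is_diff_sum _ Hz).
Qed.

Lemma is_diff_dtrans c c' p (y : E) : is_diff y (dtrans c c' p) (dtrans c c' p).
Proof. by apply: is_diff_linear => k a b; rewrite dtransD dtransZ. Qed.

Lemma fiber_expr_chart c c' p (u : 'I_s -> tangent atl p) y : atl c -> atl c' ->
  dom c p -> dom c' p -> fiber_expr T c' u y = dtrans c c' p (fiber_expr T c u (dtrans c' c p y)).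
Proof.
move=> ac ac' cp c'p; rewrite /fiber_expr (tcoord_law _ ac ac' cp c'p).
suff -> : tangent_of atl c' p y = tangent_of atl c p (dtrans c' c p y) by [].
by apply: (tcoord_inj ac cp); rewrite tcoord_tangent_of // tcoord_tangent_ofE.
Qed.

Definition init_args (S : Type) (u : 'I_s.+1 -> S) : 'I_s -> S :=
  fun k => u (widen_ord (leqnSn s) k).

Definition vderiv c (v : TM atl) (u : 'I_s.+1 -> tangent atl (tpi v)) : E :=
  'd (fiber_expr T c (init_args u)) (tcoord c (tvect v)) (tcoord c (u ord_max)).

(** Tensoriality of the vertical derivative: on a fixed fiber a change of chart conjugates
    [fiber_expr] by linear maps, which are their own differentials, so that no second derivative of
    the transition can appear. *)
Lemma vderiv_chart c c' v (u : 'I_s.+1 -> tangent atl (tpi v)) : atl c -> atl c' ->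
  dom c (tpi v) -> dom c' (tpi v) -> B v ->
  vderiv c' u = dtrans c c' (tpi v) (vderiv c u).
Proof.
move=> ac ac' cv c'v Bv; rewrite /vderiv.
have -> : fiber_expr T c' (init_args u) =
    dtrans c c' (tpi v) \o (fiber_expr T c (init_args u) \o dtrans c' c (tpi v)).
  by apply/funext => y; rewrite /= -fiber_expr_chart.
have yE : dtrans c' c (tpi v) (tcoord c' (tvect v)) = tcoord c (tvect v).
  by rewrite -(tcoord_law (tvect v) ac' ac c'v cv).
have D1 := is_diff_dtrans c' c (tpi v) (tcoord c' (tvect v)).
have D2 : is_diff (dtrans c' c (tpi v) (tcoord c' (tvect v))) (fiber_expr T c (init_args u))
    ('d (fiber_expr T c (init_args u)) (tcoord c (tvect v))).
  by rewrite yE; exact: (differentiableP (fiber_expr_diff (init_args u) ac cv Bv)).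
have D3 := is_diff_dtrans c c' (tpi v) ((fiber_expr T c (init_args u) \o dtrans c' c (tpi v)) (tcoord c' (tvect v))).
apply: etrans (diff_conj (tcoord c' (u ord_max)) D1 D2 D3) _.
by rewrite -(tcoord_law (u ord_max) ac' ac c'v cv).
Qed.

Lemma init_args_set_max S (u : 'I_s.+1 -> S) x : init_args (set_arg u ord_max x) = init_args u.
Proof.
apply/funext => i; rewrite /init_args /set_arg; case: eqP => // /(congr1 val) /= iE.
by have := ltn_ord i; rewrite iE ltnn.
Qed.

Lemma init_args_set_widen S (u : 'I_s.+1 -> S) k x :
  init_args (set_arg u (widen_ord (leqnSn s) k) x) = set_arg (init_args u) k x.
Proof. by apply/funext => i; rewrite /init_args /set_arg -val_eqE. Qed.

Lemma vderiv_multilinear c v k (u : 'I_s.+1 -> tangent atl (tpi v)) :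
  atl c -> dom c (tpi v) -> B v -> linear (fun x => vderiv c (set_arg u k x)).
Proof.
move=> ac cv Bv a x x'; rewrite /vderiv.
(* In the last slot, the direction of differentiation, linearity is that of a differential; in the
   other slots it is that of T, passed through the differential. *)
case: (unliftP ord_max k) => [j ->|->]; last first.
  by rewrite !init_args_set_max /set_arg eqxx tcoordD tcoordZ linearP.
have -> : lift ord_max j = widen_ord (leqnSn s) j.
  by apply: val_inj; rewrite /= /bump leqNgt ltn_ord.
have maxE y : set_arg u (widen_ord (leqnSn s) j) y ord_max = u ord_max.
  by rewrite /set_arg; case: eqP => // /(congr1 val) /= jE; have := ltn_ord j; rewrite -jE ltnn.
rewrite !maxE !init_args_set_widen.
have -> : fiber_expr T c (set_arg (init_args u) j (a *: x + x')) =
    a *: fiber_expr T c (set_arg (init_args u) j x) + fiber_expr T c (set_arg (init_args u) j x').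
  apply/funext => y; rewrite !fctE /fiber_expr -tcoordZ -tcoordD; congr (tcoord _ _).
  exact: (fiber_ext_multilinear _ mT).
have D1 := fiber_expr_diff (set_arg (init_args u) j x) ac cv Bv.
have D2 := fiber_expr_diff (set_arg (init_args u) j x') ac cv Bv.
exact: diff_lincomb.
Qed.

Lemma derive_vderiv c v (J : 'I_s.+1 -> 'I_n) : atl c -> dom c (tpi v) -> B v ->
  'D_(0, evec (J ord_max))
    (in_chart (nat_chart atl c) (fun w Bw => tcomp c (T w Bw) (init_args J)))
    (cmap (nat_chart atl c) v) = vderiv c (frame atl c (tpi v) J).
Proof.
move=> ac cv Bv.
have dG : differentiable
    (in_chart (nat_chart atl c) (fun v Bv => tcomp c (T v Bv) (init_args J)) : E * E -> E)
    (cmap c (tpi v), tcoord c (tvect v)).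
  by apply: (sT (init_args J) ac 1).1; exists v.
rewrite deriveE //; have D := is_diff_slice dG.
have FE : fiber_expr T c (init_args (frame atl c (tpi v) J)) = (fun z : E => in_chart (nat_chart atl c)
      (fun v Bv => tcomp c (T v Bv) (init_args J)) (cmap c (tpi v), z)).
  by apply/funext => z; rewrite fiber_exprE.
by rewrite /vderiv FE (is_diff_val D) tcoord_tangent_of.
Qed.

(** The choice in [vdiff] is forced. The map S0 built from [vderiv] in c satisfies the specification
    in every chart by [vderiv_chart], and a multilinear map is determined by its components in one
    chart. *)
Lemma vdiff_spec c v (Bv : B v) : atl c -> dom c (tpi v) ->
  multilinear (vdiff T Bv) /\ forall u, tcoord c (vdiff T Bv u) = vderiv c u.
Proof.
move=> ac cv; rewrite /vdiff; set P := [set S | _].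
pose S0 : mtensor atl s.+1 (tpi v) := fun u => tangent_of atl c (tpi v) (vderiv c u).
have S0c u : tcoord c (S0 u) = vderiv c u by rewrite tcoord_tangent_of.
have mS0 : multilinear S0.
  move=> k u a x x'; apply: (tcoord_inj ac cv); rewrite tcoordD tcoordZ !S0c.
  exact: (vderiv_multilinear k u ac cv Bv).
have PS0 : P S0.
  split=> // c' J ac' c'v; apply: (etrans _ (esym (derive_vderiv J ac' c'v Bv))).
  by rewrite tcompE (tcoord_law _ ac ac' cv c'v) S0c (vderiv_chart _ ac ac' cv c'v).
suff -> : xget (fun=> 0) P = S0 by [].
apply: xget_subset1 PS0 _ => S1 S2 [m1 e1] [m2 e2].
by apply: (multilinear_ext Hatl ac cv m1 m2) => J; rewrite e1 // e2.
Qed.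

End Fixed.

End VerticalDerivative.

(** * Degrees of vertical derivatives and of contractions *)

Section HomogeneousTensors.
Context {R : realType} {M : Type} {n : nat}.
Local Notation E := 'rV[R]_n.
Implicit Types c : chart M E.
Variables (atl : set (chart M E)) (Hatl : smooth_atlas atl).
Hypothesis cover : forall p, exists2 c, atl c & dom c p.
Implicit Types B : set (TM atl).

Notation nat_image c B := (cmap (nat_chart atl c) @` (B `&` dom (nat_chart atl c))).

(** Differentiate F = k *: F (l^-1 *: _) at l *: y. With k = l ^ a this is the loss of one degree
    under vertical differentiation. *)
Lemma diff_homogeneous (V W : normedModType R) (F : V -> W) (l k : R) y w :
  0 < l -> differentiable F y -> (forall z, F (l *: z) = k *: F z) ->
  'd F (l *: y) w = (k / l) *: 'd F y w.
Proof.
move=> l0 dF FE; have ln : l != 0 by rewrite gt_eqF.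
have FG : F = k *: (F \o *:%R l^-1).
  by apply/funext => z; rewrite !fctE /= -FE scalerA divff // scale1r.
have yE : l^-1 *: (l *: y) = y by rewrite scalerA mulVf // scale1r.
have D1 := is_diff_scaler l^-1 (l *: y).
have D2 : is_diff (l^-1 *: (l *: y)) F ('d F y) by rewrite yE; exact: differentiableP.
have D := is_diffZ k (is_diff_comp D1 D2).
transitivity ('d (k *: (F \o *:%R l^-1)) (l *: y) w); first by rewrite -FG.
by rewrite (is_diff_val D) !fctE /= linearZ scalerA.
Qed.

Lemma smooth_in_eq (W : normedModType R) B c (f : forall v, B v -> W) (g : E * E -> W) :
  nat_open B -> atl c ->
  (forall v Bv, dom c (tpi v) -> f v Bv = g (cmap c (tpi v), tcoord c (tvect v))) ->
  (forall k, Ck k (nat_image c B) g) -> smooth_in (nat_chart atl c) f.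
Proof.
move=> oB ac fg sg k; apply: (eq_Ck (oB _ ac)) (sg k) => _ [v [Bv cv] <-].
by rewrite (in_chartE _ Bv) ?fg //; exact: nat_inj.
Qed.

(** No membership in B is asked of y, because [diff_homogeneous] wants the identity everywhere.
    Outside B both sides are 0: a conic set is also stable under l^-1, so that l *: y leaves B
    together with y. *)
Lemma fiber_expr_homogeneous a s B (T : tsec s B) c p J l (y : E) :
  conic B -> is_htensor a T -> atl c -> dom c p -> 0 < l ->
  fiber_expr T c (frame atl c p J) (l *: y) = l ^ a *: fiber_expr T c (frame atl c p J) y.
Proof.
move=> kB [_ hT _] ac cp l0; rewrite /fiber_expr tangent_ofZ //.
set v : TM atl := TM_of atl c p y.
have [Bv|nB] := pselect (B v).
  have Blv : B (hscale l v) := kB l v l0 Bv.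
  have -> : fiber_ext T (l *: tangent_of atl c p y) (frame atl c p J) =
            T (hscale l v) Blv (frame atl c p J) by exact: (fiber_extE T Blv).
  have -> : fiber_ext T (tangent_of atl c p y) (frame atl c p J) = T v Bv (frame atl c p J).
    exact: (fiber_extE T Bv).
  by have := hT l v Bv Blv c J l0 ac cp; rewrite !tcompE.
rewrite !fiber_ext_off ?tcoord0 ?scaler0 // => Blv; apply: nB.
suff -> : v = hscale l^-1 (existT _ p (l *: tangent_of atl c p y) : TM atl).
  by apply: kB => //; rewrite invr_gt0.
by rewrite /v /hscale /TM_of /= scalerA mulVf ?scale1r // gt_eqF.
Qed.

Lemma vdiff_htensor a s B (T : tsec s B) : nat_open B -> conic B ->
  is_htensor a T -> is_htensor (a - 1) (vdiff T).
Proof.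
move=> oB kB hT; have [mT homT sT] := hT.
have spec c v Bv := @vdiff_spec _ _ _ _ Hatl s B T mT sT c v Bv.
split=> [v Bv|l v Bv Blv c J l0 ac cv|c J ac].
- have [c ac cv] := cover (tpi v).
  by have [] := spec c v Bv ac cv.
- have E1 w (Bw : B w) : dom c (tpi w) ->
      tcomp c (vdiff T Bw) J = vderiv T c (frame atl c (tpi w) J) :> E.
    by move=> cw; apply: etrans (tcompE _ _ _) _; exact: (spec c w Bw ac cw).2.
  apply: (etrans (E1 _ Blv cv)); rewrite E1 //.
  have -> : l ^ (a - 1) = l ^ a / l by rewrite expfzDr ?gt_eqF.
  rewrite {1}/vderiv tcoord_hscale; apply: etrans (diff_homogeneous _ l0 _ _) _.
  + exact: (fiber_expr_diff Hatl mT sT (v := v) (init_args (frame atl c (tpi v) J)) ac cv Bv).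
  + by move=> z; exact: (fiber_expr_homogeneous _ z kB hT ac cv l0).
  + by [].
- move=> k; apply: (eq_Ck (oB _ ac)) ((sT c (init_args J) ac k.+1).2 (0, evec (J ord_max))).
  move=> _ [v [Bv cv] <-].
  rewrite (derive_vderiv Hatl sT J ac cv Bv) (in_chartE _ Bv) //; last exact: nat_inj.
  by rewrite tcompE (spec c v Bv ac cv).2.
Qed.

Lemma Ck_snd (U : set (E * E)) k : Ck k U (snd : E * E -> E).
Proof. by apply: Ck_linear => z; exact: cvg_snd. Qed.

Lemma Ck_fst (U : set (E * E)) k : Ck k U (fst : E * E -> E).
Proof. by apply: Ck_linear => z; exact: cvg_fst. Qed.

Definition ext_last s (S : Type) (u : 'I_s -> S) (x : S) : 'I_s.+1 -> S :=
  fun i => if unlift ord_max i is Some j then u j else x.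

Lemma icontract_comp s B (S : tsec s.+1 B) c v (Bv : B v) J :
  (forall v Bv, multilinear (S v Bv)) -> atl c -> dom c (tpi v) ->
  tcomp c (icontract S Bv) J =
  \sum_j tcoord c (tvect v) 0 j *: (tcomp c (S v Bv) (ext_last J j) : E) :> E.
Proof.
move=> mS ac cv; apply: etrans (tcompE _ _ _) _.
have -> : icontract S Bv (frame atl c (tpi v) J) =
    S v Bv (ext_last (frame atl c (tpi v) J) (tvect v)) by [].
rewrite (multilinear_expand Hatl _ ord_max (mS v Bv) ac cv) tcoord_sum.
apply: eq_bigr => j _; rewrite tcoordZ tcompE /ext_last unlift_none.
congr (_ *: tcoord _ (S v Bv _)); apply/funext => i; rewrite /set_arg /frame.
by case: unliftP => [k|] ->; rewrite ?eqxx // eq_sym (negbTE (neq_lift _ _)).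
Qed.

(** The degree rises by one because the contracted vector is v itself, which is scaled along with
    the point. *)
Lemma icontract_htensor a s B (S : tsec s.+1 B) : nat_open B ->
  is_htensor a S -> is_htensor (a + 1) (icontract S).
Proof.
move=> oB [mS hS sS]; split=> [v Bv k u|l v Bv Blv c J l0 ac cv|c J ac].
- have E1 x : icontract S Bv (fun i => if i == k then x else u i) =
      S v Bv (fun i => if i == lift ord_max k then x else ext_last u (tvect v) i).
    congr (S v Bv _); apply/funext => i; rewrite /ext_last.
    case: unliftP => [j|] ->; first by rewrite (inj_eq (@lift_inj _ _)).
    by rewrite (negbTE (neq_lift _ _)).
  move=> b x x'; rewrite !E1.
  exact: (mS v Bv (lift ord_max k) (ext_last u (tvect v))).
- apply: etrans (icontract_comp Blv J mS ac cv) _.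
  rewrite (icontract_comp Bv J mS ac cv) scaler_sumr; apply: eq_bigr => j _.
  rewrite tcoord_hscale (hS l v Bv Blv c _ l0 ac cv) mxE !scalerA; congr (_ *: _).
  by rewrite expfzDr ?gt_eqF // expr1z mulrC mulrA.
- apply: (@smooth_in_eq _ B c _ (fun z => \sum_j z.2 0 j *:
    in_chart (nat_chart atl c) (fun v Bv => tcomp c (S v Bv) (ext_last J j)) z)) => //.
    move=> v Bv cv; apply: etrans (icontract_comp Bv J mS ac cv) _.
    apply: eq_bigr => j _; congr (_ *: _).
    by rewrite (in_chartE (c := nat_chart atl c) (p := v) _ Bv) //; exact: nat_inj.
  move=> k; apply: Ck_sum (oB _ ac) _ => j; apply: Ck_scale (oB _ ac) _ _.
    by apply: Ck_coord (oB _ ac) _; exact: Ck_snd.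
  exact: sS.
Qed.

End HomogeneousTensors.

(** * Coordinate connections of two charts *)

Section ChartConnections.
Context {R : realType} {M : Type} {n : nat}.
Local Notation E := 'rV[R]_n.
Implicit Types c : chart M E.
Variables (atl : set (chart M E)) (Hatl : smooth_atlas atl).
Implicit Types B : set (TM atl).
Notation overlap c c' := (cmap c @` (dom c' `&` dom c)).

(* This is Q of the introduction, at p and in the coordinates of c. *)
Definition defect c' c p (a b : E) : E := d2trans c' c p (dtrans c c' p a) (dtrans c c' p b).

Lemma defect_sym c' c p a b : atl c -> atl c' -> dom c p -> dom c' p ->
  defect c' c p a b = defect c' c p b a.
Proof. by move=> *; exact: (d2trans_sym Hatl). Qed.

Lemma defectDl c' c p a a' b : atl c -> atl c' -> dom c p -> dom c' p ->
  defect c' c p (a + a') b = defect c' c p a b + defect c' c p a' b.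
Proof. by move=> *; rewrite /defect dtransD; exact: (d2transDl Hatl). Qed.

Lemma defectZl c' c p k a b : atl c -> atl c' -> dom c p -> dom c' p ->
  defect c' c p (k *: a) b = k *: defect c' c p a b.
Proof. by move=> *; rewrite /defect dtransZ; exact: (d2transZl Hatl). Qed.

Lemma defect_linearl c' c p b : atl c -> atl c' -> dom c p -> dom c' p ->
  linear (fun a => defect c' c p a b).
Proof. by move=> ac ac' cp c'p k a a'; rewrite defectDl // defectZl. Qed.

Lemma defect_linearr c' c p a : atl c -> atl c' -> dom c p -> dom c' p -> linear (defect c' c p a).
Proof.
move=> ac ac' cp c'p k b b'.
by rewrite (defect_sym a) // (defect_sym a b) // (defect_sym a b') // defect_linearl.
Qed.

Lemma defect_suml c' c p a b : atl c -> atl c' -> dom c p -> dom c' p ->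
  defect c' c p a b = \sum_j a 0 j *: defect c' c p (evec j) b.
Proof.
move=> ac ac' cp c'p; rewrite {1}[a]row_sum_delta.
exact: (linear_lsum _ _ _ (defect_linearl b ac ac' cp c'p)).
Qed.

Lemma defect_sumr c' c p a b : atl c -> atl c' -> dom c p -> dom c' p ->
  defect c' c p a b = \sum_k b 0 k *: defect c' c p a (evec k).
Proof.
move=> ac ac' cp c'p; rewrite {1}[b]row_sum_delta.
exact: (linear_lsum _ _ _ (defect_linearr a ac ac' cp c'p)).
Qed.

(** The second-order chain rule for the round trip from c to c' and back, whose second differential
    is 0. In this form the second derivative is taken in the coordinates of c and in the directions
    a and b themselves. *)
Lemma defectE c' c p a b : atl c -> atl c' -> dom c p -> dom c' p ->
  defect c' c p a b = - dtrans c' c p (d2trans c c' p a b).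
Proof.
move=> ac ac' cp c'p; apply/eqP; rewrite -addr_eq0; apply/eqP.
by rewrite -(d2trans_comp Hatl a b ac ac' ac cp c'p cp) (d2trans_id Hatl).
Qed.

Lemma defect_smooth c' c j k : atl c -> atl c' ->
  exists2 H : E -> E, (forall m, Ck m (overlap c c') H) &
    forall p, dom c p -> dom c' p -> defect c' c p (evec j) (evec k) = H (cmap c p).
Proof.
move=> ac ac'; pose psi := transition c c'; pose phi := transition c' c.
(* This is [defectE] with the coordinates in c' written as psi x and the argument of the outer
   differential expanded on the basis. *)
exists (fun x => - \sum_a ('D_(evec j) (fun x => 'D_(evec k) psi x) x) 0 a *:
    'D_(delta_mx 0 a) phi (psi x)).
  move=> m; have oU := overlap_open Hatl ac ac'.
  apply: CkN => //; apply: Ck_sum => // a; apply: Ck_scale => //.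
    apply: Ck_coord => //.
    exact: ((transition_Ck Hatl m.+2 ac ac').2 (evec k)).2.
  apply: (@Ck_comp _ _ _ _ _ (overlap c' c) psi (fun y => 'D_(delta_mx 0 a) phi y)) => //.
  - move=> _ [p [c'p cp] <-]; rewrite /psi (transitionE Hatl.1 ac cp c'p).
    by exists p.
  - exact: (transition_Ck Hatl m ac ac').
  - exact: (transition_Ck Hatl m.+1 ac' ac).2.
move=> p cp c'p; rewrite (defectE _ _ ac ac' cp c'p) (dtrans_rV Hatl _ ac' ac c'p cp) d2trans.unlock.
by rewrite /psi (transitionE Hatl.1 ac cp c'p).
Qed.

Lemma chart_spray_coord B c' c v (Bv : B v) : atl c -> atl c' ->
  dom c (tpi v) -> dom c' (tpi v) ->
  hcoord c (chart_spray c' v Bv) = tcoord c (tvect v) /\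
  vcoord c (chart_spray c' v Bv) = defect c' c (tpi v) (tcoord c (tvect v)) (tcoord c (tvect v)).
Proof.
move=> ac ac' cv c'v.
have -> : chart_spray c' v Bv = TTM_of c' v (tcoord c' (tvect v)) 0 by [].
rewrite (hcoord_law Hatl _ ac' ac c'v cv) (vcoord_law Hatl _ ac' ac c'v cv) hcoord_TTM_of // vcoord_TTM_of //.
rewrite -(tcoord_law (tvect v) ac' ac c'v cv) dtrans0 addr0; split=> //.
by rewrite /defect -(tcoord_law (tvect v) ac ac' cv c'v).
Qed.

Lemma chart_nl_coord B c' c v (Bv : B v) u : atl c -> atl c' ->
  dom c (tpi v) -> dom c' (tpi v) ->
  hcoord c (chart_nl c' v Bv u) = tcoord c u /\
  vcoord c (chart_nl c' v Bv u) = defect c' c (tpi v) (tcoord c u) (tcoord c (tvect v)).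
Proof.
move=> ac ac' cv c'v.
have -> : chart_nl c' v Bv u = TTM_of c' v (tcoord c' u) 0 by [].
rewrite (hcoord_law Hatl _ ac' ac c'v cv) (vcoord_law Hatl _ ac' ac c'v cv) hcoord_TTM_of // vcoord_TTM_of //.
rewrite -(tcoord_law u ac' ac c'v cv) dtrans0 addr0; split=> //.
by rewrite /defect -(tcoord_law (tvect v) ac ac' cv c'v) -(tcoord_law u ac ac' cv c'v).
Qed.

(** Symbols become a bilinear map, so that the index sums of the transformation law turn into
    compositions of maps. *)
Definition christoffel_form (g : 'I_n -> 'I_n -> 'I_n -> R) (a b : E) : E :=
  \row_i \sum_j \sum_k a 0 j * b 0 k * g i j k.

Lemma christoffel_form_linearl g b : linear (christoffel_form g ^~ b).
Proof.
move=> l a a'; apply/rowP => i; rewrite !mxE mulr_sumr -big_split; apply: eq_bigr => j _.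
rewrite mulr_sumr -big_split; apply: eq_bigr => k _ /=.
by rewrite !mxE mulrDl mulrDl !mulrA.
Qed.

Lemma christoffel_form_linearr g a : linear (christoffel_form g a).
Proof.
move=> l b b'; apply/rowP => i; rewrite !mxE mulr_sumr -big_split; apply: eq_bigr => j _.
rewrite mulr_sumr -big_split; apply: eq_bigr => k _ /=.
by rewrite !mxE; ring.
Qed.

Lemma bilinear_expand (f : E -> E -> E) a b :
  (forall b, linear (f ^~ b)) -> (forall a, linear (f a)) ->
  f a b = christoffel_form (fun i j k => f (evec j) (evec k) 0 i) a b.
Proof.
move=> fl fr; rewrite {1}[a]row_sum_delta (linear_lsum _ _ _ (fl b)).
rewrite {1}[b]row_sum_delta; apply/rowP => i; rewrite summxE !mxE; apply: eq_bigr => j _.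
rewrite mxE (linear_lsum _ _ _ (fr _)) summxE mulr_sumr; apply: eq_bigr => k _.
by rewrite mxE mulrA.
Qed.

(** The index manipulations of the classical law are confined to this proof: the inhomogeneous term
    is the defect of c seen in c', and the remaining sum is the bilinear map of g conjugated by the
    transition. *)
Lemma CM_lawE c c' p i j k (g : 'I_n -> 'I_n -> 'I_n -> R) :
  atl c -> atl c' -> dom c p -> dom c' p ->
  - (\sum_b \sum_d hess c c' p i b d * jac c' c p b j * jac c' c p d k) +
     \sum_a \sum_b \sum_d
        jac c c' p i a * jac c' c p b j * jac c' c p d k * g a b d =
  (- defect c c' p (evec j) (evec k) +
   dtrans c c' p (christoffel_form g (dtrans c' c p (evec j)) (dtrans c' c p (evec k)))) 0 i.
Proof.
move=> ac ac' cp c'p.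
have jacE e e' (x y : 'I_n) : atl e -> atl e' -> dom e p -> dom e' p ->
    jac e e' p x y = dtrans e e' p (evec y) 0 x.
  by move=> ae ae' ep e'p; rewrite (dtransE Hatl).
have hessE x y z : hess c c' p x y z = d2trans c c' p (evec y) (evec z) 0 x.
  by rewrite d2trans.unlock.
have addE (A A' : E) : (- A + A') 0 i = - A 0 i + A' 0 i by rewrite !mxE.
rewrite addE; congr (- _ + _).
  rewrite /defect (bilinear_expand (f := d2trans c c' p)); last 2 first.
  - by move=> b l a a'; rewrite (d2transDl Hatl) // (d2transZl Hatl).
  - by move=> a l b b'; rewrite (d2transDr Hatl) // (d2transZr Hatl).
  rewrite mxE; apply: eq_bigr => b _; apply: eq_bigr => d _.
  by rewrite hessE !jacE //; ring.
rewrite (dtrans_rV Hatl _ ac ac' cp c'p) summxE; apply: eq_bigr => a _.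
rewrite !mxE big_distrl /=; apply: eq_bigr => b _; rewrite big_distrl; apply: eq_bigr => d _.
by rewrite !(jacE c' c) // /jac; rewrite /evec /=; ring.
Qed.

End ChartConnections.

(** * Christoffel symbols of a chart and smoothness of the defect *)

Section LocalExpressions.
Context {R : realType} {M : Type} {n : nat}.
Local Notation E := 'rV[R]_n.
Implicit Types c : chart M E.
Variables (atl : set (chart M E)) (Hatl : smooth_atlas atl).
Implicit Types B : set (TM atl).
Notation nat_image c B := (cmap (nat_chart atl c) @` (B `&` dom (nat_chart atl c))).
Notation overlap c c' := (cmap c @` (dom c' `&` dom c)).

Lemma CM_law c c' p (G : christoffel) i j k : is_CM atl p G ->
  atl c -> atl c' -> dom c p -> dom c' p ->
  G c' i j k = (- defect c c' p (evec j) (evec k) +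
    dtrans c c' p (christoffel_form (G c) (dtrans c' c p (evec j)) (dtrans c' c p (evec k)))) 0 i.
Proof.
by move=> [GL _] ac ac' cp c'p; rewrite -(CM_lawE Hatl) //; exact: GL.
Qed.

Lemma christoffel_form0 (g : 'I_n -> 'I_n -> 'I_n -> R) a b : (forall i j k, g i j k = 0) ->
  christoffel_form g a b = 0.
Proof.
move=> g0; apply/rowP => i; rewrite !mxE big1 // => j _; rewrite big1 // => k _.
by rewrite g0 mulr0.
Qed.

(** The second-order chain rule with arguments pulled back from c2. It amounts to the Christoffel
    law for the family of symbols [- defect c _]. *)
Lemma defect_cocycle c c1 c2 p a b : atl c -> atl c1 -> atl c2 ->
  dom c p -> dom c1 p -> dom c2 p ->
  defect c c2 p a b = defect c1 c2 p a b + dtrans c1 c2 p (defect c c1 p (dtrans c2 c1 p a) (dtrans c2 c1 p b)).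
Proof.
move=> ac a1 a2 cp c1p c2p; rewrite /defect -!(dtrans_comp Hatl _ a2 a1 ac c2p c1p cp).
rewrite (d2trans_comp Hatl _ _ ac a1 a2 cp c1p c2p).
by rewrite -!(dtrans_comp Hatl _ a2 ac a1 c2p cp c1p).
Qed.

Lemma chart_anis_exists c p : atl c -> dom c p ->
  exists G : christoffel, is_CM atl p G /\ forall i j k, G c i j k = 0.
Proof.
move=> ac cp.
(* These are the symbols that the law forces on the other charts once those of c vanish; [is_CM]
   wants 0 off the charts around p. *)
pose G : @christoffel R M n := fun c' i j k => if pselect (atl c' /\ dom c' p)
  then - defect c c' p (evec j) (evec k) 0 i else 0.
have GE c' : atl c' -> dom c' p -> forall i j k, G c' i j k = - defect c c' p (evec j) (evec k) 0 i.
  by rewrite /G; case: pselect => // nc a d; case: nc.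
have Goff c' i j k : ~ (atl c' /\ dom c' p) -> G c' i j k = 0.
  by rewrite /G; case: pselect.
have Gc i j k : G c i j k = 0 by rewrite GE // /defect (d2trans_id Hatl) // mxE oppr0.
exists G; split=> //; split=> [c1 c2 a1 a2 c1p c2p i j k|c' i j k]; last exact: Goff.
apply: (etrans _ (esym (CM_lawE Hatl i j k (G c1) a1 a2 c1p c2p))); rewrite GE //.
have -> : christoffel_form (G c1) (dtrans c2 c1 p (evec j)) (dtrans c2 c1 p (evec k)) =
    - defect c c1 p (dtrans c2 c1 p (evec j)) (dtrans c2 c1 p (evec k)).
  rewrite (bilinear_expand (f := fun a b => - defect c c1 p a b)).
  - by congr christoffel_form; apply/funext => x; apply/funext => y; apply/funext => z; rewrite GE // mxE.
  - by move=> b l a a'; rewrite (defect_linearl Hatl b a1 ac c1p cp) opprD scalerN.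
  - by move=> a l b b'; rewrite (defect_linearr Hatl a a1 ac c1p cp) opprD scalerN.
rewrite dtransN -opprD [RHS]mxE; congr (- (_ : E) 0 i).
exact: defect_cocycle.
Qed.

Lemma chart_anis_spec B c v (Bv : B v) : atl c -> dom c (tpi v) ->
  is_CM atl (tpi v) (chart_anis c v Bv) /\ forall i j k, chart_anis c v Bv c i j k = 0.
Proof.
move=> ac cv; have [G HG] := chart_anis_exists ac cv.
rewrite /chart_anis.
exact: (@xgetI _ (fun _ _ _ _ => 0) [set G : christoffel | is_CM atl (tpi v) G /\
  forall i j k, G c i j k = 0] G HG).
Qed.

Lemma chart_anisE B c c' v (Bv : B v) i j k : atl c -> atl c' ->
  dom c (tpi v) -> dom c' (tpi v) ->
  chart_anis c v Bv c' i j k = (- defect c c' (tpi v) (evec j) (evec k)) 0 i.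
Proof.
move=> ac ac' cv c'v; have [CM C0] := chart_anis_spec Bv ac cv.
by rewrite (CM_law i j k CM ac ac' cv c'v) christoffel_form0 // dtrans0 addr0.
Qed.

Lemma chart_anis_off B c c' v (Bv : B v) i j k : atl c -> dom c (tpi v) ->
  ~ (atl c' /\ dom c' (tpi v)) -> chart_anis c v Bv c' i j k = 0.
Proof. by move=> ac cv nc; have [[_ ->]] := chart_anis_spec Bv ac cv. Qed.

Lemma Ck_linear_comp (V W X : normedModType R) (U : set V) (L : {linear W -> X})
    (f : V -> W) k : open U -> continuous L -> Ck k U f -> Ck k U (L \o f).
Proof.
move=> oU cL; elim: k f => [|k IH] f cf.
  by move=> x Ux; apply: continuous_comp; [exact: cf | exact: cL].
have dL y : differentiable L y by exact: linear_differentiable.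
case: cf => df cf; split=> [x Ux|v]; first exact: differentiable_comp (df x Ux) (dL _).
apply: (@eq_Ck _ _ _ _ (L \o (fun x => 'D_v f x))) => // [x Ux|]; last exact: IH (cf v).
have dx := df x Ux; rewrite [RHS]deriveE; last exact: differentiable_comp.
by rewrite (diff_comp dx (dL _)) /= diff_lin // deriveE.
Qed.

Lemma Ck_snd_comp (V W X : normedModType R) (U : set V) (f : V -> W * X) k :
  open U -> Ck k U f -> Ck k U (fun z => (f z).2).
Proof.
move=> oU; apply: (@Ck_linear_comp _ _ _ _ (@snd W X)) => // z; exact: cvg_snd.
Qed.

Lemma nat_image_overlap B c c' : B `<=` TM_over (dom c') ->
  forall z, nat_image c B z -> overlap c c' z.1.
Proof. by move=> BC _ [v [Bv cv] <-]; exists (tpi v) => //; split=> //; exact: BC. Qed.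

Lemma defect_smooth_nat B c' c j k : atl c -> atl c' -> nat_open B -> B `<=` TM_over (dom c') ->
  exists2 H : E * E -> E, (forall m, Ck m (nat_image c B) H) &
    forall v, B v -> dom c (tpi v) ->
    defect c' c (tpi v) (evec j) (evec k) = H (cmap c (tpi v), tcoord c (tvect v)).
Proof.
move=> ac ac' oB BC; have [H sH HE] := defect_smooth Hatl j k ac ac'.
exists (H \o fst) => [m|v Bv cv]; last by rewrite HE //; exact: BC.
apply: (Ck_comp (oB _ ac) (nat_image_overlap BC) (Ck_fst _ _) (sH m)).
Qed.

Lemma defect_smooth_nl B c' c j : atl c -> atl c' -> nat_open B -> B `<=` TM_over (dom c') ->
  exists2 H : E * E -> E, (forall m, Ck m (nat_image c B) H) &
    forall v, B v -> dom c (tpi v) ->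
    defect c' c (tpi v) (evec j) (tcoord c (tvect v)) = H (cmap c (tpi v), tcoord c (tvect v)).
Proof.
move=> ac ac' oB BC.
have /choice[H HH] : forall k, exists H : E * E -> E, (forall m, Ck m (nat_image c B) H) /\
    forall v, B v -> dom c (tpi v) ->
    defect c' c (tpi v) (evec j) (evec k) = H (cmap c (tpi v), tcoord c (tvect v)).
  by move=> k; have [H] := defect_smooth_nat j k ac ac' oB BC; exists H.
(* The slot filled by y is expanded on the basis, which leaves smooth functions of x multiplied by
   coordinates of y. *)
exists (fun z : E * E => \sum_k z.2 0 k *: H k z) => [m|v Bv cv].
  apply: Ck_sum (oB _ ac) _ => k; apply: Ck_scale (oB _ ac) _ _; last exact: (HH k).1.
  by apply: Ck_coord (oB _ ac) _; exact: Ck_snd.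
rewrite (defect_sumr Hatl (c' := c') _ _ ac ac' cv (BC v Bv)); apply: eq_bigr => k _ /=.
by rewrite (HH k).2.
Qed.

Lemma defect_smooth_spray B c' c : atl c -> atl c' -> nat_open B -> B `<=` TM_over (dom c') ->
  exists2 H : E * E -> E, (forall m, Ck m (nat_image c B) H) &
    forall v, B v -> dom c (tpi v) ->
    defect c' c (tpi v) (tcoord c (tvect v)) (tcoord c (tvect v)) = H (cmap c (tpi v), tcoord c (tvect v)).
Proof.
move=> ac ac' oB BC.
have /choice[H HH] : forall j, exists H : E * E -> E, (forall m, Ck m (nat_image c B) H) /\
    forall v, B v -> dom c (tpi v) ->
    defect c' c (tpi v) (evec j) (tcoord c (tvect v)) = H (cmap c (tpi v), tcoord c (tvect v)).
  by move=> j; have [H] := defect_smooth_nl j ac ac' oB BC; exists H.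
exists (fun z : E * E => \sum_k z.2 0 k *: H k z) => [m|v Bv cv].
  apply: Ck_sum (oB _ ac) _ => k; apply: Ck_scale (oB _ ac) _ _; last exact: (HH k).1.
  by apply: Ck_coord (oB _ ac) _; exact: Ck_snd.
rewrite (defect_suml Hatl (c' := c') _ _ ac ac' cv (BC v Bv)); apply: eq_bigr => k _ /=.
by rewrite (HH k).2.
Qed.

End LocalExpressions.

(** * Expressing a connection relative to a chart *)

Section Decomposition.
Context {R : realType} {M : Type} {n : nat}.
Local Notation E := 'rV[R]_n.
Implicit Types c : chart M E.
Variables (atl : set (chart M E)) (Hatl : smooth_atlas atl).
Implicit Types B : set (TM atl).
Notation nat_image c B := (cmap (nat_chart atl c) @` (B `&` dom (nat_chart atl c))).

Lemma defect_id c p a b : atl c -> dom c p -> defect c c p a b = 0.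
Proof. by move=> ac cp; rewrite /defect (d2trans_id Hatl). Qed.

Lemma spray_sub_coord B (Z : tsec 0 B) c' c v (Bv : B v) : atl c -> atl c' ->
  dom c (tpi v) -> dom c' (tpi v) ->
  hcoord c (spray_sub (chart_spray c') Z Bv) = tcoord c (tvect v) /\
  vcoord c (spray_sub (chart_spray c') Z Bv) =
    defect c' c (tpi v) (tcoord c (tvect v)) (tcoord c (tvect v)) - tcoord c (Z v Bv (fun=> 0)).
Proof.
move=> ac ac' cv c'v; rewrite /spray_sub hcoordB vcoordB.
have [-> ->] := chart_spray_coord Hatl Bv ac ac' cv c'v.
by have [-> ->] := vlift_coord Hatl (Z v Bv (fun=> 0)) ac cv; rewrite subr0.
Qed.

Lemma nl_sub_coord B (J : tsec 1 B) c' c v (Bv : B v) u : atl c -> atl c' ->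
  dom c (tpi v) -> dom c' (tpi v) ->
  hcoord c (nl_sub (chart_nl c') J Bv u) = tcoord c u /\
  vcoord c (nl_sub (chart_nl c') J Bv u) =
    defect c' c (tpi v) (tcoord c u) (tcoord c (tvect v)) - tcoord c (J v Bv (fun=> u)).
Proof.
move=> ac ac' cv c'v; rewrite /nl_sub hcoordB vcoordB.
have [-> ->] := chart_nl_coord Hatl Bv u ac ac' cv c'v.
by have [-> ->] := vlift_coord Hatl (J v Bv (fun=> u)) ac cv; rewrite subr0.
Qed.

(** Written as the index function inside [anis_add], so that the two are convertible. *)
Definition pair_idx (S : Type) (j k : S) : 'I_2 -> S := fun l => if l == ord0 then j else k.

Lemma anis_add_coord B (P : tsec 2 B) c' c v (Bv : B v) i j k : atl c -> atl c' ->
  dom c (tpi v) -> dom c' (tpi v) ->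
  anis_add (chart_anis c') P Bv c i j k =
  (- defect c' c (tpi v) (evec j) (evec k) +
   tcoord c (P v Bv (frame atl c (tpi v) (pair_idx j k)))) 0 i.
Proof.
move=> ac ac' cv c'v; rewrite /anis_add (chart_anisE Hatl Bv i j k ac' ac c'v cv).
by rewrite -tcompE [RHS]mxE.
Qed.

Lemma anis_add_off B (P : tsec 2 B) c' c v (Bv : B v) i j k : atl c' -> dom c' (tpi v) ->
  ~ (atl c /\ dom c (tpi v)) -> anis_add (chart_anis c') P Bv c i j k = 0.
Proof.
move=> ac' c'v nc; rewrite /anis_add (chart_anis_off Hatl Bv i j k ac' c'v nc) add0r.
by rewrite tcompE tcoord_off // mxE.
Qed.

Section Existence.
Variables (B : set (TM atl)) (c : chart M E).
Hypotheses (ac : atl c) (oB : nat_open B) (BC : B `<=` TM_over (dom c)).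

Lemma tensor_homogeneous a s (T : tsec s B) :
  (forall l v (Bv : B v) (Blv : B (hscale l v)) u, 0 < l ->
     T (hscale l v) Blv u = l ^ a *: T v Bv u) ->
  forall l v (Bv : B v) (Blv : B (hscale l v)) c' J, 0 < l ->
    atl c' -> dom c' (tpi v) ->
    tcomp c' (T (hscale l v) Blv) J = l ^ a *: tcomp c' (T v Bv) J.
Proof.
move=> HT l v Bv Blv c' J l0 ac' c'v.
apply: (etrans (tcompE c' (T (hscale l v) Blv) J)).
rewrite tcompE -tcoordZ; congr (tcoord c' _); exact: HT.
Qed.

Lemma spray_decomposition (G : spray_sec B) : is_spray G ->
  exists2 Z : tsec 0 B, is_htensor 2 Z &
    G = spray_sub (chart_spray c) (tscale 2 Z).
Proof.
move=> [G1 G2 G3].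
(* In c the chart spray has no vertical part, so the vertical part of G must be - 2 Z. *)
pose Z : tsec 0 B := fun v Bv u => tangent_of atl c (tpi v) (- 2^-1 *: vcoord c (G v Bv)).
have GE : G = spray_sub (chart_spray c) (tscale 2 Z).
  apply: functional_extensionality_dep => v; apply/funext => Bv.
  have cv : dom c (tpi v) := BC Bv.
  have [xE yE] := spray_sub_coord (tscale 2 Z) Bv ac ac cv cv.
  apply: (hvcoord_inj ac cv); first by rewrite xE -(tcoord_dmap_tpi Hatl) // G1.
  rewrite yE (defect_id _ _ ac cv) sub0r tcoordZ tcoord_tangent_of // scalerA -scaleNr.
  by rewrite mulrN opprK divff ?scale1r // pnatr_eq0.
exists Z => //; split=> [v Bv []//||c' J ac'].
  apply: tensor_homogeneous => l v Bv Blv u l0.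
  have cv : dom c (tpi v) := BC Bv.
  (* One factor l comes from the homogeneity condition on sprays, the other from the differential of
     [hscale]. *)
  rewrite /Z (G2 l v Bv Blv l0) vcoordZ (dmap_hscale_coord Hatl _ _ ac cv).2 -tangent_ofZ //.
  congr (tangent_of _ _ _ _); rewrite !scalerA; congr (_ *: _).
  by rewrite exprSz; ring.
(* In an arbitrary chart c', 2 Z is the defect of c at (y, y) minus the vertical part of G, and both
   are smooth there. *)
have [H sH HE] := defect_smooth_spray Hatl ac' ac oB BC.
apply: (@smooth_in_eq _ _ _ _ Hatl _ B c' _ (fun z => 2^-1 *: (H z -
   (in_chart (nat_chart atl c') (fun v Bv => vcomp (G v Bv) (nat_chart atl c')) z).2))) => //.
  move=> v Bv c'v; have cv : dom c (tpi v) := BC Bv.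
  have [_ yE] := spray_sub_coord (tscale 2 Z) Bv ac' ac c'v cv.
  rewrite -GE in yE.
  rewrite (in_chartE (c := nat_chart atl c') (p := v) _ Bv) //; last exact: nat_inj.
  rewrite -/(vcoord c' (G v Bv)) yE -HE // opprB addrC subrK tcoordZ scalerA.
  by rewrite mulVf ?scale1r ?pnatr_eq0 // tcompE.
move=> k; apply: CkZ (oB ac') _; apply: CkD (oB ac') (sH k) _; apply: CkN (oB ac') _.
exact: Ck_snd_comp (oB ac') (G3 _ ac' k).
Qed.

Lemma nl_decomposition (N : nl_sec B) : is_nl N ->
  exists2 J : tsec 1 B, is_htensor 1 J & N = nl_sub (chart_nl c) J.
Proof.
move=> [N0 N1 N2 N3].
pose J : tsec 1 B := fun v Bv u => tangent_of atl c (tpi v) (- vcoord c (N v Bv (u ord0))).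
have NE : N = nl_sub (chart_nl c) J.
  apply: functional_extensionality_dep => v; apply/funext => Bv; apply/funext => u.
  have cv : dom c (tpi v) := BC Bv.
  have [xE yE] := nl_sub_coord J Bv u ac ac cv cv.
  apply: (hvcoord_inj ac cv); first by rewrite xE -(tcoord_dmap_tpi Hatl) // N1.
  by rewrite yE (defect_id _ _ ac cv) sub0r tcoord_tangent_of // opprK.
exists J => //; split=> [v Bv k u||c' L ac'].
- have cv : dom c (tpi v) := BC Bv.
  move=> a x x'; apply: (tcoord_inj ac cv); rewrite tcoordD tcoordZ !tcoord_tangent_of //.
  by rewrite (ord1 k) /= N0 vcoordD vcoordZ opprD scalerN.
- apply: tensor_homogeneous => l v Bv Blv u l0.
  have cv : dom c (tpi v) := BC Bv.
  rewrite /J (N2 l v Bv Blv _ l0) (dmap_hscale_coord Hatl _ _ ac cv).2 -tangent_ofZ //.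
  by rewrite scalerN.
have [H sH HE] := defect_smooth_nl Hatl (L ord0) ac' ac oB BC.
apply: (@smooth_in_eq _ _ _ _ Hatl _ B c' _ (fun z => H z -
   (in_chart (nat_chart atl c') (fun v Bv =>
     vcomp (N v Bv (tvec atl (tpi v) c' (evec (L ord0)))) (nat_chart atl c')) z).2)) => //.
  move=> v Bv c'v; have cv : dom c (tpi v) := BC Bv.
  pose e := tvec atl (tpi v) c' (evec (L ord0)).
  have eE : e = tangent_of atl c' (tpi v) (evec (L ord0)) by rewrite tangent_of.unlock.
  have [_ yE] := nl_sub_coord J Bv e ac' ac c'v cv.
  rewrite -NE in yE.
  rewrite (in_chartE (c := nat_chart atl c') (p := v) _ Bv) //; last exact: nat_inj.
  rewrite -/e -/(vcoord c' (N v Bv e)) yE eE tcoord_tangent_of // -HE // opprB addrC subrK.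
  rewrite tcompE; congr (tcoord _ (J v Bv _)).
  by apply/funext => i; rewrite /frame (ord1 i).
move=> k; apply: CkD (oB ac') (sH k) _; apply: CkN (oB ac') _.
exact: Ck_snd_comp (oB ac') (N3 _ _ ac' k).
Qed.

Lemma pair_idxE (S : Type) (J : 'I_2 -> S) : J = pair_idx (J ord0) (J ord_max).
Proof.
apply/funext => i; rewrite /pair_idx; case: eqP => [->//|/eqP i0].
by congr J; apply: val_inj; case: i i0 => [[|[|]]].
Qed.

Lemma anis_decomposition (G : anis_sec B) : is_anis G ->
  exists2 P : tsec 2 B, is_htensor 0 P & G = anis_add (chart_anis c) P.
Proof.
move=> [G1 G2 G3].
(* The chart connection has zero symbols in c, so the components of P in c must be the symbols of
   G. *)
pose P : tsec 2 B := fun v Bv u =>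
  tangent_of atl c (tpi v) (christoffel_form (G v Bv c) (tcoord c (u ord0)) (tcoord c (u ord_max))).
have GE : G = anis_add (chart_anis c) P.
  apply: functional_extensionality_dep => v; apply/funext => Bv; apply/funext => c'.
  have cv : dom c (tpi v) := BC Bv.
  apply/funext => i; apply/funext => j; apply/funext => k.
  have [[ac' c'v]|nc] := pselect (atl c' /\ dom c' (tpi v)); last first.
    by rewrite (anis_add_off _ _ _ _ _ ac cv nc) (G1 v Bv).2.
  rewrite (anis_add_coord P Bv i j k ac' ac c'v cv).
  rewrite (CM_law Hatl i j k (G1 v Bv) ac ac' cv c'v); congr ((_ + _ : E) 0 i).
  by rewrite /P tcoord_tangent_ofE // /frame /= !tcoord_tangent_ofE.
exists P => //; split=> [v Bv k u||c' J ac'].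
- have cv : dom c (tpi v) := BC Bv.
  move=> a x x'; apply: (tcoord_inj ac cv); rewrite tcoordD tcoordZ !tcoord_tangent_of //.
  have m0 : (ord_max == ord0 :> 'I_2) = false by [].
  have [->|->] : k = ord0 \/ k = ord_max.
    by case: k => [[|[|k]] // H]; [left | right]; apply: val_inj.
    by rewrite eqxx m0 tcoordD tcoordZ christoffel_form_linearl.
  by rewrite eqxx eq_sym m0 tcoordD tcoordZ christoffel_form_linearr.
- apply: tensor_homogeneous => l v Bv Blv u l0.
  by rewrite /P (G2 l v Bv Blv l0) expr0z scale1r.
have [H sH HE] := defect_smooth_nat Hatl (J ord0) (J ord_max) ac' ac oB BC.
(* Smoothness of G is known entry by entry; the row of its symbols is reassembled on the basis. *)
apply: (@smooth_in_eq _ _ _ _ Hatl _ B c' _ (fun z => H z + \sum_i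
   (in_chart (nat_chart atl c') (fun v Bv => G v Bv c' i (J ord0) (J ord_max) : R^o) z) *:
   (delta_mx 0 i : E))) => //.
  move=> v Bv c'v; have cv : dom c (tpi v) := BC Bv.
  rewrite tcompE -HE // (pair_idxE J).
  set q := defect _ _ _ _ _; set e := tcoord c' _.
  have HG i : in_chart (nat_chart atl c')
      (fun v Bv => G v Bv c' i (J ord0) (J ord_max) : R^o) (cmap (nat_chart atl c') v) =
      (- q + e) 0 i.
    rewrite (in_chartE _ Bv) //; last exact: nat_inj.
    by have := anis_add_coord P Bv i (J ord0) (J ord_max) ac' ac c'v cv; rewrite -GE.
  transitivity (q + (- q + e)); first by rewrite addrA subrr add0r.
  rewrite [in LHS](row_sum_delta (- q + e)); congr (_ + _).
  by apply: eq_bigr => i _; rewrite -HG.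
move=> k; apply: CkD (oB ac') (sH k) _; apply: Ck_sum (oB ac') _ => i.
apply: Ck_scale (oB ac') _ (Ck_cst _ _ _).
exact: (G3 c' i _ _ ac' k).
Qed.

End Existence.

End Decomposition.

(** * Agreement of the local formulas in two charts *)

Section ChangeOfChart.
Context {R : realType} {M : Type} {n : nat}.
Local Notation E := 'rV[R]_n.
Implicit Types c d : chart M E.
Variables (atl : set (chart M E)) (Hatl : smooth_atlas atl).
Implicit Types B : set (TM atl).
Notation nat_image c B := (cmap (nat_chart atl c) @` (B `&` dom (nat_chart atl c))).

(** Expanding only the second argument writes f z z as a sum of products of a coordinate with a
    linear map, each covered by the Leibniz rule. *)
Lemma is_diff_bilinear_diag (f : E -> E -> E) y :
  (forall b, linear (f ^~ b)) -> (forall a, linear (f a)) ->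
  is_diff y (fun z => f z z) (fun a => f a y + f y a).
Proof.
move=> fl fr; pose F k (z : E) := z 0 k *: f z (evec k).
have fE a b : f a b = \sum_k b 0 k *: f a (evec k).
  by rewrite {1}[b]row_sum_delta; exact: (linear_lsum _ _ _ (fr a)).
have dF k : is_diff y (F k) (fun a => y 0 k *: f a (evec k) + a 0 k *: f y (evec k)).
  have D1 := is_diff_coord y k; have D2 := is_diff_linear y (fl (evec k)).
  have [d v] := is_diff_scale (is_diff_differentiable D1) (is_diff_differentiable D2).
  by split=> //; rewrite v (is_diff_val D1) (is_diff_val D2).
have -> : (fun z => f z z) = (fun z => \sum_k F k z) by apply/funext => z; rewrite fE.
apply: is_diff_eq (is_diff_sum _ dF) _; apply/funext => a.
by rewrite big_split /= -!fE.
Qed.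

Lemma fiber_nbhs B c v : nat_open B -> atl c -> dom c (tpi v) -> B v ->
  \forall y \near tcoord c (tvect v), B (TM_of atl c (tpi v) y).
Proof.
move=> oB ac cv Bv.
have nB : nbhs (cmap c (tpi v), tcoord c (tvect v)) (nat_image c B).
  by apply: open_nbhs_nbhs; split; [exact: oB | exists v].
have cp : {for tcoord c (tvect v), continuous (fun y : E => (cmap c (tpi v), y))}.
  exact: (differentiable_continuous (is_diff_differentiable
    (is_diff_pair (is_diff_cst (cmap c (tpi v) : E) _) (is_diff_id (tcoord c (tvect v)))))).
near=> y; apply/(nat_image_TM_of Hatl _ _ ac cv).
by near: y; exact: (cp _ nB).
Unshelve. all: by end_near. 
Qed.

(** The common core of the agreement lemmas for vertical derivatives: near v in its fiber T' - T is
    an explicit function q of y, which is quadratic, linear or constant according to the type of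
    connection. The domains may differ, since gluing compares tensors defined over two different
    charts. *)
Lemma vderiv_shift s B B' (T : tsec s B) (T' : tsec s B') d v
    (u : 'I_s.+1 -> tangent atl (tpi v)) (q dq : E -> E) :
  (forall v Bv, multilinear (T v Bv)) ->
  (forall c J, atl c -> smooth_in (nat_chart atl c) (fun v Bv => tcomp c (T v Bv) J)) ->
  nat_open B -> nat_open B' -> atl d -> dom d (tpi v) -> B v -> B' v ->
  (forall y (By : B (TM_of atl d (tpi v) y)) (B'y : B' (TM_of atl d (tpi v) y)),
    tcoord d (T' _ B'y (init_args u)) = tcoord d (T _ By (init_args u)) + q y) ->
  is_diff (tcoord d (tvect v)) q dq ->
  vderiv T' d u = vderiv T d u + dq (tcoord d (u ord_max)).
Proof.
move=> mT sT oB oB' ad dv Bv B'v TT' Dq.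
have dT := fiber_expr_diff Hatl mT sT (init_args u) ad dv Bv.
have D := is_diffD (differentiableP dT) Dq.
have E1 : \forall y \near tcoord d (tvect v), (fiber_expr T d (init_args u) + q) y = fiber_expr T' d (init_args u) y.
  near=> y.
  have By : B (TM_of atl d (tpi v) y) by near: y; exact: fiber_nbhs.
  have B'y : B' (TM_of atl d (tpi v) y) by near: y; exact: fiber_nbhs.
  rewrite fctE /fiber_expr.
  rewrite (fiber_extE T By (init_args u)) (fiber_extE T' B'y (init_args u)); exact: esym (TT' y By B'y).
have [_ e] := near_eq_diff E1 (is_diff_differentiable D).
exact: (congr1 (fun h : E -> E => h (tcoord d (u ord_max))) (etrans e (is_diff_val D))).
Unshelve. all: by end_near. Qed.

Lemma tcoord_vdiff a s B (T : tsec s B) d v (Bv : B v) u : is_htensor a T ->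
  atl d -> dom d (tpi v) -> tcoord d (vdiff T Bv u) = vderiv T d u.
Proof.
by move=> [mT _ sT] ad dv; have [_] := vdiff_spec Hatl mT sT Bv ad dv.
Qed.

(** Anisotropic connections are compared through their symbols, that is, on coordinate frames. As a
    bilinear map a connection can be evaluated at any vectors, in particular at v, which the
    contraction requires. *)
Lemma anis_add_bilinear B (P : tsec 2 B) c d v (Bv : B v) (u : 'I_2 -> tangent atl (tpi v)) :
  multilinear (P v Bv) -> atl c -> atl d -> dom c (tpi v) -> dom d (tpi v) ->
  - defect c d (tpi v) (tcoord d (u ord0)) (tcoord d (u ord_max)) + tcoord d (P v Bv u) =
  christoffel_form (anis_add (chart_anis c) P Bv d) (tcoord d (u ord0)) (tcoord d (u ord_max)).
Proof.
move=> mP ac ad cv dv; pose p := tpi v.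
pose f (a b : E) : E := - defect c d p a b +
  tcoord d (P v Bv (pair_idx (tangent_of atl d p a) (tangent_of atl d p b))).
have m0 : (ord_max == ord0 :> 'I_2) = false by [].
have updl x y z : set_arg (pair_idx x y) ord0 z = pair_idx z y :> ('I_2 -> tangent atl p).
  by apply/funext => i; rewrite /set_arg /pair_idx; case: eqP.
have updr x y z : set_arg (pair_idx x y) ord_max z = pair_idx x z :> ('I_2 -> tangent atl p).
  apply/funext => i; rewrite /set_arg /pair_idx; case: eqP => [->|]; first by rewrite m0.
  by case: i => [[|[|i]] // H] /eqP.
have fl b : linear (f ^~ b).
  move=> k a a'; rewrite /f (defect_linearl Hatl b ad ac dv cv) tangent_ofD // tangent_ofZ //.
  set y := tangent_of atl d p b.
  have := mP ord0 (pair_idx 0 y) k (tangent_of atl d p a) (tangent_of atl d p a').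
  rewrite -![fun i => if i == ord0 then _ else _]/(set_arg (pair_idx 0 y) ord0 _) !updl => ->.
  by rewrite tcoordD tcoordZ opprD scalerDr scalerN addrACA.
have fr a : linear (f a).
  move=> k b b'; rewrite /f (defect_linearr Hatl a ad ac dv cv) tangent_ofD // tangent_ofZ //.
  set y := tangent_of atl d p a.
  have := mP ord_max (pair_idx y 0) k (tangent_of atl d p b) (tangent_of atl d p b').
  rewrite -![fun i => if i == ord_max then _ else _]/(set_arg (pair_idx y 0) ord_max _) !updr => ->.
  by rewrite tcoordD tcoordZ opprD scalerDr scalerN addrACA.
have uE : u = pair_idx (tangent_of atl d p (tcoord d (u ord0))) (tangent_of atl d p (tcoord d (u ord_max))).
  by rewrite !tangent_of_tcoord //; exact: pair_idxE.
transitivity (f (tcoord d (u ord0)) (tcoord d (u ord_max))); first by rewrite /f -uE.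
rewrite (bilinear_expand _ _ fl fr); congr christoffel_form.
apply/funext => i; apply/funext => j; apply/funext => k.
rewrite (anis_add_coord Hatl P Bv i j k ad ac dv cv) /f.
congr ((_ + tcoord d (P v Bv _) : E) 0 i); apply/funext => l.
by rewrite /frame /pair_idx; case: eqP.
Qed.

Lemma subr_swap (V : zmodType) (a b q : V) : - a = q - b -> b = a + q.
Proof. by move=> e; rewrite -[a]opprK e opprB subrK. Qed.

Lemma subr_swap2 (V : zmodType) (a b q q' : V) : q - a = q' - b -> b = a + (q' - q).
Proof.
by move=> e; apply: (@subr_swap _ a b (q' - q)); rewrite addrAC -e addrAC subrr sub0r.
Qed.

Lemma subr_swap3 (V : zmodType) (a q q' : V) : - q + a = - q' + (a + (q' - q)).
Proof. by rewrite addrCA [- q' + _]addrA addNr add0r addrC. Qed.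

Lemma subr_swap4 (V : zmodType) (a b q q' : V) : - q + a = - q' + b -> b = a + (q' - q).
Proof.
move=> e; have -> : b = q' + (- q' + b) by rewrite addrA subrr add0r.
by rewrite -e addrA addrC.
Qed.

Section Agreement.
Variables (B B' : set (TM atl)) (oB : nat_open B) (oB' : nat_open B').
Variables (c c' : chart M E) (ac : atl c) (ac' : atl c').

Lemma spray_vdiff_agree (Z : tsec 0 B) (Z' : tsec 0 B') :
  is_htensor 2 Z -> is_htensor 2 Z' ->
  (forall w (Bw : B w) (B'w : B' w), spray_sub (chart_spray c) (tscale 2 Z) Bw =
     spray_sub (chart_spray c') (tscale 2 Z') B'w) ->
  forall v (Bv : B v) (B'v : B' v), dom c (tpi v) -> dom c' (tpi v) -> forall u,
  nl_sub (chart_nl c) (vdiff Z) Bv u = nl_sub (chart_nl c') (vdiff Z') B'v u.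
Proof.
move=> hZ hZ' ZZ' v Bv B'v cv c'v u.
have [x1 y1] := nl_sub_coord Hatl (vdiff Z) Bv u ac ac cv cv.
have [x2 y2] := nl_sub_coord Hatl (vdiff Z') B'v u ac ac' cv c'v.
rewrite (tcoord_vdiff Bv (fun=> u) hZ ac cv) in y1.
rewrite (tcoord_vdiff B'v (fun=> u) hZ' ac cv) in y2.
apply: (hvcoord_inj ac cv); [exact: etrans x1 (esym x2)|apply: etrans y1 (etrans _ (esym y2))].
(* Along the fiber Z' = Z + f y y; the half undoes the factor 2 with which Z acts on sprays. *)
pose f (a b : E) : E := 2^-1 *: defect c' c (tpi v) a b.
have fl b : linear (f ^~ b).
  move=> k a a'; rewrite /f (defect_linearl Hatl b ac ac' cv c'v) scalerDr !scalerA.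
  by rewrite mulrC.
have fr a : linear (f a).
  move=> k b b'; rewrite /f (defect_linearr Hatl a ac ac' cv c'v) scalerDr !scalerA.
  by rewrite mulrC.
have [[mZ _ sZ] y0] := (hZ, tcoord c (tvect v)).
have two : (2 : R) != 0 by rewrite pnatr_eq0.
have E1 : vderiv Z' c (v := v) (fun=> u) = vderiv Z c (v := v) (fun=> u) +
    (f (tcoord c u) (tcoord c (tvect v)) + f (tcoord c (tvect v)) (tcoord c u)).
  apply: (vderiv_shift mZ sZ oB oB' ac cv Bv B'v _ (is_diff_bilinear_diag _ fl fr)).
  move=> y By B'y.
  have [_ e1] := spray_sub_coord Hatl (tscale 2 Z) By ac ac cv cv.
  have [_ e2] := spray_sub_coord Hatl (tscale 2 Z') B'y ac ac' cv c'v.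
  have := etrans (esym e1) (etrans (congr1 (fun X => vcoord c X) (ZZ' _ By B'y)) e2).
  rewrite (defect_id Hatl _ _ ac cv) sub0r tcoord_tangent_of // /tscale !tcoordZ.
  have -> : init_args (fun=> u) = (fun=> 0) :> ('I_0 -> tangent atl (tpi v)).
    by apply/funext => -[].
  move=> e; rewrite /f; apply: (scalerI two).
  by rewrite scalerDr scalerA divff // scale1r; exact: subr_swap e.
rewrite E1 (defect_id Hatl _ _ ac cv) sub0r /f (defect_sym Hatl (tcoord c (tvect v)) _ ac ac' cv c'v).
rewrite -scalerDl (_ : 2^-1 + 2^-1 = 1) ?scale1r; first by rewrite opprD addrCA subrr addr0.
by rewrite [RHS]splitr !div1r.
Qed.

(** The spray of a nonlinear connection is its horizontal lift of v at v. Agreement of the sprays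
    thus follows by evaluating the two equal connections at [tvect v], without any
    differentiation. *)
Lemma spray_icontract (B0 : set (TM atl)) (J : tsec 1 B0) e v (Bv : B0 v) :
  spray_sub (chart_spray e) (icontract J) Bv = nl_sub (chart_nl e) J Bv (tvect v).
Proof.
rewrite /spray_sub /nl_sub /icontract; congr (_ - vlift (J v Bv _)).
apply/funext => i; have -> : i = ord_max by apply: val_inj; case: i => -[].
by rewrite unlift_none.
Qed.

Lemma nl_vdiff_agree (J : tsec 1 B) (J' : tsec 1 B') :
  is_htensor 1 J -> is_htensor 1 J' ->
  (forall w (Bw : B w) (B'w : B' w),
    nl_sub (chart_nl c) J Bw = nl_sub (chart_nl c') J' B'w) ->
  forall v (Bv : B v) (B'v : B' v), dom c (tpi v) -> dom c' (tpi v) ->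
  anis_add (chart_anis c) (vdiff J) Bv = anis_add (chart_anis c') (vdiff J') B'v.
Proof.
move=> hJ hJ' JJ' v Bv B'v cv c'v; apply/funext => d.
apply/funext => i; apply/funext => j; apply/funext => k.
have [[ad dv]|nd] := pselect (atl d /\ dom d (tpi v)); last first.
  by rewrite (anis_add_off Hatl _ _ i j k ac cv nd) (anis_add_off Hatl _ _ i j k ac' c'v nd).
apply: (etrans (anis_add_coord Hatl (vdiff J) Bv i j k ad ac dv cv)).
apply: (etrans _ (esym (anis_add_coord Hatl (vdiff J') B'v i j k ad ac' dv c'v))).
set u := frame atl d (tpi v) (pair_idx j k).
apply: (congr1 (fun A : E => A 0 i)).
apply: (etrans (congr1 (fun x => _ + x) (tcoord_vdiff Bv u hJ ad dv))).
apply: (etrans _ (esym (congr1 (fun x => _ + x) (tcoord_vdiff B'v u hJ' ad dv)))).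
pose a : E := evec j.
(* The symbols are compared in an arbitrary chart d, so both charts contribute a defect. With the
   first argument fixed, q is linear in y and equals its own differential. *)
pose q (y : E) : E := defect c' d (tpi v) a y - defect c d (tpi v) a y.
have lq : linear q.
  move=> l b b'; rewrite /q (defect_linearr Hatl a ad ac dv cv) (defect_linearr Hatl a ad ac' dv c'v).
  by rewrite scalerBr opprD addrACA.
have [mJ _ sJ] := hJ.
have -> : vderiv J' d u = vderiv J d u + q (tcoord d (u ord_max)).
  apply: (vderiv_shift mJ sJ oB oB' ad dv Bv B'v _ (is_diff_linear _ lq)).
  move=> y By B'y; pose u0 := u ord0.
  have [_ e1] := nl_sub_coord Hatl J By u0 ad ac dv cv.
  have [_ e2] := nl_sub_coord Hatl J' B'y u0 ad ac' dv c'v.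
  have e0 := congr1 (fun X => vcoord d (X u0)) (JJ' _ By B'y).
  have := etrans (esym e1) (etrans e0 e2).
  have ej : tcoord d u0 = evec j by rewrite /u0 /u /frame tcoord_tangent_of.
  have ey : tcoord d (tvect (TM_of atl d (tpi v) y)) = y by rewrite tcoord_tangent_of.
  rewrite ej ey.
  have -> : init_args u = (fun=> u ord0) :> ('I_1 -> tangent atl (tpi v)).
    by apply/funext => l; rewrite /init_args (ord1 l); congr u; exact: val_inj.
  exact: subr_swap2.
have -> : tcoord d (u ord_max) = evec k by rewrite tcoord_tangent_of.
exact: subr_swap3.
Qed.

Lemma anis_icontract_agree (P : tsec 2 B) (P' : tsec 2 B') v (Bv : B v) (B'v : B' v) :
  multilinear (P v Bv) -> multilinear (P' v B'v) ->
  anis_add (chart_anis c) P Bv = anis_add (chart_anis c') P' B'v ->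
  dom c (tpi v) -> dom c' (tpi v) ->
  nl_sub (chart_nl c) (icontract P) Bv = nl_sub (chart_nl c') (icontract P') B'v.
Proof.
move=> mP mP' PP' cv c'v; apply/funext => u.
have [x1 y1] := nl_sub_coord Hatl (icontract P) Bv u ac ac cv cv.
have [x2 y2] := nl_sub_coord Hatl (icontract P') B'v u ac ac' cv c'v.
apply: (hvcoord_inj ac cv); [exact: etrans x1 (esym x2)|apply: etrans y1 (etrans _ (esym y2))].
(* The pair (u, v), at which the contraction with the Liouville field evaluates P. *)
pose u2 := ext_last (fun=> u) (tvect v) : 'I_2 -> tangent atl (tpi v).
have u20 : u2 ord0 = u.
  by rewrite /u2 /ext_last (_ : ord0 = lift ord_max ord0) ?liftK //; exact: val_inj.
have u2m : u2 ord_max = tvect v by rewrite /u2 /ext_last unlift_none.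
have e1 := anis_add_bilinear u2 mP ac ac cv cv.
have e2 := anis_add_bilinear u2 mP' ac' ac c'v cv.
rewrite -PP' -e1 u20 u2m in e2.
apply: oppr_inj; rewrite !opprB addrC [RHS]addrC; exact: esym e2.
Qed.

Lemma anis_vdiff_agree (P : tsec 2 B) (P' : tsec 2 B') :
  is_htensor 0 P -> is_htensor 0 P' ->
  (forall w (Bw : B w) (B'w : B' w),
    anis_add (chart_anis c) P Bw = anis_add (chart_anis c') P' B'w) ->
  forall v (Bv : B v) (B'v : B' v), dom c (tpi v) -> dom c' (tpi v) ->
  vdiff P Bv = vdiff P' B'v.
Proof.
move=> hP hP' PP' v Bv B'v cv c'v; apply/funext => u; apply: (tcoord_inj ac cv).
apply: (etrans (tcoord_vdiff Bv u hP ac cv)); apply: (etrans _ (esym (tcoord_vdiff B'v u hP' ac cv))).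
have [mP _ sP] := hP; have [mP' _ _] := hP'.
pose a := tcoord c (init_args u ord0); pose b := tcoord c (init_args u ord_max).
(* P' - P does not depend on y: it comes from a tensor on M, which the vertical derivative kills. *)
pose q : E := defect c' c (tpi v) a b - defect c c (tpi v) a b.
have -> : vderiv P' c u = vderiv P c u + (0 : E -> E) (tcoord c (u ord_max)).
  apply: (vderiv_shift mP sP oB oB' ac cv Bv B'v _ (is_diff_cst q _)).
  move=> y By B'y.
  have e1 := anis_add_bilinear (v := TM_of atl c (tpi v) y) (init_args u) (mP _ By) ac ac cv cv.
  have e2 := anis_add_bilinear (v := TM_of atl c (tpi v) y) (init_args u) (mP' _ B'y) ac' ac c'v cv.
  rewrite -(PP' _ By B'y) in e2.
  exact: subr_swap4 (etrans e1 (esym e2)).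
by rewrite addr0.
Qed.

End Agreement.

End ChangeOfChart.

(** * Restriction to smaller domains and local criteria *)

Section Localization.
Context {R : realType} {M : Type} {n : nat}.
Local Notation E := 'rV[R]_n.
Implicit Types c d : chart M E.
Variables (atl : set (chart M E)) (Hatl : smooth_atlas atl).
Hypothesis cover : forall p, exists2 c, atl c & dom c p.
Implicit Types B : set (TM atl).
Notation nat_image c B := (cmap (nat_chart atl c) @` (B `&` dom (nat_chart atl c))).

Lemma Ck_pair (V W X : normedModType R) (U : set V) (f : V -> W) (g : V -> X) k :
  open U -> Ck k U f -> Ck k U g -> Ck k U (fun z => (f z, g z)).
Proof.
move=> oU; elim: k f g => [|k IH] f g cf cg.
  by move=> x Ux; apply: cvg_pair; [exact: cf | exact: cg].
case: cf cg => df cf [dg cg]; split=> [x Ux|v].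
  by apply: differentiable_pair; [exact: df | exact: dg].
apply: (@eq_Ck _ _ _ _ (fun x => ('D_v f x, 'D_v g x))) => // [x Ux|].
  have D1 := df x Ux; have D2 := dg x Ux.
  rewrite [RHS]deriveE; last exact: differentiable_pair.
  by rewrite diff_pair // !deriveE.
exact: IH (cf v) (cg v).
Qed.

Lemma smooth_in_restr (W : normedModType R) B B' (sub : B' `<=` B) c (f : forall v, B v -> W) :
  nat_open B' -> atl c -> smooth_in (nat_chart atl c) f ->
  smooth_in (nat_chart atl c) (restr sub f).
Proof.
move=> oB' ac sf k; have sub' : nat_image c B' `<=` nat_image c B.
  by move=> _ [v [B'v cv] <-]; exists v => //; split=> //; exact: sub.
apply: (eq_Ck (oB' _ ac)) (sub_Ck sub' (sf k)) => _ [v [B'v cv] <-].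
rewrite (in_chartE _ B'v) ?(in_chartE _ (sub _ B'v)) //; exact: nat_inj.
Qed.

Lemma restr_is_spray B B' (sub : B' `<=` B) (G : spray_sec B) : nat_open B' ->
  is_spray G -> is_spray (restr sub G).
Proof.
move=> oB' [G1 G2 G3]; split=> [v B'v|l v B'v B'lv l0|c ac]; first exact: G1.
  exact: G2.
exact: (smooth_in_restr sub oB' ac (G3 c ac)).
Qed.

Lemma restr_is_nl B B' (sub : B' `<=` B) (N : nl_sec B) : nat_open B' ->
  is_nl N -> is_nl (restr sub N).
Proof.
move=> oB' [N0 N1 N2 N3]; split=> [v B'v|v B'v u|l v B'v B'lv u l0|c j ac].
- exact: N0.
- exact: N1.
- exact: N2.
- exact: (smooth_in_restr sub oB' ac (N3 c j ac)).
Qed.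

Lemma restr_is_anis B B' (sub : B' `<=` B) (G : anis_sec B) : nat_open B' ->
  is_anis G -> is_anis (restr sub G).
Proof.
move=> oB' [G1 G2 G3]; split=> [v B'v|l v B'v B'lv l0|c i j k ac]; first exact: G1.
  exact: G2.
exact: (smooth_in_restr sub oB' ac (G3 c i j k ac)).
Qed.

Section Local.
Variables (A : set (TM atl)) (oA : nat_open A).
Let res U : A `&` TM_over U `<=` A := @subIsetl (TM atl) A (TM_over U).
Arguments res : clear implicits.
Notation loc c := (A `&` TM_over (dom c)).

Lemma smooth_in_local (W : normedModType R) c (f : forall v, A v -> W) :
  smooth_in (nat_chart atl c) (restr (res (dom c)) f) -> atl c ->
  smooth_in (nat_chart atl c) f.
Proof.
move=> sf ac k.
have imE : nat_image c A = nat_image c (loc c).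
  by apply/seteqP; split=> [_ [v [Av cv] <-]|_ [v [[Av _] cv] <-]]; exists v.
rewrite imE; have oA' := oA ac; rewrite imE in oA'.
apply: (eq_Ck oA') (sf k) => _ [v [Av cv] <-].
have ci := nat_inj Hatl ac; rewrite (in_chartE _ Av ci cv) (in_chartE f Av.1 ci cv).
by rewrite /restr (Prop_irrelevance (res _ _ _) Av.1).
Qed.

Lemma nat_open_loc c : atl c -> nat_open (loc c).
Proof.
move=> ac d ad; have -> : nat_image d (loc c) =
    nat_image d A `&` [set z | (cmap d @` (dom c `&` dom d)) z.1].
  apply/seteqP; split=> [_ [v [[Av cv] dv] <-]|z [[v [Av dv] <-] [p [cp dp] /= vp]]].
    by split; exists v || exists (tpi v).
  exists v => //; split=> //; split=> //.
  by rewrite /TM_over /= -(Hatl.1.1 _ ad _ _ dp dv vp).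
by apply: openI; [exact: oA | exact: (nat_overlap_open Hatl)].
Qed.

(** Homogeneity is only given on coordinate frames; [frame_ind] carries it to all arguments, which
    make sense at both points because scaling preserves the base point. *)
Lemma tcoord_homogeneous a s B (T : tsec s B) l v (Bv : B v) (Blv : B (hscale l v))
    (u : 'I_s -> tangent atl (tpi v)) c : is_htensor a T -> 0 < l -> atl c -> dom c (tpi v) ->
  tcoord c (T (hscale l v) Blv u : tangent atl (tpi v)) = l ^ a *: tcoord c (T v Bv u).
Proof.
move=> [mT hT _] l0 ac cv; move: u; apply: (@frame_ind _ _ _ atl s c (tpi v)) => [J|u k Hu].
  apply: (etrans (esym (tcompE c (T (hscale l v) Blv) J))); rewrite -tcompE.
  exact: (hT l v Bv Blv c J l0 ac cv).
rewrite (multilinear_expand Hatl u k (mT v Bv) ac cv).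
rewrite (multilinear_expand Hatl (p := tpi v) u k (mT (hscale l v) Blv) ac cv).
rewrite !tcoord_sum scaler_sumr; apply: eq_bigr => j _.
by rewrite !tcoordZ Hu !scalerA mulrC.
Qed.

Definition no_index (i : 'I_0) : 'I_n := match notF (ltn_ord i) with end.

Lemma frame0 c p (J : 'I_0 -> 'I_n) : frame atl c p J = (fun=> 0).
Proof. by apply/funext => -[]. Qed.

(** Z appears without the factor 2, the form in which [icontract] yields sprays. In c the chart
    spray is (y, 0), so each condition on G becomes one on Z. *)
Lemma spray_of_local (G : spray_sec A) :
  (forall c, atl c -> exists2 Z : tsec 0 (loc c), is_htensor 2 Z &
     restr (res (dom c)) G = spray_sub (chart_spray c) Z) -> is_spray G.
Proof.
move=> HG.
have coord c v (Av : A v) : atl c -> forall cv : dom c (tpi v),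
    exists2 Z : tsec 0 (loc c), is_htensor 2 Z &
    forall w (Aw : A w) (cw : dom c (tpi w)), hcoord c (G w Aw) = tcoord c (tvect w) /\
      vcoord c (G w Aw) = - tcoord c (Z w (conj Aw cw) (fun=> 0)).
  move=> ac cv; have [Z hZ GZ] := HG c ac; exists Z => // w Aw cw.
  have := spray_sub_coord Hatl Z (conj Aw cw : (loc c) w) ac ac cw cw.
  by rewrite -GZ /restr (Prop_irrelevance (res _ _ _) Aw) (defect_id Hatl _ _ ac cw) sub0r.
split=> [v Av|l v Av Alv l0|c ac].
- have [c ac cv] := cover (tpi v); have [Z hZ GZ] := coord c v Av ac cv.
  by apply: (tcoord_inj ac cv); rewrite (tcoord_dmap_tpi Hatl) // (GZ v Av cv).1.
- have [c ac cv] := cover (tpi v); have [Z hZ GZ] := coord c v Av ac cv.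
  have [x1 y1] := GZ v Av cv; have [x2 y2] := GZ (hscale l v) Alv cv.
  have [x3 y3] := dmap_hscale_coord Hatl l (G v Av) ac cv.
  apply: (hvcoord_inj (v := hscale l v) ac cv); first by rewrite hcoordZ x3 x2 x1 tcoord_hscale.
  rewrite vcoordZ y3 y2 y1 !scalerN; congr (- _).
  apply: (etrans (tcoord_homogeneous (T := Z) (conj Av cv) (conj Alv cv) (fun=> 0) hZ l0 ac cv)).
  by rewrite scalerA.
- have [Z hZ GZ] := HG c ac; apply: (smooth_in_local _ ac).
  pose t := fun v (Bv : (loc c) v) => tcomp c (Z v Bv) no_index : E.
  apply: (@smooth_in_eq _ _ _ _ Hatl _ _ c _ (fun z : E * E =>
    (z.2, - in_chart (nat_chart atl c) t z) : E * E) (nat_open_loc ac) ac).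
    move=> v Bv cv; rewrite [LHS]surjective_pairing.
    rewrite -/(hcoord c (restr (res (dom c)) G Bv)) -/(vcoord c (restr (res (dom c)) G Bv)) GZ.
    have [-> ->] := spray_sub_coord Hatl Z Bv ac ac cv cv.
    rewrite (in_chartE t (p := v) Bv) //; last exact: nat_inj.
    by rewrite (defect_id Hatl _ _ ac cv) sub0r /t tcompE frame0.
  move=> k; apply: Ck_pair (nat_open_loc ac ac) (Ck_snd _ _) _.
  apply: CkN (nat_open_loc ac ac) _.
  by have [_ _ sZ] := hZ; exact: (sZ c no_index ac k).
Qed.

Lemma nl_of_local (N : nl_sec A) :
  (forall c, atl c -> exists2 J : tsec 1 (loc c), is_htensor 1 J &
     restr (res (dom c)) N = nl_sub (chart_nl c) J) -> is_nl N.
Proof.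
move=> HN.
have coord c : atl c -> exists2 J : tsec 1 (loc c), is_htensor 1 J &
    forall w (Aw : A w) (cw : dom c (tpi w)) u, hcoord c (N w Aw u) = tcoord c u /\
      vcoord c (N w Aw u) = - tcoord c (J w (conj Aw cw) (fun=> u)).
  move=> ac; have [J hJ NJ] := HN c ac; exists J => // w Aw cw u.
  have := nl_sub_coord Hatl J (conj Aw cw : (loc c) w) u ac ac cw cw.
  by rewrite -NJ /restr (Prop_irrelevance (res _ _ _) Aw) (defect_id Hatl _ _ ac cw) sub0r.
split=> [v Av|v Av u|l v Av Alv u l0|c j ac].
- have [c ac cv] := cover (tpi v); have [J [mJ _ _] NJ] := coord c ac.
  move=> k x x'; apply: (hvcoord_inj ac cv).
    by rewrite hcoordD hcoordZ !(NJ v Av cv _).1 tcoordD tcoordZ.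
  rewrite vcoordD vcoordZ !(NJ v Av cv _).2 scalerN -opprD -tcoordZ -tcoordD; congr (- tcoord c _).
  have E1 z : J v (conj Av cv) (fun=> z) =
      J v (conj Av cv) (fun i => if i == ord0 then z else 0).
    by congr (J v _ _); apply/funext => i; rewrite (ord1 i).
  by rewrite !E1; exact: (mJ v (conj Av cv) ord0 (fun=> 0)).
- have [c ac cv] := cover (tpi v); have [J hJ NJ] := coord c ac.
  by apply: (tcoord_inj ac cv); rewrite (tcoord_dmap_tpi Hatl) // (NJ v Av cv u).1.
- have [c ac cv] := cover (tpi v); have [J hJ NJ] := coord c ac.
  have [x1 y1] := NJ v Av cv u; have [x2 y2] := NJ (hscale l v) Alv cv u.
  have [x3 y3] := dmap_hscale_coord Hatl l (N v Av u) ac cv.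
  apply: (hvcoord_inj (v := hscale l v) ac cv); first by rewrite x3 x2 x1.
  rewrite y3 y2 y1 scalerN; congr (- _).
  apply: (etrans (tcoord_homogeneous (T := J) (conj Av cv) (conj Alv cv) (fun=> u) hJ l0 ac cv)).
  by rewrite expr1z.
- have [J hJ NJ] := coord c ac; apply: (smooth_in_local _ ac).
  pose t := fun v (Bv : (loc c) v) => tcomp c (J v Bv) (fun=> j) : E.
  apply: (@smooth_in_eq _ _ _ _ Hatl _ _ c _ (fun z : E * E =>
    (evec j, - in_chart (nat_chart atl c) t z) : E * E) (nat_open_loc ac) ac).
    move=> v Bv cv; rewrite [LHS]surjective_pairing /restr.
    set e := tvec _ _ _ _; have eE : e = tangent_of atl c (tpi v) (evec j) by rewrite tangent_of.unlock.
    set X := N _ _ _; rewrite -/(hcoord c X) -/(vcoord c X).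
    have [-> ->] := NJ v (res _ _ Bv) cv e.
    rewrite (in_chartE t (p := v) Bv) //; last exact: nat_inj.
    rewrite {1}eE tcoord_tangent_of // /t tcompE (Prop_irrelevance (conj _ _) Bv) eE.
    by congr (_, _).
  move=> k; apply: Ck_pair (nat_open_loc ac ac) (Ck_cst _ _ _) _.
  apply: CkN (nat_open_loc ac ac) _.
  by have [_ _ sJ] := hJ; exact: (sJ c _ ac k).
Qed.

(** The condition [is_CM] relates all pairs of charts (c1, c2), not only c to another chart. It
    splits into the tensor law for P and the cocycle identity of the defect of c. *)
Lemma anis_of_local (G : anis_sec A) :
  (forall c, atl c -> exists2 P : tsec 2 (loc c), is_htensor 0 P &
     restr (res (dom c)) G = anis_add (chart_anis c) P) -> is_anis G.
Proof.
move=> HG.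
have loc_eq c : atl c -> exists2 P : tsec 2 (loc c), is_htensor 0 P &
    forall w (Aw : A w) (cw : dom c (tpi w)),
      G w Aw = anis_add (chart_anis c) P (conj Aw cw : (loc c) w).
  move=> ac; have [P hP GP] := HG c ac; exists P => // w Aw cw.
  by rewrite -GP /restr (Prop_irrelevance (res _ _ _) Aw).
split=> [v Av|l v Av Alv l0|c i j k ac].
- have [c ac cv] := cover (tpi v); have [P [mP _ _] GP] := loc_eq c ac.
  set Bv : (loc c) v := conj Av cv; rewrite (GP v Av cv).
  split=> [c1 c2 a1 a2 c1v c2v i j k|d i j k nd]; last exact: (anis_add_off Hatl).
  apply: (etrans _ (esym (CM_lawE Hatl i j k _ a1 a2 c1v c2v))).
  apply: (etrans (anis_add_coord Hatl P Bv i j k a2 ac c2v cv)).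
  apply: (congr1 (fun X : E => X 0 i)).
  set u := frame _ _ _ _; have := anis_add_bilinear Hatl u (mP v Bv) ac a1 cv c1v.
  rewrite (tcoord_law (u ord0) a2 a1 c2v c1v) (tcoord_law (u ord_max) a2 a1 c2v c1v).
  have -> : tcoord c2 (u ord0) = evec j by rewrite tcoord_tangent_of.
  have -> : tcoord c2 (u ord_max) = evec k by rewrite tcoord_tangent_of.
  move=> <-; rewrite dtransD dtransN -(tcoord_law _ a1 a2 c1v c2v) addrA; congr (_ + _).
  rewrite (defect_cocycle Hatl (evec j) (evec k) ac a1 a2 cv c1v c2v).
  by rewrite opprD.
- have [c ac cv] := cover (tpi v); have [P hP GP] := loc_eq c ac.
  rewrite (GP v Av cv) (GP (hscale l v) Alv cv).
  apply/funext => d; apply/funext => i; apply/funext => j; apply/funext => k.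
  have [[ad dv]|nd] := pselect (atl d /\ dom d (tpi v)); last first.
    rewrite (anis_add_off Hatl P (v := v) _ i j k ac cv nd).
    exact: (anis_add_off Hatl P (v := hscale l v) _ i j k ac cv nd).
  rewrite (anis_add_coord Hatl P (v := v) _ i j k ad ac dv cv).
  apply: (etrans (anis_add_coord Hatl P (v := hscale l v) _ i j k ad ac dv cv)).
  apply: (congr1 (fun X : E => (- _ + X) 0 i)).
  rewrite (tcoord_homogeneous (T := P) (conj Av cv) (conj Alv cv) _ hP l0 ad dv).
  by rewrite expr0z scale1r.
- have [P hP GP] := loc_eq c ac; apply: (smooth_in_local _ ac).
  pose t := fun v (Bv : (loc c) v) => tcomp c (P v Bv) (pair_idx j k) : E.
  apply: (@smooth_in_eq _ _ _ _ Hatl R^o _ c _ (fun z : E * E =>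
    in_chart (nat_chart atl c) t z 0 i : R^o) (nat_open_loc ac) ac).
    move=> v Bv cv; rewrite /restr (GP v _ cv).
    rewrite (anis_add_coord Hatl P _ i j k ac ac cv cv) (defect_id Hatl _ _ ac cv) oppr0 add0r.
    rewrite (in_chartE t (p := v) Bv) //; last exact: nat_inj.
    by rewrite /t tcompE (Prop_irrelevance (conj _ _) Bv).
  move=> m; apply: (Ck_coord i (nat_open_loc ac ac)).
  by have [_ _ sP] := hP; exact: (sP c _ ac m).
Qed.

Lemma htensor_of_local a s (T : tsec s A) :
  (forall c, atl c -> exists2 K : tsec s (loc c), is_htensor a K &
     restr (res (dom c)) T = K) -> is_htensor a T.
Proof.
move=> HT.
have loc_eq c : atl c -> exists2 K : tsec s (loc c), is_htensor a K &
    forall w (Aw : A w) (cw : dom c (tpi w)), T w Aw = K w (conj Aw cw : (loc c) w).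
  move=> ac; have [K hK TK] := HT c ac; exists K => // w Aw cw.
  by rewrite -TK /restr (Prop_irrelevance (res _ _ _) Aw).
split=> [v Av|l v Av Alv c J l0 ac cv|c J ac].
- have [c ac cv] := cover (tpi v); have [K [mK _ _] TK] := loc_eq c ac.
  by rewrite (TK v Av cv); exact: mK.
- have [K [_ hK _] TK] := loc_eq c ac.
  by rewrite (TK v Av cv) (TK (hscale l v) Alv cv); exact: hK.
- have [K [_ _ sK] TK] := HT c ac; apply: (smooth_in_local _ ac).
  by rewrite -TK in sK; exact: sK.
Qed.

End Local.

End Localization.

Lemma sval_inj (T : Type) (P : T -> Prop) (x y : {t | P t}) : sval x = sval y -> x = y.
Proof. by case: x y => [x px] [y py] /= xy; subst y; rewrite (Prop_irrelevance px py). Qed.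

Lemma exists_unique_map (X Y : Type) (Rel : X -> Y -> Prop) :
  (forall x, exists! y, Rel x y) -> exists! f : X -> Y, forall x, Rel x (f x).
Proof.
move=> H; have /choice[f Hf] : forall x, exists y, unique (Rel x) y by [].
exists f; split=> [x|g Hg]; first exact: (Hf x).1.
by apply/funext => x; apply: (Hf x).2; exact: Hg.
Qed.

(** * Gluing *)

Section Gluing.
Context {R : realType} {M : Type} {n : nat}.
Local Notation E := 'rV[R]_n.
Implicit Types c d : chart M E.
Variables (atl : set (chart M E)).
Hypothesis cover : forall p, exists2 c, atl c & dom c p.
Variable A : set (TM atl).
Notation loc c := (A `&` TM_over (dom c)).

(** Stated once for the five maps: i ranges over the tensors that express the given connection in c,
    selected by P, and f c i is the local formula of the map. The value at v is common to all charts
    by agreement, hence well defined and unique, and [isF] can be verified chart by chart. *)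
Lemma unique_gluing (F : TM atl -> Type) (isF : (forall v, A v -> F v) -> Prop)
    (I : chart M E -> Type) (P : forall c, I c -> Prop)
    (f : forall c, I c -> forall v, (loc c) v -> F v) :
  (forall c, atl c -> exists i, P c i) ->
  (forall c c' i i', atl c -> atl c' -> P c i -> P c' i' ->
     forall v Dv D'v, f c i v Dv = f c' i' v D'v) ->
  (forall g, (forall c, atl c -> exists2 i, P c i &
     restr (@subIsetl (TM atl) A (TM_over (dom c))) g = f c i) -> isF g) ->
  exists! y : {g | isF g}, forall c i, atl c -> P c i ->
    restr (@subIsetl (TM atl) A (TM_over (dom c))) (sval y) = f c i.
Proof.
move=> Pex agree isFg.
have Hv v : A v -> exists x : F v, forall c i, atl c -> P c i ->
    forall Dv : (loc c) v, x = f c i v Dv.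
  move=> Av; have [c ac cv] := cover (tpi v); have [i Pi] := Pex c ac.
  by exists (f c i v (conj Av cv)) => c' i' ac' Pi' Dv; exact: agree.
pose g v (Av : A v) := sval (cid (Hv v Av)).
have gE c i : atl c -> P c i -> restr (@subIsetl (TM atl) A (TM_over (dom c))) g = f c i.
  move=> ac Pi; apply: functional_extensionality_dep => v; apply: functional_extensionality_dep => Dv.
  exact: (svalP (cid (Hv v _)) c i ac Pi Dv).
have Fg : isF g.
  by apply: isFg => c ac; have [i Pi] := Pex c ac; exists i => //; exact: gE.
exists (exist _ g Fg); split=> // -[h Fh] /= hE; apply: sval_inj => /=.
apply: functional_extensionality_dep => v; apply: functional_extensionality_dep => Av.
have [c ac cv] := cover (tpi v); have [i Pi] := Pex c ac.
have Dv : (loc c) v by [].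
have := congr1 (fun k : forall v, (loc c) v -> F v => k v Dv) (etrans (gE c i ac Pi) (esym (hE c i ac Pi))).
by rewrite /restr (Prop_irrelevance (subIsetl Dv) Av).
Qed.

End Gluing.

(** * Uniqueness of the tensors relative to a chart *)

Section Uniqueness.
Context {R : realType} {M : Type} {n : nat}.
Local Notation E := 'rV[R]_n.
Implicit Types c d : chart M E.
Variables (atl : set (chart M E)) (Hatl : smooth_atlas atl).
Variables (B : set (TM atl)) (c : chart M E) (ac : atl c) (BC : B `<=` TM_over (dom c)).

Lemma spray_sub_inj (Z Z' : tsec 0 B) :
  spray_sub (chart_spray c) (tscale 2 Z) = spray_sub (chart_spray c) (tscale 2 Z') -> Z = Z'.
Proof.
move=> ZZ'; apply: functional_extensionality_dep => v; apply: functional_extensionality_dep => Bv.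
apply/funext => u; have cv : dom c (tpi v) := BC Bv.
have -> : u = fun=> 0 by apply/funext => -[].
have [_ e1] := spray_sub_coord Hatl (tscale 2 Z) Bv ac ac cv cv.
have [_ e2] := spray_sub_coord Hatl (tscale 2 Z') Bv ac ac cv cv.
have e := etrans (esym e1) (etrans (congr1 (fun X : spray_sec B => vcoord c (X v Bv)) ZZ') e2).
have two : (2 : R) != 0 by rewrite pnatr_eq0.
by apply: (tcoord_inj ac cv); apply: (scalerI two); rewrite -!tcoordZ; apply: oppr_inj; exact: addrI e.
Qed.

Lemma nl_sub_inj (J J' : tsec 1 B) :
  nl_sub (chart_nl c) J = nl_sub (chart_nl c) J' -> J = J'.
Proof.
move=> JJ'; apply: functional_extensionality_dep => v; apply: functional_extensionality_dep => Bv.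
apply/funext => u; have cv : dom c (tpi v) := BC Bv.
have -> : u = fun=> u ord0 by apply/funext => i; rewrite (ord1 i).
have [_ e1] := nl_sub_coord Hatl J Bv (u ord0) ac ac cv cv.
have [_ e2] := nl_sub_coord Hatl J' Bv (u ord0) ac ac cv cv.
have e := etrans (esym e1) (etrans (congr1 (fun X : nl_sec B => vcoord c (X v Bv (u ord0))) JJ') e2).
by apply: (tcoord_inj ac cv); apply: oppr_inj; exact: addrI e.
Qed.

(** [anis_add] sees a tensor on coordinate frames only, and multilinearity determines it from
    there. *)
Lemma anis_add_inj (P P' : tsec 2 B) :
  (forall v Bv, multilinear (P v Bv)) -> (forall v Bv, multilinear (P' v Bv)) ->
  anis_add (chart_anis c) P = anis_add (chart_anis c) P' -> P = P'.
Proof.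
move=> mP mP' PP'; apply: functional_extensionality_dep => v.
apply: functional_extensionality_dep => Bv.
apply/funext => u; have cv : dom c (tpi v) := BC Bv.
have e1 := anis_add_bilinear Hatl u (mP v Bv) ac ac cv cv.
have e2 := anis_add_bilinear Hatl u (mP' v Bv) ac ac cv cv.
rewrite -PP' -e1 in e2.
by apply: (tcoord_inj ac cv); exact: addrI (esym e2).
Qed.

End Uniqueness.

(** * From manifolds to smooth atlases *)

Section Manifolds.
Context {R : realType} {n : nat} {M : topologicalType}.
Local Notation E := 'rV[R]_n.
Variables (atl : set (chart M E)) (HM : smooth_manifold atl).

Lemma smooth_manifold_atlas : smooth_atlas atl.
Proof.
case: HM => _ _ Hchart Hcomp _; split; last exact: Hcomp.
split=> [c ac|c c' ac ac']; first by case: (Hchart c ac).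
have oU : open (cmap c @` (dom c' `&` dom c)).
  have [oc _ Hc] := Hchart c ac; have [oc' _ _] := Hchart c' ac'.
  by apply/Hc; [exact: subIsetr | exact: openI].
split=> // p cp c'p; have [+ _] := Hcomp c c' ac ac' 1.
by apply; exists p.
Qed.

Lemma smooth_manifold_cover p : exists2 c, atl c & dom c p.
Proof. by case: HM => _ + _ _ _; exact. Qed.

Lemma nat_open_TM_over (A : set (TM atl)) U : nat_open A -> open U ->
  nat_open (A `&` TM_over U).
Proof.
move=> oA oU d ad.
have -> : cmap (nat_chart atl d) @` (A `&` TM_over U `&` dom (nat_chart atl d)) =
    cmap (nat_chart atl d) @` (A `&` dom (nat_chart atl d)) `&`
    [set z | (cmap d @` (U `&` dom d)) z.1].
  apply/seteqP; split=> [_ [v [[Av Uv] dv] <-]|z [[v [Av dv] <-] [p [Up dp] /= vp]]].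
    by split; exists v || exists (tpi v).
  exists v => //; split=> //; split=> //.
  by rewrite /TM_over /= -(smooth_manifold_atlas.1.1 _ ad _ _ dp dv vp).
apply: openI; first exact: oA.
apply: open_fst_preimage; case: HM => _ _ Hchart _ _; have [od _ Hd] := Hchart d ad.
by apply/Hd; [exact: subIsetr | exact: openI].
Qed.

Lemma chart_dom_open c : atl c -> open (dom c).
Proof. by case: HM => _ _ Hchart _ _ ac; have [] := Hchart c ac. Qed.

End Manifolds.

Theorem proposition4 (R : realType) (n : nat) (M : topologicalType)
    (atl : set (chart M 'rV[R]_n)) (A : set (TM atl))
    (HM : smooth_manifold atl) (HA : conic_domain A) :
  (* (i) *)
  (forall c c' : chart M 'rV[R]_n, atl c -> atl c' ->
     let B : set (TM atl) := A `&` TM_over (dom c `&` dom c') in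
     forall (G : spray B) (N : nlconn B) (Gam : anisconn B),
     [/\ (exists! Z : htensor 2 0 B,
            sval G = spray_sub (chart_spray c) (tscale 2 (sval Z))) /\
         (exists! Z' : htensor 2 0 B,
            sval G = spray_sub (chart_spray c') (tscale 2 (sval Z'))),
         (exists! J : htensor 1 1 B, sval N = nl_sub (chart_nl c) (sval J)) /\
         (exists! J' : htensor 1 1 B, sval N = nl_sub (chart_nl c') (sval J')),
         (exists! P : htensor 0 2 B,
            sval Gam = anis_add (chart_anis c) (sval P)) /\
         (exists! P' : htensor 0 2 B,
            sval Gam = anis_add (chart_anis c') (sval P')) &
         forall (Z Z' : htensor 2 0 B) (J J' : htensor 1 1 B)
                (P P' : htensor 0 2 B),
           sval G = spray_sub (chart_spray c) (tscale 2 (sval Z)) ->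
           sval G = spray_sub (chart_spray c') (tscale 2 (sval Z')) ->
           sval N = nl_sub (chart_nl c) (sval J) ->
           sval N = nl_sub (chart_nl c') (sval J') ->
           sval Gam = anis_add (chart_anis c) (sval P) ->
           sval Gam = anis_add (chart_anis c') (sval P') ->
           [/\ nl_sub (chart_nl c) (vdiff (sval Z)) =
                 nl_sub (chart_nl c') (vdiff (sval Z')),
               spray_sub (chart_spray c) (icontract (sval J)) =
                 spray_sub (chart_spray c') (icontract (sval J')),
               anis_add (chart_anis c) (vdiff (sval J)) =
                 anis_add (chart_anis c') (vdiff (sval J')),
               nl_sub (chart_nl c) (icontract (sval P)) =
                 nl_sub (chart_nl c') (icontract (sval P')) &
               vdiff (sval P) = vdiff (sval P')]])
  /\
  (* (ii) *)
  (let res (U : set M) := @subIsetl (TM atl) A (TM_over U) in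
   [/\ (exists! d_spr : spray A -> nlconn A,
          forall (G : spray A) (c : chart M 'rV[R]_n)
                 (Z : htensor 2 0 (A `&` TM_over (dom c))), atl c ->
            restr (res (dom c)) (sval G) =
              spray_sub (chart_spray c) (tscale 2 (sval Z)) ->
            restr (res (dom c)) (sval (d_spr G)) =
              nl_sub (chart_nl c) (vdiff (sval Z))),
       (exists! i_spr : nlconn A -> spray A,
          forall (N : nlconn A) (c : chart M 'rV[R]_n)
                 (J : htensor 1 1 (A `&` TM_over (dom c))), atl c ->
            restr (res (dom c)) (sval N) = nl_sub (chart_nl c) (sval J) ->
            restr (res (dom c)) (sval (i_spr N)) =
              spray_sub (chart_spray c) (icontract (sval J))),
       (exists! d_nl : nlconn A -> anisconn A,
          forall (N : nlconn A) (c : chart M 'rV[R]_n)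
                 (J : htensor 1 1 (A `&` TM_over (dom c))), atl c ->
            restr (res (dom c)) (sval N) = nl_sub (chart_nl c) (sval J) ->
            restr (res (dom c)) (sval (d_nl N)) =
              anis_add (chart_anis c) (vdiff (sval J))),
       (exists! i_nl : anisconn A -> nlconn A,
          forall (Gam : anisconn A) (c : chart M 'rV[R]_n)
                 (P : htensor 0 2 (A `&` TM_over (dom c))), atl c ->
            restr (res (dom c)) (sval Gam) =
              anis_add (chart_anis c) (sval P) ->
            restr (res (dom c)) (sval (i_nl Gam)) =
              nl_sub (chart_nl c) (icontract (sval P))) &
       (exists! d_anis : anisconn A -> htensor (- 1) 3 A,
          forall (Gam : anisconn A) (c : chart M 'rV[R]_n)
                 (P : htensor 0 2 (A `&` TM_over (dom c))), atl c ->
            restr (res (dom c)) (sval Gam) =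
              anis_add (chart_anis c) (sval P) ->
            restr (res (dom c)) (sval (d_anis Gam)) = vdiff (sval P))]).
Proof.
have Hatl := smooth_manifold_atlas HM; have cover := smooth_manifold_cover HM.
have [oA _ _ kA] := HA.
split.
  move=> c c' ac ac' B G N Gam.
  have oB : nat_open B.
    by apply: (nat_open_TM_over HM) => //; apply: openI; exact: (chart_dom_open HM).
  have BC : B `<=` TM_over (dom c) by move=> v [_ []].
  have BC' : B `<=` TM_over (dom c') by move=> v [_ []].
  have HZ d : atl d -> B `<=` TM_over (dom d) -> exists! Z : htensor 2 0 B,
      sval G = spray_sub (chart_spray d) (tscale 2 (sval Z)).
    move=> ad BD; have [Z hZ GZ] := spray_decomposition Hatl ad oB BD (svalP G).
    exists (exist _ Z hZ); split=> // Z' GZ'; apply: sval_inj.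
    exact: (spray_sub_inj Hatl ad BD (etrans (esym GZ) GZ')).
  have HJ d : atl d -> B `<=` TM_over (dom d) -> exists! J : htensor 1 1 B,
      sval N = nl_sub (chart_nl d) (sval J).
    move=> ad BD; have [J hJ NJ] := nl_decomposition Hatl ad oB BD (svalP N).
    exists (exist _ J hJ); split=> // J' NJ'; apply: sval_inj.
    exact: (nl_sub_inj Hatl ad BD (etrans (esym NJ) NJ')).
  have HP d : atl d -> B `<=` TM_over (dom d) -> exists! P : htensor 0 2 B,
      sval Gam = anis_add (chart_anis d) (sval P).
    move=> ad BD; have [P hP GP] := anis_decomposition Hatl ad oB BD (svalP Gam).
    exists (exist _ P hP); split=> // P' GP'; apply: sval_inj.
    have [mP _ _] := hP; have [mP' _ _] := svalP P'.
    exact: (anis_add_inj Hatl ad BD mP mP' (etrans (esym GP) GP')).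
  split; [by split; exact: HZ | by split; exact: HJ | by split; exact: HP |].
  move=> Z Z' J J' P P' GZ GZ' NJ NJ' GP GP'.
  (* The agreement lemmas allow two domains, hence two membership proofs; on the single domain B
     these are identified by proof irrelevance. *)
  have aZ w (Bw B'w : B w) : spray_sub (chart_spray c) (tscale 2 (sval Z)) Bw =
      spray_sub (chart_spray c') (tscale 2 (sval Z')) B'w.
    rewrite (Prop_irrelevance B'w Bw).
    exact: (congr1 (fun X : spray_sec B => X w Bw) (etrans (esym GZ) GZ')).
  have aJ w (Bw B'w : B w) : nl_sub (chart_nl c) (sval J) Bw =
      nl_sub (chart_nl c') (sval J') B'w.
    rewrite (Prop_irrelevance B'w Bw).
    exact: (congr1 (fun X : nl_sec B => X w Bw) (etrans (esym NJ) NJ')).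
  have aP w (Bw B'w : B w) : anis_add (chart_anis c) (sval P) Bw =
      anis_add (chart_anis c') (sval P') B'w.
    rewrite (Prop_irrelevance B'w Bw).
    exact: (congr1 (fun X : anis_sec B => X w Bw) (etrans (esym GP) GP')).
  have [[mP _ _] [mP' _ _]] := (svalP P, svalP P').
  split; apply: functional_extensionality_dep => v; apply: functional_extensionality_dep => Bv;
    have [cv c'v] := (BC v Bv, BC' v Bv).
  - apply/funext => u.
    exact: (spray_vdiff_agree Hatl oB oB ac ac' (svalP Z) (svalP Z') aZ Bv Bv cv c'v u).
  - apply: (etrans (spray_icontract (sval J) c Bv)).
    apply: (etrans _ (esym (spray_icontract (sval J') c' Bv))).
    exact: (congr1 (fun X => X (tvect v)) (aJ v Bv Bv)).
  - exact: (nl_vdiff_agree Hatl oB oB ac ac' (svalP J) (svalP J') aJ Bv Bv cv c'v).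
  - exact: (anis_icontract_agree Hatl ac ac' (mP v Bv) (mP' v Bv) (aP v Bv Bv) cv c'v).
  - exact: (anis_vdiff_agree Hatl oB oB ac ac' (svalP P) (svalP P') aP Bv Bv cv c'v).
move=> res.
pose loc (c : chart M 'rV[R]_n) : set (TM atl) := A `&` TM_over (dom c).
have oL c : atl c -> nat_open (loc c) by exact: (nat_open_loc Hatl oA).
have kL c : conic (loc c) by move=> l v l0 [Av cv]; split=> //; exact: kA.
have LC c : loc c `<=` TM_over (dom c) by move=> v [].
have exZ (G : spray A) c : atl c -> exists Z : htensor 2 0 (loc c),
    restr (res (dom c)) (sval G) = spray_sub (chart_spray c) (tscale 2 (sval Z)).
  move=> ac; have rG := restr_is_spray Hatl (res (dom c)) (oL c ac) (svalP G).
  have [Z hZ GZ] := spray_decomposition Hatl ac (oL c ac) (@LC c) rG.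
  by exists (exist _ Z hZ).
have exJ (N : nlconn A) c : atl c -> exists J : htensor 1 1 (loc c),
    restr (res (dom c)) (sval N) = nl_sub (chart_nl c) (sval J).
  move=> ac; have rN := restr_is_nl Hatl (res (dom c)) (oL c ac) (svalP N).
  have [J hJ NJ] := nl_decomposition Hatl ac (oL c ac) (@LC c) rN.
  by exists (exist _ J hJ).
have exP (Gam : anisconn A) c : atl c -> exists P : htensor 0 2 (loc c),
    restr (res (dom c)) (sval Gam) = anis_add (chart_anis c) (sval P).
  move=> ac; have rG := restr_is_anis Hatl (res (dom c)) (oL c ac) (svalP Gam).
  have [P hP GP] := anis_decomposition Hatl ac (oL c ac) (@LC c) rG.
  by exists (exist _ P hP).
(* Local expressions of one global section coincide wherever both are defined, which is the
   hypothesis of the agreement lemmas. *)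
have agree (F : TM atl -> Type) (g : forall v, A v -> F v) c c'
    (f : forall v, loc c v -> F v) (f' : forall v, loc c' v -> F v) :
    restr (res (dom c)) g = f -> restr (res (dom c')) g = f' ->
    forall w Dw D'w, f w Dw = f' w D'w.
  by move=> <- <- w Dw D'w; rewrite /restr (Prop_irrelevance (res _ _ Dw) (res _ _ D'w)).
split.
- apply: (@exists_unique_map (spray A) (nlconn A) (fun G N =>
    forall c (Z : htensor 2 0 (loc c)), atl c ->
      restr (res (dom c)) (sval G) = spray_sub (chart_spray c) (tscale 2 (sval Z)) ->
      restr (res (dom c)) (sval N) = nl_sub (chart_nl c) (vdiff (sval Z)))) => G.
  apply: (@unique_gluing _ _ _ atl cover A _ (@is_nl _ _ _ _ A)
    (fun c => htensor 2 0 (loc c)) (fun c Z => restr (res (dom c)) (sval G) =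
       spray_sub (chart_spray c) (tscale 2 (sval Z)))
    (fun c Z => nl_sub (chart_nl c) (vdiff (sval Z)))).
  + exact: exZ.
  + move=> c c' Z Z' ac ac' GZ GZ' v Dv D'v; apply/funext => u.
    exact: (spray_vdiff_agree Hatl (oL c ac) (oL c' ac') ac ac' (svalP Z) (svalP Z')
      (agree _ _ c c' _ _ GZ GZ') Dv D'v Dv.2 D'v.2 u).
  + move=> N HN; apply: (nl_of_local Hatl cover oA) => c ac; have [Z _ NZ] := HN c ac.
    exists (vdiff (sval Z)) => //.
    (* The degree 2 - 1 computes to the required 1; the same happens to the other degrees below. *)
    exact: (vdiff_htensor Hatl cover (oL c ac) (kL c) (svalP Z)).
- apply: (@exists_unique_map (nlconn A) (spray A) (fun N G =>
    forall c (J : htensor 1 1 (loc c)), atl c ->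
      restr (res (dom c)) (sval N) = nl_sub (chart_nl c) (sval J) ->
      restr (res (dom c)) (sval G) = spray_sub (chart_spray c) (icontract (sval J)))) => N.
  apply: (@unique_gluing _ _ _ atl cover A _ (@is_spray _ _ _ _ A)
    (fun c => htensor 1 1 (loc c)) (fun c J => restr (res (dom c)) (sval N) =
       nl_sub (chart_nl c) (sval J))
    (fun c J => spray_sub (chart_spray c) (icontract (sval J)))).
  + exact: exJ.
  + move=> c c' J J' ac ac' NJ NJ' v Dv D'v.
    apply: (etrans (spray_icontract (sval J) c Dv)).
    apply: (etrans _ (esym (spray_icontract (sval J') c' D'v))).
    exact: (congr1 (fun X => X (tvect v)) (agree _ _ c c' _ _ NJ NJ' v Dv D'v)).
  + move=> G HG; apply: (spray_of_local Hatl cover oA) => c ac; have [J _ GJ] := HG c ac.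
    exists (icontract (sval J)) => //.
    exact: (icontract_htensor Hatl (oL c ac) (svalP J)).
- apply: (@exists_unique_map (nlconn A) (anisconn A) (fun N Gam =>
    forall c (J : htensor 1 1 (loc c)), atl c ->
      restr (res (dom c)) (sval N) = nl_sub (chart_nl c) (sval J) ->
      restr (res (dom c)) (sval Gam) = anis_add (chart_anis c) (vdiff (sval J)))) => N.
  apply: (@unique_gluing _ _ _ atl cover A _ (@is_anis _ _ _ _ A)
    (fun c => htensor 1 1 (loc c)) (fun c J => restr (res (dom c)) (sval N) =
       nl_sub (chart_nl c) (sval J))
    (fun c J => anis_add (chart_anis c) (vdiff (sval J)))).
  + exact: exJ.
  + move=> c c' J J' ac ac' NJ NJ' v Dv D'v.
    exact: (nl_vdiff_agree Hatl (oL c ac) (oL c' ac') ac ac' (svalP J) (svalP J')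
      (agree _ _ c c' _ _ NJ NJ') Dv D'v Dv.2 D'v.2).
  + move=> G HG; apply: (anis_of_local Hatl cover oA) => c ac; have [J _ GJ] := HG c ac.
    exists (vdiff (sval J)) => //.
    exact: (vdiff_htensor Hatl cover (oL c ac) (kL c) (svalP J)).
- apply: (@exists_unique_map (anisconn A) (nlconn A) (fun Gam N =>
    forall c (P : htensor 0 2 (loc c)), atl c ->
      restr (res (dom c)) (sval Gam) = anis_add (chart_anis c) (sval P) ->
      restr (res (dom c)) (sval N) = nl_sub (chart_nl c) (icontract (sval P)))) => Gam.
  apply: (@unique_gluing _ _ _ atl cover A _ (@is_nl _ _ _ _ A)
    (fun c => htensor 0 2 (loc c)) (fun c P => restr (res (dom c)) (sval Gam) =
       anis_add (chart_anis c) (sval P))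
    (fun c P => nl_sub (chart_nl c) (icontract (sval P)))).
  + exact: exP.
  + move=> c c' P P' ac ac' GP GP' v Dv D'v.
    have [[mP _ _] [mP' _ _]] := (svalP P, svalP P').
    exact: (anis_icontract_agree Hatl ac ac' (mP v Dv) (mP' v D'v)
      (agree _ _ c c' _ _ GP GP' v Dv D'v) Dv.2 D'v.2).
  + move=> N HN; apply: (nl_of_local Hatl cover oA) => c ac; have [P _ NP] := HN c ac.
    exists (icontract (sval P)) => //.
    exact: (icontract_htensor Hatl (oL c ac) (svalP P)).
- apply: (@exists_unique_map (anisconn A) (htensor (- 1) 3 A) (fun Gam T =>
    forall c (P : htensor 0 2 (loc c)), atl c ->
      restr (res (dom c)) (sval Gam) = anis_add (chart_anis c) (sval P) ->
      restr (res (dom c)) (sval T) = vdiff (sval P))) => Gam.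
  apply: (@unique_gluing _ _ _ atl cover A _ (@is_htensor _ _ _ _ (- 1) 3 A)
    (fun c => htensor 0 2 (loc c)) (fun c P => restr (res (dom c)) (sval Gam) =
       anis_add (chart_anis c) (sval P))
    (fun c P => vdiff (sval P))).
  + exact: exP.
  + move=> c c' P P' ac ac' GP GP' v Dv D'v.
    exact: (anis_vdiff_agree Hatl (oL c ac) (oL c' ac') ac ac' (svalP P) (svalP P')
      (agree _ _ c c' _ _ GP GP') Dv D'v Dv.2 D'v.2).
  + move=> T HT; apply: (htensor_of_local Hatl cover oA) => c ac; have [P _ TP] := HT c ac.
    exists (vdiff (sval P)) => //.
    exact: (vdiff_htensor Hatl cover (oL c ac) (kL c) (svalP P)).
Qed.
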